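(* Let $\Omega\subset\mathbb{R}^2$ be a bounded domain with boundary of class $C^2$, and let $K:[0,\infty)\to\mathbb{R}$ be a twice continuously differentiable function with $K(0)=\mu>0$. Suppose that the Laplace transform $\hat K(\lambda)$ of $K$ has at least one root $\lambda_0\neq 0$ in its domain of holomorphism. Then there exists an initial condition $\xi\in H^2(\Omega)\cap H^1_0(\Omega)$ such that for every $T>0$ and every control $u\in C(0,T;L_2(\Omega))$ with compact support in $\Omega$ (with respect to the variables $(x,y)$), the corresponding solution $\theta$ of the problem $$\theta_t(t,x,y)-\int_0^t K(t-s)\,\Delta\theta(s,x,y)\,ds=u(t,x,y),\quad t>0,\ (x,y)\in\Omega,$$ $$\theta|_{t=0}=\xi(x,y),\qquad \theta|_{\partial\Omega}=0,$$ does not have compact support in $t$. That is, the system is uncontrollable to rest by controls compactly supported in $\Omega$.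
   Context: Functions of $(x,y)$ are complex-valued. $\theta(t)$ and $u(t)$ denote $\theta(t,\cdot,\cdot)$ and $u(t,\cdot,\cdot)$, regarded as functions of $t$ with values in function spaces. Controls: $u\in C(0,T;L_2(\Omega))$ means that $u$ is continuous on $[0,T]$ with values in $L_2(\Omega)$; it is understood as a control on $[0,\infty)$ with compact support in $t$ by setting $u(t)=0$ for $t>T$. It has compact support in $\Omega$ (in $x,y$) if there is a compact set $D\subset\Omega$ (which may depend on $u$) such that for every $t$, $u(t)$ vanishes almost everywhere outside $D$. Solution: a function $\theta\in C^1(0,+\infty;L_2(\Omega))\cap C(0,+\infty;H^2(\Omega)\cap H^1_0(\Omega))$ (continuity being up to $t=0$) which satisfies the integrodifferential equation and the initial condition $\theta(0)=\xi$; the boundary condition is encoded in $\theta(t)\in H^1_0(\Omega)$. A solution has compact support in $t$ if there is $T_1>0$ with $\theta(t)=0$ for all $t\ge T_1$. Laplace transform: $\hat K(\lambda)=\int_0^\infty e^{-\lambda t}K(t)\,dt$. It is required that a domain of holomorphism of $\hat K$ exists: there is a connected open set $G\subset\mathbb{C}$ containing a half-plane $\{\operatorname{Re}\lambda>a\}$ on which the integral converges absolutely, such that $\hat K$ extends holomorphically to $G$ (the extension is still denoted $\hat K$). The hypothesis on roots means that $\hat K(\lambda_0)=0$ for some $\lambda_0\in G$, $\lambda_0\ne0$. The system is controllable to rest (with a given class of controls) if for every initial condition $\xi$ there is a control $u$ with compact support in $t$ such that the corresponding solution has compact support in $t$; it is uncontrollable to rest if there is an initial condition $\xi$ such that for every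 control $u$ in the class the corresponding solution does not have compact support in $t$. *)

(* Defs.v *)
From HB Require Import structures.
From mathcomp Require Import all_boot all_order all_algebra.
From mathcomp Require Import all_classical all_reals all_analysis.
From mathcomp Require Import complex.
Set Implicit Arguments.
Unset Strict Implicit.
Unset Printing Implicit Defensive.
Import Order.TTheory GRing.Theory Num.Theory.
Import numFieldNormedType.Exports.
Local Open Scope classical_set_scope.
Local Open Scope ring_scope.
Local Open Scope complex_scope.

(* The variables (x, y) range over R * R. Elements of L_2(Omega) are
   represented by functions R * R -> R[i] of which only the restriction to
   Omega matters, up to equality almost everywhere. *)

Notation planefun R := ((R * R)%type -> R[i]).

Notation leb2 R := ((@lebesgue_measure R) \x (@lebesgue_measure R))%E.

Definition cintegral d (T : measurableType d) (R : realType)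
    (mu : {measure set T -> \bar R}) (D : set T) (f : T -> R[i]) : R[i] :=
  (\int[mu]_(x in D) complex.Re (f x)) +i* (\int[mu]_(x in D) complex.Im (f x)).

Definition cmod (R : realType) (z : R[i]) : R :=
  Num.sqrt (complex.Re z ^+ 2 + complex.Im z ^+ 2).

Definition cexp (R : realType) (z : R[i]) : R[i] :=
  (expR (complex.Re z) * cos (complex.Im z))
    +i* (expR (complex.Re z) * sin (complex.Im z)).

Definition C2_line (R : realType) (g : R -> R) : Prop :=
  [/\ forall x, derivable g x 1, forall x, derivable (derive1 g) x 1 &
      continuous (derive1 (derive1 g))].

Definition bounded_domain (R : realType) (Omega : set (R * R)) : Prop :=
  [/\ open Omega, connected Omega, Omega !=set0 & bounded_set Omega].

(* Near each boundary point, after possibly exchanging the two coordinates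
   ([sw]) and reversing the sign of the second one ([sg]), Omega is the set of
   points strictly above the graph of a C^2 function. The ball is a square,
   the norm on R * R being the sup norm. *)
Definition C2_boundary (R : realType) (Omega : set (R * R)) : Prop :=
  forall p, closure Omega p -> ~ interior Omega p ->
  exists (g : R -> R) (r : R) (sw sg : bool),
    [/\ C2_line g, 0 < r &
      forall q : R * R, ball p r q ->
        (Omega q <-> g (if sw then q.2 else q.1)
                       < (-1) ^+ sg * (if sw then q.1 else q.2))].

(* Coordinates are indexed by [bool]: [false] for x, [true] for y. *)
Definition axis (R : realType) (i : bool) : R * R :=
  if i then (0, 1) else (1, 0).

Definition iter_partial (R : realType) (f : R * R -> R) (w : seq bool) :
    R * R -> R :=
  foldr (fun i (g : R * R -> R) => fun p => 'D_(axis R i) g p) f w.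

Definition smooth (R : realType) (f : R * R -> R) : Prop :=
  forall w : seq bool, continuous (iter_partial f w) /\
    forall (i : bool) (p : R * R), derivable (iter_partial f w) p (axis R i).

Definition partial (R : realType) (i : bool) (f : planefun R) : planefun R :=
  fun p => ('D_(axis R i) (fun q => complex.Re (f q)) p)
             +i* ('D_(axis R i) (fun q => complex.Im (f q)) p).

Definition test_function (R : realType) (Omega : set (R * R))
    (phi : planefun R) : Prop :=
  [/\ smooth (fun q => complex.Re (phi q)),
      smooth (fun q => complex.Im (phi q)) &
      exists D : set (R * R),
        [/\ compact D, D `<=` Omega & forall p, ~ D p -> phi p = 0]].

Definition ae_eq_on (R : realType) (Omega : set (R * R))
    (f g : planefun R) : Prop :=
  {ae (leb2 R), forall p, Omega p -> f p = g p}.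

Definition inL2 (R : realType) (Omega : set (R * R)) (f : planefun R) : Prop :=
  [/\ measurable_fun Omega (fun p => complex.Re (f p)),
      measurable_fun Omega (fun p => complex.Im (f p)) &
      (\int[leb2 R]_(p in Omega) (cmod (f p) ^+ 2)%R%:E < +oo)%E].

Definition L2norm (R : realType) (Omega : set (R * R)) (f : planefun R) : R :=
  Num.sqrt (\int[leb2 R]_(p in Omega) (cmod (f p) ^+ 2)).

Definition weak_partial (R : realType) (Omega : set (R * R)) (i : bool)
    (f g : planefun R) : Prop :=
  forall phi, test_function Omega phi ->
    cintegral (leb2 R) Omega (fun p => f p * partial i phi p)
    = - cintegral (leb2 R) Omega (fun p => g p * phi p).

(* A representative of the weak derivative in L_2(Omega); it is unique almost
   everywhere, and has no meaning when there is no such weak derivative. *)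
Definition wD (R : realType) (Omega : set (R * R)) (i : bool)
    (f : planefun R) : planefun R :=
  xget (fun=> 0) [set g | inL2 Omega g /\ weak_partial Omega i f g].

Definition inH1 (R : realType) (Omega : set (R * R)) (f : planefun R) : Prop :=
  inL2 Omega f /\
  forall i, exists g, inL2 Omega g /\ weak_partial Omega i f g.

Definition inH2 (R : realType) (Omega : set (R * R)) (f : planefun R) : Prop :=
  inH1 Omega f /\ forall i, inH1 Omega (wD Omega i f).

Definition H1norm (R : realType) (Omega : set (R * R)) (f : planefun R) : R :=
  Num.sqrt (L2norm Omega f ^+ 2 + \sum_(i : bool) L2norm Omega (wD Omega i f) ^+ 2).

Definition H2norm (R : realType) (Omega : set (R * R)) (f : planefun R) : R :=
  Num.sqrt (H1norm Omega f ^+ 2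
    + \sum_(i : bool) \sum_(j : bool)
        L2norm Omega (wD Omega j (wD Omega i f)) ^+ 2).

Definition inH10 (R : realType) (Omega : set (R * R)) (f : planefun R) : Prop :=
  inH1 Omega f /\
  forall e : R, 0 < e -> exists phi, test_function Omega phi /\
    H1norm Omega (fun p => f p - phi p) < e.

Definition laplacian (R : realType) (Omega : set (R * R))
    (f : planefun R) : planefun R :=
  fun p => \sum_(i : bool) wD Omega i (wD Omega i f) p.

Definition continuous_for (R : realType) (N : planefun R -> R) (A : set R)
    (g : R -> planefun R) : Prop :=
  forall t, A t ->
    N (fun p => g s p - g t p) @[s --> within A (nbhs t)] --> (0 : R).

(* [N] is a norm on functions of (x, y). The difference quotient is taken
   within [0, +oo), hence one-sided at t = 0. *)
Definition derivative_for (R : realType) (N : planefun R -> R)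
    (g g' : R -> planefun R) : Prop :=
  forall t, 0 <= t ->
    N (fun p => ((s - t)^-1)%:C * (g s p - g t p) - g' t p)
      @[s --> within [set s : R | 0 <= s] (t^')] --> (0 : R).

(* [v] is the Riemann integral over [a, b] of the L_2(Omega)-valued [g]:
   the limit in L_2(Omega) of the Riemann sums over the partitions
   a = x 0 <= ... <= x n = b with tags tau i in [x i, x i.+1], as the mesh
   tends to 0. *)
Definition is_L2_integral (R : realType) (Omega : set (R * R)) (a b : R)
    (g : R -> planefun R) (v : planefun R) : Prop :=
  inL2 Omega v /\
  forall e : R, 0 < e -> exists2 d : R, 0 < d &
  forall (n : nat) (x tau : nat -> R),
    x 0%N = a -> x n = b ->
    (forall i : nat, (i < n)%N ->
       x i <= tau i <= x i.+1 /\ x i.+1 - x i < d) ->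
    L2norm Omega
      (fun p => \sum_(i < n) (x i.+1 - x i)%:C * g (tau i) p - v p) < e.

Definition derivative_halfline (R : realType) (K K' : R -> R) : Prop :=
  forall t, 0 <= t ->
    (s - t)^-1 * (K s - K t)
      @[s --> within [set s : R | 0 <= s] (t^')] --> K' t.

Definition C2_halfline (R : realType) (K : R -> R) : Prop :=
  exists K1 K2 : R -> R,
    [/\ derivative_halfline K K1, derivative_halfline K1 K2 &
        {within [set t : R | 0 <= t], continuous K2}].

Definition laplace (R : realType) (K : R -> R) (lambda : R[i]) : R[i] :=
  cintegral (@lebesgue_measure R) [set t : R | 0 <= t]
    (fun t => cexp (- lambda * t%:C) * (K t)%:C).

Definition laplace_abs_cv (R : realType) (K : R -> R) (lambda : R[i]) : Prop :=
  (\int[@lebesgue_measure R]_(t in [set t : R | (0 <= t)%R])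
     (cmod (cexp (- lambda * t%:C) * (K t)%:C)%R)%:E < +oo)%E.

(* [G] is a domain of holomorphism of the Laplace transform of [K], and [Khat]
   its extension to [G]; holomorphy is complex differentiability on [G]. *)
Definition laplace_extension (R : realType) (K : R -> R) (G : set R[i]^o)
    (Khat : R[i]^o -> R[i]^o) : Prop :=
  [/\ open G, connected G, forall z, G z -> derivable Khat z 1 &
      exists a : R, forall z : R[i], a < complex.Re z ->
        [/\ G z, laplace_abs_cv K z & Khat z = laplace K z]].

Definition control (R : realType) (Omega : set (R * R)) (T : R)
    (u : R -> planefun R) : Prop :=
  [/\ forall t, 0 <= t -> inL2 Omega (u t),
      continuous_for (L2norm Omega) `[0, T] u,
      forall t, T < t -> ae_eq_on Omega (u t) (fun=> 0) &
      exists D : set (R * R), [/\ compact D, D `<=` Omega &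
        forall t, 0 <= t -> ae_eq_on (Omega `\` D) (u t) (fun=> 0)]].

Definition solution (R : realType) (Omega : set (R * R)) (K : R -> R)
    (xi : planefun R) (u theta : R -> planefun R) : Prop :=
  [/\ forall t, 0 <= t -> inH2 Omega (theta t) /\ inH10 Omega (theta t),
      continuous_for (H2norm Omega) [set t : R | 0 <= t] theta,
      ae_eq_on Omega (theta 0) xi &
      exists theta' : R -> planefun R,
        [/\ forall t, 0 <= t -> inL2 Omega (theta' t),
            derivative_for (L2norm Omega) theta theta',
            continuous_for (L2norm Omega) [set t : R | 0 <= t] theta' &
            forall t, 0 < t -> exists2 I : planefun R,
              is_L2_integral Omega 0 t
                (fun s p => (K (t - s))%:C * laplacian Omega (theta s) p) I &
              ae_eq_on Omega (fun p => theta' t p - I p) (u t)]].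

Definition compact_support_in_time (R : realType) (Omega : set (R * R))
    (theta : R -> planefun R) : Prop :=
  exists2 T1 : R, 0 < T1 &
    forall t, T1 <= t -> ae_eq_on Omega (theta t) (fun=> 0).

(* Main.v *)
(** The initial datum is [xi = sum_k r_k^2 zeta_k], where the [zeta_k] are
    rescaled copies of one smooth bump living in disjoint squares of half-side
    [r_k -> 0] that accumulate at a boundary point of [Omega].

    Suppose a solution [theta] vanishes for [t >= T1], the control being
    supported in the compact set [D].  For a test function [eta] supported in
    [Omega \ D] put [h_eta(t) = <theta(t), eta>].  Transposing the Laplacian,
    [h_eta' = K * h_(Lap eta)], so that the entire functions
    [H_eta = Laplace transform of h_eta] satisfy
    [z H_eta(z) - <xi, eta> = Khat(z) H_(Lap eta)(z)], first in a half-plane and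
    then on [G] by the identity theorem.  Since [Khat(lambda0) = 0], the ratio of
    the two sides for one fixed [eta] with [<xi, eta> <> 0] determines the
    leading behaviour of [Khat] at [lambda0], and hence a Taylor coefficient of
    every [H_eta] at [lambda0] as [a <xi, eta> + b <xi, Lap eta>] with [b <> 0]
    independent of [eta].  For [eta = Lap zeta_k] this coefficient is
    [O(||zeta_k||_2) = O(r_k)], because [Lap theta] is bounded in [L_2] on
    [0, T1]; but [<xi, Lap zeta_k> = O(r_k)] while
    [<xi, Lap^2 zeta_k> = r_k^2 ||Lap zeta_k||_2^2] stays away from zero. *)
Require Import Defs.
From HB Require Import structures.
From mathcomp Require Import all_boot all_order all_algebra.
From mathcomp Require Import all_classical all_reals all_analysis.
From mathcomp Require Import measurable_realfun complex ring lra.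
Set Implicit Arguments.
Unset Strict Implicit.
Unset Printing Implicit Defensive.
Import Order.TTheory GRing.Theory Num.Theory.
Import numFieldNormedType.Exports ComplexField.Normc.
Local Open Scope classical_set_scope.
Local Open Scope ring_scope.
Local Open Scope complex_scope.

(** * Complex differentiability and the identity theorem *)

(** The exponents are forced by scaling. Each derivative of a bump of half-side [r] costs a factor
    [1 / r], and integration over its square gains [r ^ 2]; the weight [r ^ 2] is the one that keeps
    the second derivatives of the datum bounded while its pairing with two Laplacians of the bump
    does not decay. The datum must be fixed before the control is known: since the bumps run into a
    boundary point, whatever compact [D] a control occupies, all but finitely many bumps lie off it.
    [Khat] is never expanded at [lambda0]. Its order of vanishing [m] and leading coefficient are
    read off from the quotient of two entire functions attached to one test function. They then
    serve for all test functions, and [m] is the index of the Taylor coefficient that is used. The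
    quotient makes sense because one of these functions takes the value [- <xi, eta>] at 0, so that
    it is not identically zero. The condition [lambda0 != 0] allows the recursion between Taylor
    coefficients to be solved: each one is obtained from the preceding one by dividing by
    [lambda0]. *)

Section complex_norm.
Variable R : realType.
Implicit Types z w : R[i].

Lemma normc_ge0 z : 0 <= normc z.
Proof. by case: z => a b; exact: sqrtr_ge0. Qed.

Lemma normr_normc z : `|z| = (normc z)%:C.
Proof. by []. Qed.

Lemma normc_gt0 z : z != 0 -> 0 < normc z.
Proof.
move=> z0; rewrite lt_neqAle normc_ge0 andbT eq_sym.
by apply: contraNneq z0 => /eq0_normc ->.
Qed.

Lemma normcB z w : normc (z - w) = normc (w - z).
Proof. by rewrite -normcN opprB. Qed.

Lemma le_normcB z w : normc (z - w) <= normc z + normc w.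
Proof. by rewrite -(normcN w) le_normcD. Qed.

Lemma normc_triangle z w t : normc (z - w) <= normc (z - t) + normc (t - w).
Proof. by rewrite -(subrKA t) le_normcD. Qed.

Lemma le_Re_normc z : `|complex.Re z| <= normc z.
Proof.
case: z => a b /=; rewrite -sqrtr_sqr ler_wsqrtr// lerDl sqr_ge0 //.
Qed.

Lemma le_Im_normc z : `|complex.Im z| <= normc z.
Proof.
case: z => a b /=; rewrite -sqrtr_sqr ler_wsqrtr// lerDr sqr_ge0 //.
Qed.

Lemma normc_le_ReIm z : normc z <= `|complex.Re z| + `|complex.Im z|.
Proof.
case: z => a b /=; rewrite -[leRHS]ger0_norm ?addr_ge0//.
rewrite -sqrtr_sqr ler_wsqrtr// sqrrD -!normrX.
by rewrite -addrA [X in _ <= _ + X]addrC addrA ger0_norm ?sqr_ge0// ger0_norm ?sqr_ge0// lerDl mulrn_wge0// mulr_ge0.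
Qed.

Lemma normc_real (x : R) : normc x%:C = `|x|.
Proof. by rewrite /normc/= expr0n/= addr0 sqrtr_sqr. Qed.

Lemma normcX z n : normc (z ^+ n) = normc z ^+ n.
Proof.
elim: n => [|n IH]; first by rewrite !expr0 normc1.
by rewrite !exprS normcM IH.
Qed.

Lemma gt0_complexE (e : R[i]) : 0 < e -> exists2 d : R, 0 < d & e = d%:C.
Proof.
case: e => a b; rewrite ltcE/= => /andP[/eqP -> a0]; by exists a.
Qed.

Lemma nbhs_normcP (z : R[i]^o) (A : set R[i]^o) : nbhs z A <->
  exists2 d : R, 0 < d & forall w : R[i], normc (w - z) < d -> A w.
Proof.
split=> [/nbhs_ballP[e /= /gt0_complexE [d d0 ->] H]|[d d0 H]].
  exists d => // w wd; apply: H; rewrite -ball_normE /= -opprB normrN normr_normc.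
  by rewrite ltcR.
apply/nbhs_ballP; exists d%:C; first by rewrite /= ltcR.
move=> w; rewrite -ball_normE/= -opprB normrN normr_normc ltcR; exact: H.
Qed.

Lemma open_normcP (A : set R[i]^o) : open A <-> forall z, A z ->
  exists2 d : R, 0 < d & forall w : R[i], normc (w - z) < d -> A w.
Proof.
rewrite openE; split=> H z Az; first by apply/nbhs_normcP; exact: H.
by apply/nbhs_normcP; exact: H.
Qed.

(** Differentiability with derivative [L], multiplied out: the radii are real and no quotient
    occurs, so that [w = z] needs no separate treatment. *)
Definition cdiff_at (f : R[i] -> R[i]) (z L : R[i]) :=
  forall e : R, 0 < e -> exists2 d : R, 0 < d &
    forall w, normc (w - z) < d ->
      normc (f w - f z - L * (w - z)) <= e * normc (w - z).

Lemma derivable_cdiff (f : R[i]^o -> R[i]^o) (z : R[i]^o) :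
  derivable f z 1 <-> exists L, cdiff_at f z L.
Proof.
split.
  move=> /cvg_ex[L /cvgrPdist_lt HL]; exists L => e e0.
  have /HL : 0 < e%:C by rewrite ltcR.
  move=> /nbhs_normcP[d d0 H]; exists d => // w wd.
  have [->|wz] := eqVneq w z; first by rewrite !subrr mulr0 subrr normc0 mulr0.
  have wz0 : w - z != 0 by rewrite subr_eq0.
  have /= := H (w - z); rewrite subr0 => /(_ wd wz0).
  rewrite [(w - z) *: 1]mulr1 subrK normr_normc ltcR => /ltW.
  rewrite [normc (L - _)]normcB.
  move=> /(ler_wpM2r (normc_ge0 (w - z))); rewrite -normcM mulrBl.
  by rewrite [_ *: _]mulrC mulfVK.
move=> [L HL]; apply/cvg_ex; exists L; apply/cvgrPdist_lt => e /gt0_complexE[d d0 ->].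
(* Halving [d] turns the non-strict bound of [cdiff_at] into the strict one required by the
   limit. *)
have [k k0 H] := HL (d / 2) (divr_gt0 d0 (ltr0n _ 2)).
apply/nbhs_normcP; exists k => // h; rewrite subr0 => hk /= h0.
rewrite normr_normc ltcR normcB [h *: 1]mulr1.
have := H (h + z); rewrite addrK => /(_ hk).
have nh := normc_gt0 h0; rewrite -ler_pdivrMr// -normcV -normcM mulrBl mulfK//.
rewrite [_ *: _]mulrC => /le_lt_trans; apply.
by rewrite ltr_pdivrMr// ltr_pMr// ltr1n.
Qed.

Lemma cdiff_cont (f : R[i] -> R[i]) z L : cdiff_at f z L ->
  forall e : R, 0 < e -> exists2 d : R, 0 < d &
    forall w, normc (w - z) < d -> normc (f w - f z) < e.
Proof.
move=> H e e0; have [d d0 Hd] := H 1 ltr01.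
have L0 := normc_ge0 L.
have L1 : 0 < 1 + normc L by rewrite ltr_pwDl.
exists (Num.min d (e / (1 + normc L))); first by rewrite lt_min d0 divr_gt0.
move=> w; rewrite lt_min => /andP[wd].
rewrite ltr_pdivlMr// mulrC => we; apply: le_lt_trans we.
rewrite mulrDl -normcM -(subrK (L * (w - z)) (f w - f z)).
by apply: le_trans (le_normcD _ _) _; rewrite lerD2r Hd.
Qed.

End complex_norm.

Section cintegral_theory.
Context d (T : measurableType d) (R : realType).
Variables (mu : {measure set T -> \bar R}) (D : set T).
Hypothesis mD : measurable D.
Implicit Types f g : T -> R[i].

Definition cintegrable f :=
  mu.-integrable D (EFin \o (fun x => complex.Re (f x))) /\
  mu.-integrable D (EFin \o (fun x => complex.Im (f x))).

Lemma eq_complexP (z w : R[i]) :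
  complex.Re z = complex.Re w -> complex.Im z = complex.Im w -> z = w.
Proof. by case: z => a b; case: w => a' b' /= -> ->. Qed.

Lemma integrable_addr (f g : T -> R) : mu.-integrable D (EFin \o f) ->
  mu.-integrable D (EFin \o g) -> mu.-integrable D (EFin \o (fun x => f x + g x)).
Proof. by move=> hf hg; have := integrableD mD hf hg. Qed.

Lemma integrable_subr (f g : T -> R) : mu.-integrable D (EFin \o f) ->
  mu.-integrable D (EFin \o g) -> mu.-integrable D (EFin \o (fun x => f x - g x)).
Proof. by move=> hf hg; have := integrableB mD hf hg. Qed.

Lemma integrable_mulr (c : R) (f : T -> R) : mu.-integrable D (EFin \o f) ->
  mu.-integrable D (EFin \o (fun x => c * f x)).
Proof. by move=> hf; have := integrableZl mD c hf. Qed.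

Lemma cintegrableD f g : cintegrable f -> cintegrable g ->
  cintegrable (fun x => f x + g x).
Proof.
move=> [f1 f2] [g1 g2]; split.
  rewrite (_ : (fun _ => _) = (fun x => complex.Re (f x) + complex.Re (g x))).
    exact: integrable_addr.
  by apply/funext => x; case: (f x); case: (g x).
rewrite (_ : (fun _ => _) = (fun x => complex.Im (f x) + complex.Im (g x))).
  exact: integrable_addr.
by apply/funext => x; case: (f x); case: (g x).
Qed.

Lemma cintegralD f g : cintegrable f -> cintegrable g ->
  cintegral mu D (fun x => f x + g x) = cintegral mu D f + cintegral mu D g.
Proof.
move=> [f1 f2] [g1 g2]; apply: eq_complexP => /=.
  rewrite -RintegralD//; apply: eq_Rintegral => x _; by case: (f x); case: (g x).
rewrite -RintegralD//; apply: eq_Rintegral => x _; by case: (f x); case: (g x).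
Qed.

Lemma cReM (z w : R[i]) : complex.Re (z * w) =
  complex.Re z * complex.Re w - complex.Im z * complex.Im w.
Proof. by case: z; case: w. Qed.

Lemma cImM (z w : R[i]) : complex.Im (z * w) =
  complex.Re z * complex.Im w + complex.Im z * complex.Re w.
Proof. by case: z => a b; case: w. Qed.

Lemma cintegrableZ (c : R[i]) f : cintegrable f -> cintegrable (fun x => c * f x).
Proof.
move=> [f1 f2]; split; under eq_fun do rewrite ?cReM ?cImM.
  by apply: integrable_subr; exact: integrable_mulr.
by apply: integrable_addr; exact: integrable_mulr.
Qed.

Lemma cintegralZ (c : R[i]) f : cintegrable f ->
  cintegral mu D (fun x => c * f x) = c * cintegral mu D f.
Proof.
move=> [f1 f2]; apply: eq_complexP; rewrite ?cReM ?cImM /=.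
  under eq_Rintegral do rewrite cReM.
  by rewrite RintegralB ?RintegralZl//; exact: integrable_mulr.
under eq_Rintegral do rewrite cImM.
by rewrite RintegralD ?RintegralZl//; exact: integrable_mulr.
Qed.

Lemma cintegrableB f g : cintegrable f -> cintegrable g ->
  cintegrable (fun x => f x - g x).
Proof.
move=> hf hg; have := cintegrableD hf (cintegrableZ (-1) hg).
by under eq_fun do rewrite mulN1r.
Qed.

Lemma cintegralB f g : cintegrable f -> cintegrable g ->
  cintegral mu D (fun x => f x - g x) = cintegral mu D f - cintegral mu D g.
Proof.
move=> hf hg; have := cintegralD hf (cintegrableZ (-1) hg).
by rewrite cintegralZ// mulN1r => <-; congr cintegral; apply/funext => x; rewrite mulN1r.
Qed.

(** The factor 2 comes from estimating the real and the imaginary part separately. It is carried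
    through the later estimates, which only need some constant. *)
Lemma le_normc_cintegral f (g : T -> R) : cintegrable f ->
  mu.-integrable D (EFin \o g) -> (forall x, D x -> normc (f x) <= g x) ->
  normc (cintegral mu D f) <= 2 * \int[mu]_(x in D) g x.
Proof.
move=> [f1 f2] hg fg; apply: le_trans (normc_le_ReIm _) _ => /=.
rewrite mulrDl mul1r lerD//.
  apply: le_trans (le_normr_Rintegral mD f1) _.
  apply: le_Rintegral => //; first exact: (integrable_norm f1).
  by move=> x Dx; apply: le_trans (fg x Dx); exact: le_Re_normc.
apply: le_trans (le_normr_Rintegral mD f2) _.
apply: le_Rintegral => //; first exact: (integrable_norm f2).
by move=> x Dx; apply: le_trans (fg x Dx); exact: le_Im_normc.
Qed.

Lemma eq_cintegral f g : (forall x, D x -> f x = g x) ->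
  cintegral mu D f = cintegral mu D g.
Proof.
move=> fg; apply: eq_complexP => /=; apply: eq_Rintegral => x /set_mem Dx;
  by rewrite fg.
Qed.

End cintegral_theory.

Section interval_integral.
Variable R : realType.
Notation mu := (@lebesgue_measure R).
Implicit Types (f g : R -> R[i]) (a b c : R).

Definition ccont f a b :=
  {within `[a, b], continuous (fun x => complex.Re (f x))} /\
  {within `[a, b], continuous (fun x => complex.Im (f x))}.

Lemma continuous_itv_integrable (f : R -> R) a b :
  {within `[a, b], continuous f} -> mu.-integrable `[a, b] (EFin \o f).
Proof. by apply: continuous_compact_integrable; exact: segment_compact. Qed.

Lemma ccont_integrable f a b : ccont f a b -> cintegrable mu `[a, b] f.
Proof. by move=> [h1 h2]; split; exact: continuous_itv_integrable. Qed.

Lemma Rintegral_itv_cst a b (k : R) : a <= b -> \int[mu]_(x in `[a, b]) k = k * (b - a).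
Proof.
move=> ab; rewrite Rintegral_cst//= lebesgue_measure_itv/= lte_fin.
case: ltP => [_|ba]; first by rewrite -EFinB.
by rewrite (_ : b = a) ?subrr//; apply/le_anti; rewrite ab ba.
Qed.

Lemma integrable_itv_cst a b (k : R) : mu.-integrable `[a, b] (EFin \o cst k).
Proof. by apply: continuous_itv_integrable => x; exact: cvg_cst. Qed.

(** Made for Goursat's theorem: there [k] is the difference between the values of an affine function
    on opposite sides of a rectangle, which is constant along the side. *)
Lemma cintegral_itv_near_cst f a b (k : R[i]) (M : R) : a <= b ->
  ccont f a b -> (forall x, a <= x <= b -> normc (f x - k) <= M) ->
  normc (cintegral mu `[a, b] f - k * (b - a)%:C) <= 2 * (M * (b - a)).
Proof.
move=> ab cf H.
have kk : cintegrable mu `[a, b] (fun=> k) by split; exact: integrable_itv_cst.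
have -> : k * (b - a)%:C = cintegral mu `[a, b] (fun=> k).
  apply: eq_complexP; rewrite ?cReM ?cImM/= Rintegral_itv_cst// mulr0 ?subr0 ?add0r//.
rewrite -cintegralB//; last exact: ccont_integrable.
rewrite -(Rintegral_itv_cst M ab); apply: le_normc_cintegral => //.
- by apply: cintegrableB => //; exact: ccont_integrable.
- exact: integrable_itv_cst.
Qed.

Lemma cintegral_itv_bound f a b (M : R) : a <= b ->
  ccont f a b -> (forall x, a <= x <= b -> normc (f x) <= M) ->
  normc (cintegral mu `[a, b] f) <= 2 * (M * (b - a)).
Proof.
move=> ab cf H; have := @cintegral_itv_near_cst f a b 0 M ab cf.
by rewrite mul0r subr0; apply => x /H; rewrite subr0.
Qed.

Lemma Rintegral_itv_split (f : R -> R) a b c : a <= c -> c <= b ->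
  mu.-integrable `[a, b] (EFin \o f) ->
  \int[mu]_(x in `[a, b]) f x =
  \int[mu]_(x in `[a, c]) f x + \int[mu]_(x in `[c, b]) f x.
Proof.
move=> ac cb hf; apply/eqP; rewrite addrC -subr_eq; apply/eqP.
rewrite Rintegral_itvB ?bnd_simp// Rintegral_itv_obnd_cbnd//.
apply: integrableS hf => //; apply: subset_itv; rewrite bnd_simp//.
Qed.

Lemma cintegral_itv_split f a b c : a <= c -> c <= b -> ccont f a b ->
  cintegral mu `[a, b] f = cintegral mu `[a, c] f + cintegral mu `[c, b] f.
Proof.
move=> ac cb /ccont_integrable[h1 h2].
by apply: eq_complexP; exact: Rintegral_itv_split.
Qed.

End interval_integral.

(** * Contour integrals over the boundary of a rectangle *)

Section goursat.
Variable R : realType.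
Notation mu := (@lebesgue_measure R).
Implicit Types (f g : R[i] -> R[i]) (a b c d : R).

Definition cont_at f (z : R[i]) := forall e : R, 0 < e -> exists2 d : R, 0 < d &
    forall w, normc (w - z) < d -> normc (f w - f z) < e.

Definition rect a b c d (z : R[i]) :=
  (a <= complex.Re z <= b) && (c <= complex.Im z <= d).

(** The counterclockwise contour integral. Opposite sides share one integral, so that the integrand
    is a difference in which affine parts of [f] become constants. *)
Definition rect_integral f a b c d : R[i] :=
  cintegral mu `[a, b] (fun x => f (x +i* c) - f (x +i* d)) +
  'i * cintegral mu `[c, d] (fun y => f (b +i* y) - f (a +i* y)).

Lemma ccont_path f (g : R -> R[i]) a b :
  (forall x y, normc (g x - g y) <= `|x - y|) ->
  (forall x, a <= x <= b -> cont_at f (g x)) -> ccont (fun x => f (g x)) a b.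
Proof.
move=> gL H.
have K x : x \in `[a, b]%classic -> forall e : R, 0 < e -> \forall y \near x,
    normc (f (g y) - f (g x)) < e.
  move=> /set_mem/=; rewrite in_itv/= => /H Hx e e0.
  have [k k0 Hk] := Hx e e0.
  near=> y; apply: Hk; apply: le_lt_trans (gL _ _) _.
  near: y; apply/nbhs_ballP; exists k => //= y.
  by rewrite -ball_normE/= distrC.
split; apply: continuous_in_subspaceT => x /K xab; apply/cvgrPdist_lt => e e0;
  have := xab e e0; apply: filterS => y; rewrite distrC; apply: le_lt_trans.
  apply: le_trans (le_Re_normc _).
  by case: (f (g y)); case: (f (g x)) => //.
apply: le_trans (le_Im_normc _).
by case: (f (g y)); case: (f (g x)) => //.
Unshelve. all: by end_near. Qed.

Lemma ccont_hor f a b c : (forall x, a <= x <= b -> cont_at f (x +i* c)) ->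
  ccont (fun x => f (x +i* c)) a b.
Proof.
apply: ccont_path => x y; apply: le_trans (normc_le_ReIm _) _ => /=.
by rewrite subrr normr0 addr0.
Qed.

Lemma ccont_ver f a b c : (forall x, a <= x <= b -> cont_at f (c +i* x)) ->
  ccont (fun x => f (c +i* x)) a b.
Proof.
apply: ccont_path => x y; apply: le_trans (normc_le_ReIm _) _ => /=.
by rewrite subrr normr0 add0r.
Qed.

Lemma ccontB (f g : R -> R[i]) a b : ccont f a b -> ccont g a b ->
  ccont (fun x => f x - g x) a b.
Proof.
move=> [f1 f2] [g1 g2]; split=> x.
  rewrite (_ : (fun _ => _) = (fun x => complex.Re (f x) - complex.Re (g x))).
    by apply: continuousB; [exact: f1|exact: g1].
  by apply/funext => y; case: (f y); case: (g y).
rewrite (_ : (fun _ => _) = (fun x => complex.Im (f x) - complex.Im (g x))).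
  by apply: continuousB; [exact: f2|exact: g2].
by apply/funext => y; case: (f y); case: (g y).
Qed.

Lemma rect_integral_splitx f a b c d m : a <= m -> m <= b -> c <= d ->
  (forall z, rect a b c d z -> cont_at f z) ->
  rect_integral f a b c d = rect_integral f a m c d + rect_integral f m b c d.
Proof.
move=> am mb cd H.
have V x : a <= x <= b -> ccont (fun y => f (x +i* y)) c d.
  by move=> xab; apply: ccont_ver => y yab; apply: H; rewrite /rect/= xab.
rewrite /rect_integral (@cintegral_itv_split _ _ a b m)//; last first.
  by apply: ccontB; apply: ccont_hor => x xab; apply: H; rewrite /rect/= xab lexx /= ?andbT.
rewrite addrACA; congr (_ + _); rewrite -mulrDr; congr (_ * _).
have Vb : a <= b <= b by rewrite lexx (le_trans am).
have Va : a <= a <= b by rewrite lexx (le_trans am).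
have Vm : a <= m <= b by rewrite am mb.
rewrite -cintegralD//.
- by apply: eq_cintegral => y _; ring.
- by apply: ccont_integrable; apply: ccontB; exact: V.
- by apply: ccont_integrable; apply: ccontB; exact: V.
Qed.

Lemma rect_integral_splity f a b c d m : c <= m -> m <= d -> a <= b ->
  (forall z, rect a b c d z -> cont_at f z) ->
  rect_integral f a b c d = rect_integral f a b c m + rect_integral f a b m d.
Proof.
move=> cm md ab H.
have V y : c <= y <= d -> ccont (fun x => f (x +i* y)) a b.
  by move=> yab; apply: ccont_hor => x xab; apply: H; rewrite /rect/= xab.
rewrite /rect_integral (@cintegral_itv_split _ _ c d m)//; last first.
  by apply: ccontB; apply: ccont_ver => x xab; apply: H; rewrite /rect/= xab lexx /= ?andbT.
rewrite addrACA mulrDr; congr (_ + _).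
have Vb : c <= c <= d by rewrite lexx (le_trans cm).
have Va : c <= d <= d by rewrite lexx (le_trans cm).
have Vm : c <= m <= d by rewrite cm md.
rewrite -cintegralD//.
- by apply: eq_cintegral => y _; ring.
- by apply: ccont_integrable; apply: ccontB; exact: V.
- by apply: ccont_integrable; apply: ccontB; exact: V.
Qed.

(** Hypotheses are later placed on the boundary only, because the Cauchy kernel is singular at the
    centre of its square. *)
Definition edge a b c d (z : R[i]) :=
  ((a <= complex.Re z <= b) && ((complex.Im z == c) || (complex.Im z == d))) ||
  ((c <= complex.Im z <= d) && ((complex.Re z == a) || (complex.Re z == b))).

Section edge_continuity.
Variables (f : R[i] -> R[i]) (a b c d : R).
Hypothesis fc : forall z, edge a b c d z -> cont_at f z.

Lemma ccont_edge_h : ccont (fun x => f (x +i* c) - f (x +i* d)) a b.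
Proof.
by apply: ccontB; apply: ccont_hor => x xab; apply: fc; rewrite /edge/= xab eqxx ?orbT.
Qed.

Lemma ccont_edge_v : ccont (fun y => f (b +i* y) - f (a +i* y)) c d.
Proof.
by apply: ccontB; apply: ccont_ver => x xab; apply: fc; rewrite /edge/= xab eqxx ?orbT.
Qed.

Lemma rect_integral_bound M : a <= b -> c <= d ->
  (forall z, edge a b c d z -> normc (f z) <= M) ->
  normc (rect_integral f a b c d) <= 4 * M * (b - a + (d - c)).
Proof.
move=> ab cd B.
apply: le_trans (le_normcD _ _) _.
rewrite normcM (_ : normc 'i = 1) ?mul1r; last first.
  by rewrite /= expr0n expr1n add0r sqrtr1.
rewrite mulrDr lerD//.
  rewrite (_ : 4 * M * (b - a) = 2 * ((2 * M) * (b - a))); last by ring.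
  apply: cintegral_itv_bound => //; first exact: ccont_edge_h.
  move=> x xab; rewrite mulrDl mul1r; apply: le_trans (le_normcB _ _) _.
  by apply: lerD; apply: B; rewrite /edge/= xab eqxx ?orbT.
rewrite (_ : 4 * M * (d - c) = 2 * ((2 * M) * (d - c))); last by ring.
apply: cintegral_itv_bound => //; first exact: ccont_edge_v.
move=> x xab; rewrite mulrDl mul1r; apply: le_trans (le_normcB _ _) _.
by apply: lerD; apply: B; rewrite /edge/= xab eqxx ?orbT.
Qed.

Lemma rect_integralZ (k : R[i]) :
  rect_integral (fun z => k * f z) a b c d = k * rect_integral f a b c d.
Proof.
rewrite /rect_integral mulrDr mulrCA; congr (_ + _ * _).
  rewrite -cintegralZ//; first by apply: eq_cintegral => x _; ring.
  by apply: ccont_integrable; exact: ccont_edge_h.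
rewrite -cintegralZ//; first by apply: eq_cintegral => x _; ring.
by apply: ccont_integrable; exact: ccont_edge_v.
Qed.

End edge_continuity.

Lemma rect_integralB f g a b c d :
  (forall z, edge a b c d z -> cont_at f z) ->
  (forall z, edge a b c d z -> cont_at g z) ->
  rect_integral (fun z => f z - g z) a b c d =
  rect_integral f a b c d - rect_integral g a b c d.
Proof.
move=> cf cg; rewrite /rect_integral opprD addrACA -mulrBr.
rewrite -!cintegralB//; try by apply: ccont_integrable; exact: ccont_edge_h.
- by congr (_ + _ * _); apply: eq_cintegral => x _; ring.
- by apply: ccont_integrable; exact: ccont_edge_v.
- by apply: ccont_integrable; exact: ccont_edge_v.
Qed.

(* The affine part of f contributes the same constant with opposite signs. *)
Lemma rect_integral_affine f a b c d M (p L z0 : R[i]) : a <= b -> c <= d ->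
  (forall z, rect a b c d z -> cont_at f z) ->
  (forall z, rect a b c d z -> normc (f z - p - L * (z - z0)) <= M) ->
  normc (rect_integral f a b c d) <= 4 * M * (b - a + (d - c)).
Proof.
move=> ab cd H B.
have i1 : normc ('i : R[i]) = 1 by rewrite /= expr0n expr1n add0r sqrtr1.
have E : 'i * (c - d)%:C * L * (b - a)%:C + 'i * (L * (b - a)%:C * (d - c)%:C) = 0.
  by rewrite -(opprB d c) rmorphN/=; ring.
have E1 (u v k : R[i]) : normc (u - p - L * (k - z0)) <= M ->
   forall k', normc (v - p - L * (k' - z0)) <= M ->
   normc (u - v - L * (k - k')) <= 2 * M.
  move=> h1 k' h2; rewrite mulrDl mul1r.
  rewrite (_ : _ - _ = (u - p - L * (k - z0)) - (v - p - L * (k' - z0))); last by ring.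
  by apply: le_trans (le_normcB _ _) _; exact: lerD.
rewrite -[rect_integral _ _ _ _ _]subr0 -E /rect_integral.
rewrite (_ : forall x y z t : R[i], x + 'i * y - (z + 'i * t) = (x - z) + 'i * (y - t)); last first.
  by move=> *; ring.
apply: le_trans (le_normcD _ _) _; rewrite normcM i1 mul1r mulrDr lerD//.
  rewrite (_ : 4 * M * (b - a) = 2 * ((2 * M) * (b - a))); last by ring.
  apply: cintegral_itv_near_cst => //.
    by apply: ccontB; apply: ccont_hor => x xab; apply: H; rewrite /rect/= xab lexx /= ?andbT.
  move=> x xab.
  rewrite (_ : 'i * (c - d)%:C * L = L * ((x +i* c) - (x +i* d))).
    by apply: (E1 _ _ _); apply: B; rewrite /rect/= xab lexx /= ?andbT.
  rewrite mulrC; congr (_ * _); apply: eq_complexP; rewrite ?cReM ?cImM/=; ring.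
rewrite (_ : 4 * M * (d - c) = 2 * ((2 * M) * (d - c))); last by ring.
apply: cintegral_itv_near_cst => //.
  by apply: ccontB; apply: ccont_ver => x xab; apply: H; rewrite /rect/= xab lexx /= ?andbT.
move=> x xab.
rewrite (_ : L * (b - a)%:C = L * ((b +i* x) - (a +i* x))).
  by apply: (E1 _ _ _); apply: B; rewrite /rect/= xab lexx /= ?andbT.
congr (_ * _); apply: eq_complexP => /=; ring.
Qed.

End goursat.

Lemma half_pow_small (R : realType) (w e : R) : 0 < e -> exists n : nat, w / 2 ^+ n < e.
Proof.
move=> e0; have [n Hn] : exists n : nat, `|w| / e < n%:R.
  by exists (Num.bound (`|w| / e)); apply: archi_boundP; rewrite divr_ge0// ltW.
exists n; rewrite ltr_pdivrMr ?exprn_gt0// mulrC -ltr_pdivrMr//.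
apply: le_lt_trans (_ : `|w| / e < _); first by rewrite ler_pM2r ?invr_gt0// ler_norm.
by apply: lt_le_trans Hn _; rewrite -natrX ler_nat ltnW// ltn_expl.
Qed.

Section bisection.
Variable R : realType.
Implicit Types (P : R -> R -> R -> R -> Prop) (a b c d : R).

Lemma midpoint_bounds a b : a <= b ->
  [/\ a <= (a + b) / 2, (a + b) / 2 <= b, (a + b) / 2 - a = (b - a) / 2 &
      b - (a + b) / 2 = (b - a) / 2].
Proof. by move=> ab; split; lra. Qed.

Lemma bisection P a b c d : a <= b -> c <= d -> P a b c d ->
  (forall a b c d, a <= b -> c <= d -> P a b c d ->
     let m := (a + b) / 2 in let n := (c + d) / 2 in
     [\/ P a m c n, P m b c n, P a m n d | P m b n d]) ->
  exists x y, [/\ a <= x <= b, c <= y <= d & forall e, 0 < e ->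
    exists a' b' c' d', P a' b' c' d' /\
      [/\ a' <= x <= b', c' <= y <= d', b' - a' < e, d' - c' < e &
        [/\ a <= a', b' <= b, c <= c' & d' <= d]]].
Proof.
move=> ab cd Pabcd step.
pose ok (Q : R * R * R * R) := let: (a, b, c, d) := Q in
  [/\ a <= b, c <= d & P a b c d].
pose nest (Q Q' : R * R * R * R) :=
  let: (a, b, c, d) := Q in let: (a', b', c', d') := Q' in
  [/\ a <= a', b' <= b, c <= c', d' <= d &
      b' - a' = (b - a) / 2 /\ d' - c' = (d - c) / 2].
(* The guard [ok Q] makes the choice of a quarter a total function, which can then be iterated; off
   the guard the value is irrelevant. *)
have /choice[nx nxP] : forall Q, exists Q', ok Q -> ok Q' /\ nest Q Q'.
  move=> [[[a0 b0] c0] d0]; have [h|nh] := pselect (ok (a0, b0, c0, d0)); last first.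
    by exists (a0, b0, c0, d0).
  have [ab0 cd0 P0] := h.
  have [m1 m2 m3 m4] := midpoint_bounds ab0.
  have [n1 n2 n3 n4] := midpoint_bounds cd0.
  case: (step _ _ _ _ ab0 cd0 P0) => H.
  - by exists (a0, (a0 + b0) / 2, c0, (c0 + d0) / 2).
  - by exists ((a0 + b0) / 2, b0, c0, (c0 + d0) / 2).
  - by exists (a0, (a0 + b0) / 2, (c0 + d0) / 2, d0).
  - by exists ((a0 + b0) / 2, b0, (c0 + d0) / 2, d0).
pose u n := iter n nx (a, b, c, d).
have uok n : ok (u n).
  by elim: n => [|n IH]; [split|rewrite /u iterS; exact: (nxP _ IH).1].
have un n : nest (u n) (u n.+1) by rewrite /u iterS; exact: (nxP _ (uok n)).2.
pose A n := (u n).1.1.1; pose B n := (u n).1.1.2.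
pose C n := (u n).1.2; pose D n := (u n).2.
have uE n : u n = (A n, B n, C n, D n) by rewrite /A /B /C /D; case: (u n) => [[[]]].
have ABn n : A n <= B n by have := uok n; rewrite uE => -[].
have CDn n : C n <= D n by have := uok n; rewrite uE => -[].
have Pn n : P (A n) (B n) (C n) (D n) by have := uok n; rewrite uE => -[].
have An n k : A n <= A (n + k)%N.
  elim: k => [|k IH]; rewrite ?addn0// addnS; apply: le_trans IH _.
  by have := un (n + k)%N; rewrite !uE => -[].
have Bn n k : B (n + k)%N <= B n.
  elim: k => [|k IH]; rewrite ?addn0// addnS; apply: le_trans IH.
  by have := un (n + k)%N; rewrite !uE => -[].
have Cn n k : C n <= C (n + k)%N.
  elim: k => [|k IH]; rewrite ?addn0// addnS; apply: le_trans IH _.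
  by have := un (n + k)%N; rewrite !uE => -[].
have Dn n k : D (n + k)%N <= D n.
  elim: k => [|k IH]; rewrite ?addn0// addnS; apply: le_trans IH.
  by have := un (n + k)%N; rewrite !uE => -[].
have W n : B n - A n = (b - a) / 2 ^+ n /\ D n - C n = (d - c) / 2 ^+ n.
  elim: n => [|n [IH1 IH2]]; first by rewrite /A /B /C /D/= expr0 !divr1.
  have := un n; rewrite !uE => -[_ _ _ _ [-> ->]].
  by rewrite IH1 IH2 exprSr !invfM !mulrA.
have AB n k : A n <= B k.
  have [nk|kn] := leqP n k.
    by apply: le_trans (ABn k); rewrite -(subnKC nk).
  by apply: le_trans (ABn n) _; rewrite -(subnKC (ltnW kn)).
have CD n k : C n <= D k.
  have [nk|kn] := leqP n k.
    by apply: le_trans (CDn k); rewrite -(subnKC nk).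
  by apply: le_trans (CDn n) _; rewrite -(subnKC (ltnW kn)).
(* Nested intervals: the supremum of the left ends lies below every right end. *)
have supP (F G : nat -> R) : (forall n k, F n <= G k) ->
    forall n, F n <= sup (range F) <= G n.
  move=> FG n; apply/andP; split.
    by apply: ub_le_sup; [exists (G 0%N) => _ [k _ <-]|exists n].
  by apply: ge_sup; [exists (F 0%N), 0%N|move=> _ [k _ <-]].
exists (sup (range A)), (sup (range C)); split.
- exact: (supP _ _ AB 0%N).
- exact: (supP _ _ CD 0%N).
move=> e e0; have [n Hn] := half_pow_small (b - a + (d - c)) e0.
exists (A n), (B n), (C n), (D n); split => //.
have [-> ->] := W n.
have le1 : (b - a) / 2 ^+ n <= (b - a + (d - c)) / 2 ^+ n.
  by rewrite ler_pM2r ?invr_gt0 ?exprn_gt0// lerDl subr_ge0.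
have le2 : (d - c) / 2 ^+ n <= (b - a + (d - c)) / 2 ^+ n.
  by rewrite ler_pM2r ?invr_gt0 ?exprn_gt0// lerDr subr_ge0.
split.
- exact: supP.
- exact: supP.
- exact: le_lt_trans Hn.
- exact: le_lt_trans Hn.
split; [exact: (An 0%N n)|exact: (Bn 0%N n)|exact: (Cn 0%N n)|exact: (Dn 0%N n)].
Qed.

End bisection.

Section goursat_theorem.
Variable R : realType.
Implicit Types (f g : R[i] -> R[i]) (a b c d : R).

Lemma rect_sub a b c d a' b' c' d' z : a <= a' -> b' <= b -> c <= c' -> d' <= d ->
  rect a' b' c' d' z -> rect a b c d z.
Proof.
move=> aa bb cc dd /andP[/andP[h1 h2] /andP[h3 h4]]; apply/andP; split.
  by rewrite (le_trans aa h1) (le_trans h2 bb).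
by rewrite (le_trans cc h3) (le_trans h4 dd).
Qed.

(** By contradiction through [bisection]. The inherited property is that the integral exceeds
    [e * S ^ 2], with [S] the half-perimeter: the four quarters have half of [S], so their bounds
    add up to the bound of the whole. At the limit point the linear approximation of [f] gives an
    upper bound of the same order with a smaller constant. *)
Lemma goursat f a b c d : a <= b -> c <= d ->
  (forall z, rect a b c d z -> exists L, cdiff_at f z L) ->
  rect_integral f a b c d = 0.
Proof.
move=> ab cd H.
have Hc z : rect a b c d z -> cont_at f z.
  by move=> /H[L /cdiff_cont].
apply: eq0_normc; apply/eqP; rewrite eq_le normc_ge0 andbT leNgt; apply/negP => J0.
pose S a b c d : R := b - a + (d - c).
have S0 : 0 <= S a b c d by rewrite addr_ge0 ?subr_ge0.
(* Chosen so that [e * S ^ 2] is less than the modulus of the integral; the [+ 1] covers a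
   degenerate rectangle. *)
pose e := normc (rect_integral f a b c d) / (2 * (S a b c d ^+ 2 + 1)).
have S1 : 0 < S a b c d ^+ 2 + 1 by rewrite ltr_pwDr// sqr_ge0.
have e0 : 0 < e by rewrite divr_gt0// mulr_gt0.
pose bad a' b' c' d' := [/\ a <= a', b' <= b, c <= c' & d' <= d] /\
  e * S a' b' c' d' ^+ 2 < normc (rect_integral f a' b' c' d').
have badQ : bad a b c d.
  split; first by rewrite !lexx.
  rewrite /e mulrAC ltr_pdivrMr ?mulr_gt0// ltr_pM2l//.
  by have := sqr_ge0 (S a b c d); lra.
have [] := @bisection R bad a b c d ab cd badQ.
  move=> a' b' c' d' ab' cd' [[aa bb cc dd] bd] /=.
  have [m1 m2 m3 m4] := midpoint_bounds ab'.
  have [n1 n2 n3 n4] := midpoint_bounds cd'.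
  set m := (a' + b') / 2 in m1 m2 m3 m4 *; set n := (c' + d') / 2 in n1 n2 n3 n4 *.
  pose s := S a' b' c' d'.
  have E1 : S a' m c' n = s / 2 by rewrite /S m3 n3 -mulrDl.
  have E2 : S m b' c' n = s / 2 by rewrite /S m4 n3 -mulrDl.
  have E3 : S a' m n d' = s / 2 by rewrite /S m3 n4 -mulrDl.
  have E4 : S m b' n d' = s / 2 by rewrite /S m4 n4 -mulrDl.
  have N1 : [/\ a <= a', m <= b, c <= c' & n <= d].
    by split=> //; [exact: le_trans m2 bb|exact: le_trans n2 dd].
  have N2 : [/\ a <= m, b' <= b, c <= c' & n <= d].
    by split=> //; [exact: le_trans aa m1|exact: le_trans n2 dd].
  have N3 : [/\ a <= a', m <= b, c <= n & d' <= d].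
    by split=> //; [exact: le_trans m2 bb|exact: le_trans cc n1].
  have N4 : [/\ a <= m, b' <= b, c <= n & d' <= d].
    by split=> //; [exact: le_trans aa m1|exact: le_trans cc n1].
  have [h1|h1] := ltP (e * S a' m c' n ^+ 2) (normc (rect_integral f a' m c' n)); first by constructor 1.
  have [h2|h2] := ltP (e * S m b' c' n ^+ 2) (normc (rect_integral f m b' c' n)); first by constructor 2.
  have [h3|h3] := ltP (e * S a' m n d' ^+ 2) (normc (rect_integral f a' m n d')); first by constructor 3.
  have [h4|h4] := ltP (e * S m b' n d' ^+ 2) (normc (rect_integral f m b' n d')); first by constructor 4.
  exfalso; move: bd; apply/negP; rewrite -leNgt.
  rewrite (@rect_integral_splitx _ _ _ _ _ _ m)//; last first.
    by move=> z /(rect_sub aa bb cc dd); exact: Hc.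
  rewrite (@rect_integral_splity _ _ a' m _ _ n)//; last first.
    by move=> z hz; apply: Hc; case: N1 => *; apply: rect_sub hz.
  rewrite (@rect_integral_splity _ _ m b' _ _ n)//; last first.
    by move=> z hz; apply: Hc; case: N2 => *; apply: rect_sub hz.
  apply: le_trans (le_normcD _ _) _.
  apply: le_trans (lerD (le_normcD _ _) (le_normcD _ _)) _.
  apply: le_trans (lerD (lerD h1 h3) (lerD h2 h4)) _.
  by rewrite E1 E2 E3 E4 -/s; lra.
move=> x [y [xab ycd near_xy]].
have [L HL] : exists L, cdiff_at f (x +i* y) L by apply: H; rewrite /rect/= xab.
(* [rect_integral_affine] brings a factor 4, so the final bound is [4 / 5 * e * s ^ 2], below
   [e * s ^ 2]. *)
have e5 : 0 < e / 5 by rewrite divr_gt0.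
have [k k0 Hk] := HL _ e5.
have k2 : 0 < k / 2 by rewrite divr_gt0.
have [a' [b' [c' [d' [[[aa bb cc dd] bd] [xab' ycd' wx wy _]]]]]] := near_xy _ k2.
have ab' : a' <= b' by case/andP: xab' => h1 h2; exact: le_trans h1 h2.
have cd' : c' <= d' by case/andP: ycd' => h1 h2; exact: le_trans h1 h2.
move: bd; apply/negP; rewrite -leNgt.
pose s := S a' b' c' d'.
have s0 : 0 <= s by rewrite addr_ge0 ?subr_ge0.
apply: le_trans (@rect_integral_affine _ f a' b' c' d' (e / 5 * s) (f (x +i* y)) L (x +i* y) ab' cd' _ _) _.
- by move=> z hz; apply: Hc; apply: rect_sub hz.
- move=> z /andP[zx zy].
  have ns : normc (z - (x +i* y)) <= s.
    apply: le_trans (normc_le_ReIm _) _; case: z zx zy => zx zy /= hx hy.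
    rewrite lerD// ler_norml; move: xab' ycd' hx hy => /andP[? ?] /andP[? ?] /andP[? ?] /andP[? ?];
    by apply/andP; split; lra.
  apply: le_trans (Hk _ _) _; last by rewrite ler_pM2l.
  by apply: le_lt_trans ns _; rewrite /s /S; lra.
- rewrite -/(S _ _ _ _) -/s; have : 0 <= e * s ^+ 2 by rewrite mulr_ge0 ?sqr_ge0 ?ltW.
  by lra.
Qed.

End goursat_theorem.

(** * Cauchy's formula and estimate on squares *)

Section cauchy_estimate.
Variable R : realType.
Implicit Types (f g : R[i] -> R[i]).

Lemma cdiff_near f g z L : (exists2 r : R, 0 < r & forall w, normc (w - z) < r -> f w = g w) ->
  cdiff_at f z L -> cdiff_at g z L.
Proof.
move=> [r r0 fg] H e e0; have [d d0 Hd] := H e e0.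
exists (Num.min d r); first by rewrite lt_min d0.
move=> w; rewrite lt_min => /andP[/Hd h wr].
by rewrite -(fg w)// -(fg z)// subrr normc0.
Qed.

Lemma cdiff_inv (z0 z : R[i]) : z != z0 ->
  exists L, cdiff_at (fun w => (w - z0)^-1) z L.
Proof.
move=> zz0; apply/(@derivable_cdiff _ (fun w : R[i]^o => (w - z0)^-1 : R[i]^o)).
apply: derivableV; first by rewrite subr_eq0.
by apply: derivableB => //; exact: derivable_cst.
Qed.

Lemma cdiff_mul f g z : (exists L, cdiff_at f z L) -> (exists L, cdiff_at g z L) ->
  exists L, cdiff_at (fun w => f w * g w) z L.
Proof.
move=> /derivable_cdiff hf /derivable_cdiff hg.
apply/(@derivable_cdiff _ (fun w : R[i]^o => f w * g w : R[i]^o)).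
have H := derivableM hf hg; exact H.
Qed.

Lemma cdiff_sub f g z : (exists L, cdiff_at f z L) -> (exists L, cdiff_at g z L) ->
  exists L, cdiff_at (fun w => f w - g w) z L.
Proof.
move=> /derivable_cdiff hf /derivable_cdiff hg.
apply/(@derivable_cdiff _ (fun w : R[i]^o => f w - g w : R[i]^o)).
have H := derivableB hf hg; exact H.
Qed.

Lemma cdiff_cst (c z : R[i]) : exists L, cdiff_at (fun=> c) z L.
Proof.
by exists 0 => e e0; exists 1 => // w _; rewrite subrr mul0r subrr normc0 mulr_ge0 ?normc_ge0 ?ltW.
Qed.

Lemma cdiff_cont_at f z : (exists L, cdiff_at f z L) -> cont_at f z.
Proof. by move=> [L /cdiff_cont]. Qed.

Lemma edge_rect a b c d (z : R[i]) : a <= b -> c <= d -> edge a b c d z -> rect a b c d z.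
Proof.
move=> ab cd /orP[/andP[h1 /orP[]/eqP h2]|/andP[h1 /orP[]/eqP h2]];
  by rewrite /rect h1 h2 !lexx ?andbT.
Qed.

Definition square (z0 : R[i]) (s : R) := rect (complex.Re z0 - s) (complex.Re z0 + s)
  (complex.Im z0 - s) (complex.Im z0 + s).

Definition square_edge (z0 : R[i]) (s : R) :=
  edge (complex.Re z0 - s) (complex.Re z0 + s) (complex.Im z0 - s) (complex.Im z0 + s).

Definition square_integral f (z0 : R[i]) (s : R) :=
  rect_integral f (complex.Re z0 - s) (complex.Re z0 + s)
    (complex.Im z0 - s) (complex.Im z0 + s).

Lemma squareP z0 s z : square z0 s z <->
  `|complex.Re (z - z0)| <= s /\ `|complex.Im (z - z0)| <= s.
Proof.
case: z0 => x0 y0; case: z => x y; rewrite /square /rect/= !ler_norml.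
split=> [/andP[/andP[? ?]/andP[? ?]]|[/andP[? ?]/andP[? ?]]].
  by split; apply/andP; split; lra.
by apply/andP; split; apply/andP; split; lra.
Qed.

Lemma square_normc z0 s z : square z0 s z -> normc (z - z0) <= 2 * s.
Proof.
move=> /squareP[h1 h2]; apply: le_trans (normc_le_ReIm _) _; lra.
Qed.

Lemma square_edge_normc z0 s z : 0 < s -> square_edge z0 s z -> s <= normc (z - z0).
Proof.
move=> s0 /orP[/andP[_ h]|/andP[_ h]].
  apply: le_trans (le_Im_normc _); case: z0 h => x0 y0; case: z => x y /=.
  move=> /orP[]/eqP ->; last by rewrite [y0 + s]addrC addrK ler_norm.
  by rewrite addrAC subrr add0r normrN ler_norm.
apply: le_trans (le_Re_normc _); case: z0 h => x0 y0; case: z => x y /=.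
move=> /orP[]/eqP ->; last by rewrite [x0 + s]addrC addrK ler_norm.
by rewrite addrAC subrr add0r normrN ler_norm.
Qed.

(* An exceptional point for differentiability, at which q is only continuous. *)
Lemma square_integral_exceptional q z0 s : 0 < s -> cont_at q z0 ->
  (forall z, square z0 s z -> z != z0 -> exists L, cdiff_at q z L) ->
  square_integral q z0 s = 0.
Proof.
move=> s0 q0 H.
have qc z : square z0 s z -> cont_at q z.
  by have [->//|zz0 /H] := eqVneq z z0; move/(_ zz0)/cdiff_cont_at.
(* Two vertical and two horizontal strips that miss [z0] are cut off; Goursat's theorem applies to
   each, and the concentric square of half-side [t] is left. *)
have shrink t : 0 < t -> t <= s -> square_integral q z0 s = square_integral q z0 t.
  move: (z0) H qc => [x0 y0] H qc t0 ts; rewrite /square_integral /=.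
  have sub a b c d z : x0 - s <= a -> b <= x0 + s -> y0 - s <= c -> d <= y0 + s ->
    rect a b c d z -> rect (x0 - s) (x0 + s) (y0 - s) (y0 + s) z.
    by move=> *; apply: rect_sub; eassumption.
  have G a b c d : a <= b -> c <= d -> x0 - s <= a -> b <= x0 + s -> y0 - s <= c -> d <= y0 + s ->
     [\/ b < x0, x0 < a, d < y0 | y0 < c] -> rect_integral q a b c d = 0.
    move=> ab cd h1 h2 h3 h4 h; apply: goursat => // z hz; apply: H.
      exact: sub hz.
    apply/eqP => zE; move: hz; rewrite zE /rect/= => /andP[/andP[? ?]/andP[? ?]].
    by case: h => ?; lra.
  have Q a b c d z : x0 - s <= a -> b <= x0 + s -> y0 - s <= c -> d <= y0 + s ->
    rect a b c d z -> cont_at q z by move=> *; apply: qc; apply: sub; eassumption.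
  rewrite (@rect_integral_splitx _ q _ _ _ _ (x0 - t)); [|lra|lra|lra|by move=> z; apply: Q; lra].
  rewrite (@rect_integral_splitx _ q (x0 - t) _ _ _ (x0 + t)); [|lra|lra|lra|by move=> z; apply: Q; lra].
  rewrite (@rect_integral_splity _ q (x0 - t) _ _ _ (y0 - t)); [|lra|lra|lra|by move=> z; apply: Q; lra].
  rewrite (@rect_integral_splity _ q (x0 - t) (x0 + t) (y0 - t) _ (y0 + t)); [|lra|lra|lra|by move=> z; apply: Q; lra].
  rewrite (G (x0 - s)); [|lra|lra|lra|lra|lra|lra|constructor 1; lra].
  rewrite (G (x0 + t)); [|lra|lra|lra|lra|lra|lra|constructor 2; lra].
  rewrite (G (x0 - t) _ (y0 - s)); [|lra|lra|lra|lra|lra|lra|constructor 3; lra].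
  rewrite (G (x0 - t) _ (y0 + t)); [|lra|lra|lra|lra|lra|lra|constructor 4; lra].
  by rewrite !add0r !addr0.
apply: eq0_normc; apply/eqP; rewrite eq_le normc_ge0 andbT leNgt; apply/negP => J0.
have [d d0 Hd] := q0 1 ltr01.
pose M := normc (q z0) + 1.
have M0 : 0 < M by rewrite ltr_pwDr// normc_ge0.
set J := normc _ in J0.
(* Points of the small square are at distance at most [2 * t] from [z0], hence less than [d]. The
   trivial estimate of its integral is [16 * M * t], which the choice of 17 makes smaller than
   [J]. *)
pose t := Num.min s (Num.min (d / 3) (J / (17 * M))).
have t0 : 0 < t by rewrite !lt_min s0 !divr_gt0// mulr_gt0.
have ts : t <= s by rewrite ge_min lexx.
have td : t <= d / 3 by rewrite !ge_min lexx orbT.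
have tJ : t * (17 * M) <= J by rewrite -ler_pdivlMr ?mulr_gt0// !ge_min lexx !orbT.
have st z : square z0 t z -> square z0 s z.
  by move=> /squareP[h1 h2]; apply/squareP; split; apply: le_trans ts.
have : J <= 4 * M * (4 * t).
  rewrite /J (shrink t)//.
  rewrite (_ : 4 * t = complex.Re z0 + t - (complex.Re z0 - t) +
                       (complex.Im z0 + t - (complex.Im z0 - t))); last by ring.
  have ab : complex.Re z0 - t <= complex.Re z0 + t by lra.
  have cd : complex.Im z0 - t <= complex.Im z0 + t by lra.
  apply: rect_integral_bound => // z /(edge_rect ab cd) hz.
    by apply: qc; exact: st.
  have := Hd z; have := square_normc hz => h1 h2.
  have /h2 h3 : normc (z - z0) < d by lra.
  by rewrite -(subrK (q z0) (q z)); apply: le_trans (le_normcD _ _) _; rewrite addrC /M lerD2l ltW.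
have : 0 < t * M by rewrite mulr_gt0.
lra.
Qed.

(** The exact value is [2 * pi * 'i], but a lower bound is enough. In the imaginary part each of the
    two integrands is [2 * s / (u ^ 2 + s ^ 2)] with [|u| <= s], hence at least [1 / s], over an
    interval of length [2 * s]. *)
Lemma square_integral_inv z0 s : 0 < s ->
  4 <= normc (square_integral (fun w => (w - z0)^-1) z0 s).
Proof.
move=> s0; set J := square_integral _ _ _.
suff : 4 <= complex.Im J.
  move=> h; apply: le_trans h _; apply: le_trans (ler_norm _) (le_Im_normc _).
have ec z : square_edge z0 s z -> cont_at (fun w => (w - z0)^-1) z.
  move=> ez; apply: cdiff_cont_at; apply: cdiff_inv.
  apply/eqP => zE; have := square_edge_normc s0 ez; rewrite zE subrr normc0; lra.
have [_ ch] := ccont_edge_h ec; have [cv _] := ccont_edge_v ec.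
move: ch cv; rewrite /J /square_integral /rect_integral; clear J ec.
case: z0 => x0 y0 /= ch cv; rewrite mul0r mul1r add0r.
have key a (F : R -> R) :
    {within `[a - s, a + s], continuous F} ->
    (forall x, a - s <= x <= a + s -> s^-1 <= F x) ->
    2 <= \int[@lebesgue_measure R]_(x in `[a - s, a + s]) F x.
  move=> cF HF.
  have -> : 2 = \int[@lebesgue_measure R]_(x in `[a - s, a + s]) s^-1.
    rewrite Rintegral_itv_cst; last lra.
    by field; lra.
  apply: le_Rintegral; [by []|exact: integrable_itv_cst|exact: continuous_itv_integrable|].
  by move=> x /=; rewrite in_itv/=; exact: HF.
have -> : 4 = 2 + 2 :> R by ring.
have ineq (u : R) : - s <= u -> u <= s -> s^-1 <= s / (u ^+ 2 + s ^+ 2) + s / (u ^+ 2 + s ^+ 2).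
  move=> u1 u2; have u3 : 0 <= (s - u) * (s + u) by rewrite mulr_ge0//; lra.
  have s2 : 0 < s ^+ 2 by rewrite exprn_gt0.
  have us : 0 < u ^+ 2 + s ^+ 2 by have := sqr_ge0 u; lra.
  rewrite -mulrDl ler_pdivlMr// mulrC ler_pdivrMr//; lra.
apply: lerD; apply: key => //= x /andP[x1 x2].
  have -> : y0 - s - y0 = - s by ring.
  have -> : y0 + s - y0 = s by ring.
  rewrite sqrrN mulNr opprK; apply: ineq; lra.
have -> : x0 - s - x0 = - s by ring.
have -> : x0 + s - x0 = s by ring.
rewrite sqrrN mulNr opprK addrC.
have -> : s ^+ 2 + (x - y0) ^+ 2 = (x - y0) ^+ 2 + s ^+ 2 by ring.
apply: ineq; lra.
Qed.

(** The difference quotient [q], completed by the derivative at [z0], has integral zero, so the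
    integral of [f * k] is [f z0] times that of the Cauchy kernel [k]. The former is at most
    [16 * M] and the latter at least 4 in modulus. The loss of a constant is harmless in
    [zero_spreads], where only the growth in [n] matters. *)
Lemma cauchy_estimate f z0 s M : 0 < s ->
  (forall z, square z0 s z -> exists L, cdiff_at f z L) ->
  (forall z, square_edge z0 s z -> normc (f z) <= M) ->
  normc (f z0) <= 4 * M.
Proof.
move=> s0 H B.
have sq0 : square z0 s z0 by apply/squareP; rewrite subrr/= normr0 ltW.
have ab : complex.Re z0 - s <= complex.Re z0 + s by lra.
have cd : complex.Im z0 - s <= complex.Im z0 + s by lra.
have [L HL] := H _ sq0.
pose q z := if z == z0 then L else (f z - f z0) * (z - z0)^-1.
have q0 : cont_at q z0.
  move=> e e0; have e2 : 0 < e / 2 by rewrite divr_gt0.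
  have [d d0 Hd] := HL _ e2.
  exists d => // w wd; rewrite /q eqxx; case: eqVneq => [_|wz]; first by rewrite subrr normc0.
  have wz0 : w - z0 != 0 by rewrite subr_eq0.
  have nw := normc_gt0 wz0.
  rewrite -(ltr_pM2r nw) -normcM mulrBl mulfVK//.
  apply: le_lt_trans (Hd _ wd) _; rewrite ltr_pM2r//; lra.
have qd z : square z0 s z -> z != z0 -> exists L, cdiff_at q z L.
  move=> hz zz0.
  have [L' HL'] : exists L, cdiff_at (fun z => (f z - f z0) * (z - z0)^-1) z L.
    apply: cdiff_mul; last exact: cdiff_inv.
    by apply: cdiff_sub; [exact: H|exact: cdiff_cst].
  exists L'; apply: cdiff_near HL'; exists (normc (z - z0)).
    by apply: normc_gt0; rewrite subr_eq0.
  move=> w wz; rewrite /q; case: eqVneq => // wE; move: wz.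
  by rewrite wE normcB ltxx.
have enz z : square_edge z0 s z -> z != z0.
  move=> ez; apply/eqP => zE; have := square_edge_normc s0 ez; rewrite zE subrr normc0; lra.
pose k (w : R[i]) := (w - z0)^-1.
pose fk w := f w * k w.
have kc z : square_edge z0 s z -> cont_at k z.
  by move=> ez; apply: cdiff_cont_at; exact/cdiff_inv/enz.
have fkc z : square_edge z0 s z -> cont_at fk z.
  move=> ez; apply: cdiff_cont_at; apply: cdiff_mul; last exact/cdiff_inv/enz.
  by apply: H; exact: edge_rect ez.
have fzkc z : square_edge z0 s z -> cont_at (fun z => f z0 * k z) z.
  move=> ez; apply: cdiff_cont_at; apply: cdiff_mul; last exact/cdiff_inv/enz.
  exact: cdiff_cst.
have E : square_integral fk z0 s = f z0 * square_integral k z0 s.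
  apply/eqP; rewrite -subr_eq0; apply/eqP.
  rewrite -(square_integral_exceptional s0 q0 qd) /square_integral.
  rewrite -rect_integralZ// -rect_integralB//.
  rewrite /rect_integral; congr (_ + _ * _); apply: eq_cintegral => x /=;
    rewrite in_itv/= => xab; rewrite /q /fk !ifF -?mulrBl//; apply/negbTE/enz;
    by rewrite /square_edge /edge/= xab eqxx ?orbT.
have B0 : 0 <= M.
  apply: le_trans (normc_ge0 (f ((complex.Re z0 + s) +i* (complex.Im z0)))) (B _ _).
  by rewrite /square_edge /edge/= eqxx !orbT andbT; apply/orP; right; apply/andP; split; lra.
have B1 : normc (square_integral fk z0 s) <= 16 * M.
  rewrite (_ : 16 * M = 4 * (M / s) * (complex.Re z0 + s - (complex.Re z0 - s) +
                       (complex.Im z0 + s - (complex.Im z0 - s)))); last by field; lra.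
  apply: rect_integral_bound => // z ez.
  rewrite /fk normcM normcV; apply: ler_pM; rewrite ?normc_ge0 ?invr_ge0 ?normc_ge0//.
    exact: B.
  by rewrite lef_pV2 ?posrE//; [exact: square_edge_normc|rewrite normc_gt0// subr_eq0 enz].
move: B1; rewrite E normcM.
have := square_integral_inv z0 s0; rewrite -/k.
have := normc_ge0 (f z0); nra.
Qed.

End cauchy_estimate.

Section identity_theorem.
Variable R : realType.
Implicit Types (f g : R[i] -> R[i]).

(** If [f] were unbounded, bisection would produce arbitrarily small rectangles around one point on
    which it is unbounded, against continuity at that point. *)
Lemma bounded_rect f (a b c d : R) : a <= b -> c <= d ->
  (forall z, rect a b c d z -> cont_at f z) ->
  exists M, forall z, rect a b c d z -> normc (f z) <= M.
Proof.
move=> ab cd H; apply: contrapT => nM.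
pose bd a' b' c' d' := exists M, forall z, rect a' b' c' d' z -> normc (f z) <= M.
have [|x [y [xab ycd near_xy]]] := @bisection R (fun a b c d => ~ bd a b c d) a b c d ab cd nM.
  move=> a' b' c' d' ab' cd' nb /=.
  set m := (a' + b') / 2; set n := (c' + d') / 2.
  have [[M1 h1]|] := pselect (bd a' m c' n); last by constructor 1.
  have [[M2 h2]|] := pselect (bd m b' c' n); last by constructor 2.
  have [[M3 h3]|] := pselect (bd a' m n d'); last by constructor 3.
  have [[M4 h4]|] := pselect (bd m b' n d'); last by constructor 4.
  exfalso; apply: nb; exists (Num.max (Num.max M1 M2) (Num.max M3 M4)) => z.
  move=> /andP[/andP[z1 z2] /andP[z3 z4]]; rewrite !le_max.
  have [zm|/ltW zm] := leP (complex.Re z) m; have [zn|/ltW zn] := leP (complex.Im z) n.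
  - by rewrite h1// /rect z1 zm z3 zn.
  - by rewrite h3 ?orbT// /rect z1 zm z4 zn.
  - by rewrite h2 ?orbT// /rect zm z2 z3 zn.
  - by rewrite h4 ?orbT// /rect zm z2 zn z4.
have [k k0 Hk] : exists2 d : R, 0 < d & forall w, normc (w - (x +i* y)) < d ->
    normc (f w - f (x +i* y)) < 1.
  by apply: H => //; rewrite /rect/= xab.
have k2 : 0 < k / 2 by rewrite divr_gt0.
have [a' [b' [c' [d' [nb [xab' ycd' wx wy _]]]]]] := near_xy _ k2.
apply: nb; exists (1 + normc (f (x +i* y))) => z /andP[zx zy].
have ns : normc (z - (x +i* y)) < k.
  apply: le_lt_trans (normc_le_ReIm _) _; case: z zx zy => zx zy /= hx hy.
  rewrite (splitr k) ltrD// ltr_norml; move: xab' ycd' hx hy => /andP[? ?] /andP[? ?] /andP[? ?] /andP[? ?];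
  by apply/andP; split; lra.
rewrite -(subrK (f (x +i* y)) (f z)); apply: le_trans (le_normcD _ _) _.
by rewrite lerD2r ltW// Hk.
Qed.

(** As [f] vanishes near [c], [f w / (w - c) ^ n] is differentiable on the whole disc for every [n].
    With [r = |z0 - c|], the Cauchy estimate on a square about [z0] whose edge stays at distance at
    least [2 * r] from [c] bounds [|f z0| / r ^ n] by [4 * M / (2 * r) ^ n]; hence [|f z0| * 2 ^ n]
    is bounded in [n]. *)
Lemma zero_spreads f (c : R[i]) (rho delta : R) : 0 < rho -> 0 < delta ->
  (forall z, normc (z - c) < rho -> exists L, cdiff_at f z L) ->
  (forall z, normc (z - c) < delta -> f z = 0) ->
  forall z0, normc (z0 - c) < rho / 16 -> f z0 = 0.
Proof.
move=> rho0 delta0 H Z z0 z0c.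
have [->|z0nc] := eqVneq z0 c; first by apply: Z; rewrite subrr normc0.
set r := normc (z0 - c) in z0c.
have r0 : 0 < r by rewrite normc_gt0// subr_eq0.
pose s := rho / 4; have s0 : 0 < s by rewrite divr_gt0.
have inB z : square z0 s z -> normc (z - c) < rho.
  move=> /square_normc h; have := normc_triangle z c z0; rewrite -/r.
  by move=> /le_lt_trans; apply; rewrite /s in h; lra.
have [M HM] : exists M, forall z, square z0 s z -> normc (f z) <= M.
  apply: bounded_rect; [lra|lra|] => z hz.
  by apply: cdiff_cont_at; apply: H; exact: inB.
have ab : complex.Re z0 - s <= complex.Re z0 + s by lra.
have cd : complex.Im z0 - s <= complex.Im z0 + s by lra.
have far z : square_edge z0 s z -> 2 * r <= normc (z - c).
  move=> /(square_edge_normc s0) h; have := normc_triangle z z0 c.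
  rewrite [normc (c - z0)]normcB -/r => h2; rewrite /s in h; lra.
(* At [z = c] the conventional value of the inverse does not matter, since the factor [f w] is zero
   nearby. *)
have Fd n z : normc (z - c) < rho -> exists L, cdiff_at (fun w => f w * (w - c)^-1 ^+ n) z L.
  move=> zc; have [zE|zc0] := eqVneq z c.
    have [L HL] := cdiff_cst 0 z; exists L; apply: cdiff_near HL.
    by exists delta => // w wz; rewrite Z ?mul0r// -zE.
  apply: cdiff_mul; first exact: H.
  elim: n => [|n IH]; first exact: (cdiff_cst 1).
  rewrite (_ : (fun w => _) = (fun w => (w - c)^-1 * (w - c)^-1 ^+ n)); last first.
    by apply/funext => w; rewrite exprS.
  by apply: cdiff_mul IH; exact: cdiff_inv.
have M0 : 0 <= M by apply: le_trans (normc_ge0 (f z0)) (HM _ _); apply/squareP; rewrite subrr/= normr0 ltW.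
have est n : normc (f z0) * 2 ^+ n <= 4 * M.
  have := @cauchy_estimate _ (fun w => f w * (w - c)^-1 ^+ n) z0 s (M * (2 * r)^-1 ^+ n) s0.
  have h z : square z0 s z -> exists L, cdiff_at (fun w => f w * (w - c)^-1 ^+ n) z L.
    by move=> /inB; exact: Fd.
  have r2 : 0 < 2 * r by rewrite mulr_gt0.
  have h' z : square_edge z0 s z ->
      normc (f z * (z - c)^-1 ^+ n) <= M * (2 * r)^-1 ^+ n.
    move=> ez.
    rewrite normcM normcX normcV; apply: ler_pM; rewrite ?normc_ge0 ?exprn_ge0 ?invr_ge0 ?normc_ge0//.
      by apply: HM; exact: edge_rect ez.
    apply: lerXn2r; rewrite ?nnegrE ?invr_ge0 ?normc_ge0// ?(ltW r2)//.
    have := far _ ez => h2.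
    by rewrite lef_pV2 ?posrE// (lt_le_trans r2).
  move=> /(_ h h').
  rewrite normcM normcX normcV -/r.
  have p0 : 0 < (2 * r) ^+ n by rewrite exprn_gt0.
  move=> /(ler_wpM2r (ltW p0)); rewrite -!mulrA -!exprMn.
  rewrite mulVf ?gt_eqF// expr1n mulr1.
  by rewrite [_^-1 * _]mulrC mulfK ?gt_eqF.
apply: eq0_normc; apply/eqP; rewrite eq_le normc_ge0 andbT leNgt; apply/negP => f0.
have [n Hn] := half_pow_small (4 * M) f0.
by move: Hn; apply/negP; rewrite -leNgt ler_pdivlMr ?exprn_gt0.
Qed.

(** The points of [G] near which [f] vanishes form a nonempty set that is open and closed in [G].
    Closedness is the point where [zero_spreads] is used: its radius depends on the disc of
    differentiability and not on the size of the disc of zeros. *)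
Theorem identity_theorem (G : set R[i]^o) (f : R[i]^o -> R[i]^o) (c : R[i]) (r : R) :
  open G -> connected G -> (forall z, G z -> derivable f z 1) -> G c -> 0 < r ->
  (forall z : R[i], normc (z - c) < r -> f z = 0) ->
  forall z, G z -> f z = 0.
Proof.
move=> oG cG dG Gc r0 fc.
pose S := [set z : R[i]^o | G z /\ exists2 d : R, 0 < d & forall w : R[i], normc (w - z) < d -> f w = 0].
have GE : S = G.
  apply: cG.
  - by exists c; split => //; exists r.
  - exists S; last by apply/seteqP; split=> z [].
    apply/open_normcP => z [Gz [d d0 Hd]].
    have [e e0 He] := (open_normcP G).1 oG _ Gz.
    have d2 : 0 < d / 2 by rewrite divr_gt0.
    exists (Num.min e (d / 2)); first by rewrite lt_min e0.
    move=> w; rewrite lt_min => /andP[we wd]; split; first exact: He.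
    exists (d / 2) => // t tw; apply: Hd; rewrite (splitr d).
    by apply: le_lt_trans (normc_triangle _ _ w) _; rewrite ltrD.
  - exists (closure S); first exact: closed_closure.
    apply/seteqP; split=> z; first by move=> Sz; split; [case: Sz|exact: subset_closure].
    move=> [Gz clz]; split => //.
    have [e e0 He] := (open_normcP G).1 oG _ Gz.
    (* Zeros spread from [w] to the radius [(e / 2) / 16 = e / 32], and
       [e / 40 + e / 200 < e / 32]. *)
    have e40 : 0 < e / 40 by rewrite divr_gt0.
    have [w [[Gw [d d0 Hd]] wz]] : exists w : R[i], S w /\ normc (w - z) < e / 40.
      have [|w [Sw wz]] := clz (fun w : R[i] => normc (w - z) < e / 40); last by exists w.
      by apply/nbhs_normcP; exists (e / 40).
    have e2 : 0 < e / 2 by rewrite divr_gt0.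
    exists (e / 200); first by rewrite divr_gt0.
    move=> t tz; apply: (@zero_spreads f w (e / 2) d e2 d0 _ Hd).
      move=> v vw; apply/derivable_cdiff; apply: dG; apply: He.
      by apply: le_lt_trans (normc_triangle _ _ w) _; lra.
    by apply: le_lt_trans (normc_triangle _ _ z) _; rewrite [normc (z - w)]normcB; lra.
by move=> z; rewrite -GE => -[_ [d d0]]; apply; rewrite subrr normc0.
Qed.

End identity_theorem.

(** * Laplace transforms of compactly supported functions *)

Section complex_exponential.
Variable R : realType.
Implicit Types z w : R[i].

Lemma cexpD z w : cexp (z + w) = cexp z * cexp w.
Proof.
case: z => a b; case: w => c d; rewrite /cexp /= expRD cosD sinD.
by apply: eq_complexP => /=; ring.
Qed.

Lemma cexp0 : cexp (0 : R[i]) = 1.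
Proof. by rewrite /cexp/= expR0 cos0 sin0 mulr1 mulr0. Qed.

Lemma normc_cexp z : normc (cexp z) = expR (complex.Re z).
Proof.
case: z => a b; rewrite /cexp/= !exprMn -mulrDr cos2Dsin2 mulr1 sqrtr_sqr.
by rewrite ger0_norm ?expR_ge0.
Qed.

Definition exp_rem (n : nat) w : R[i] :=
  cexp w - \sum_(j < n) (j`!%:R^-1)%:C * w ^+ j.

Lemma exp_remS n w : exp_rem n.+1 w = exp_rem n w - (n`!%:R^-1)%:C * w ^+ n.
Proof. by rewrite /exp_rem big_ord_recr/= opprD addrA. Qed.

Definition cderive1 (f : R -> R[i]) (x : R) (l : R[i]) :=
  is_derive x 1 (fun s => complex.Re (f s)) (complex.Re l) /\
  is_derive x 1 (fun s => complex.Im (f s)) (complex.Im l).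

Lemma cderive1B f g x l k : cderive1 f x l -> cderive1 g x k ->
  cderive1 (fun s => f s - g s) x (l - k).
Proof.
move=> [f1 f2] [g1 g2]; split.
  rewrite (_ : (fun _ => _) = (fun s => complex.Re (f s)) - (fun s => complex.Re (g s))).
    by rewrite (_ : complex.Re _ = complex.Re l - complex.Re k); [exact: is_deriveB|case: l {f1 f2}; case: k {g1 g2}].
  by apply/funext => s /=; rewrite -[RHS]/(complex.Re (f s) - complex.Re (g s)); case: (f s); case: (g s).
rewrite (_ : (fun _ => _) = (fun s => complex.Im (f s)) - (fun s => complex.Im (g s))).
  by rewrite (_ : complex.Im _ = complex.Im l - complex.Im k); [exact: is_deriveB|case: l {f1 f2}; case: k {g1 g2}].
by apply/funext => s /=; rewrite -[RHS]/(complex.Im (f s) - complex.Im (g s)); case: (f s); case: (g s).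
Qed.

Lemma cderive1_cexp w x : cderive1 (fun s => cexp (w * s%:C)) x (w * cexp (w * x%:C)).
Proof.
case: w => a b; split; rewrite /cexp /=.
  rewrite !mulr0 ?subr0 !add0r; under eq_fun do rewrite subr0 add0r.
  by apply: is_derive_eq; rewrite /GRing.scale/=; ring.
rewrite !mulr0 ?subr0 !add0r; under eq_fun do rewrite subr0 add0r.
by apply: is_derive_eq; rewrite /GRing.scale/=; ring.
Qed.

Lemma is_derive_mono (k : R) n (x : R) : is_derive x 1 (fun s : R => k * s ^+ n.+1)
  (n.+1%:R * k * x ^+ n).
Proof.
have h := @is_deriveX R R id n.+1 x 1 1 (is_derive_id x 1).
have h2 := is_deriveZ k h.
rewrite (_ : (fun s => _) = k \*: (id ^+ n.+1 : R -> R)); last first.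
  by apply/funext => s; rewrite /= exprfctE.
apply: (is_derive_eq h2).
by rewrite /GRing.scale/= mulr1 -mulr_natl; ring.
Qed.

Lemma cderive1_mono (c : R[i]) n x : cderive1 (fun s => c * (s%:C) ^+ n.+1) x
  (n.+1%:R * c * (x%:C) ^+ n).
Proof.
have E (k : nat) (s : R) : (s%:C : R[i]) ^+ k = (s ^+ k)%:C by rewrite rmorphXn.
rewrite E; split; rewrite ?cReM ?cImM/=.
  under eq_fun do rewrite E cReM/= mulr0 subr0.
  rewrite !mulr0 !subr0 (_ : complex.Im _ = 0) ?mul0r ?subr0; last first.
    by have -> : (n.+1%:R : R[i]) = (n.+1%:R : R)%:C by rewrite rmorph_nat.
  have -> : complex.Re (n.+1%:R : R[i]) = n.+1%:R.
    by have -> : (n.+1%:R : R[i]) = (n.+1%:R : R)%:C by rewrite rmorph_nat.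
  exact: is_derive_mono.
under eq_fun do rewrite E cImM/= mulr0 add0r.
rewrite !mulr0 !add0r (_ : complex.Im (n.+1%:R) = 0) ?mul0r ?addr0; last first.
  by have -> : (n.+1%:R : R[i]) = (n.+1%:R : R)%:C by rewrite rmorph_nat.
have -> : complex.Re (n.+1%:R : R[i]) = n.+1%:R.
  by have -> : (n.+1%:R : R[i]) = (n.+1%:R : R)%:C by rewrite rmorph_nat.
exact: is_derive_mono.
Qed.

Lemma cderive1_cst (c : R[i]) x : cderive1 (fun=> c) x 0.
Proof. by split; exact: is_derive_cst. Qed.

(** Differentiation lowers the order of the remainder by one; the induction of [exp_rem_bound] runs
    on this. *)
Lemma cderive1_exp_rem n w x :
  cderive1 (fun s => exp_rem n.+1 (w * s%:C)) x (w * exp_rem n (w * x%:C)).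
Proof.
elim: n => [|n IH].
  rewrite (_ : (fun _ => _) = (fun s => cexp (w * s%:C) - 1)).
    rewrite /exp_rem big_ord0 subr0 -[w * cexp _]subr0.
    by apply: cderive1B; [exact: cderive1_cexp|exact: cderive1_cst].
  by apply/funext => s; rewrite /exp_rem big_ord1 expr0 fact0 invr1 mulr1.
under eq_fun do rewrite exp_remS.
rewrite exp_remS mulrBr; apply: cderive1B => //.
have := cderive1_mono ((n.+1`!%:R^-1)%:C * w ^+ n.+1) n x.
under eq_fun do rewrite -mulrA -exprMn.
congr cderive1; rewrite exprMn factS natrM invfM rmorphM/=.
rewrite -(rmorph_nat (real_complex R)) exprS.
have n0 : (n.+1%:R : R) != 0 by rewrite pnatr_eq0.
rewrite (_ : forall A B C D E F : R[i], A * (B * C * (D * E)) * F = (A * B) * (C * (D * E) * F)); last by move=> *; ring.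
by rewrite -rmorphM/= mulfV// mul1r; ring.
Qed.

Lemma cderive1_MVT f (df : R -> R[i]) (M : R) : (forall x : R, 0 <= x <= 1 -> cderive1 f x (df x)) ->
  (forall x : R, 0 <= x <= 1 -> normc (df x) <= M) -> normc (f 1 - f 0) <= 2 * M.
Proof.
move=> H B; apply: le_trans (normc_le_ReIm _) _; rewrite mulrDl mul1r.
have key (F dF : R -> R) : (forall x : R, 0 <= x <= 1 -> is_derive x 1 F (dF x)) ->
    (forall x : R, 0 <= x <= 1 -> `|dF x| <= M) -> `|F 1 - F 0| <= M.
  move=> HF BF; have [||c] := @MVT _ F dF 0 1 ltr01.
  - move=> x; rewrite in_itv/= => /andP[x0 x1]; apply: HF; apply/andP; split; exact: ltW.
  - apply: derivable_within_continuous => x; rewrite in_itv/= => /HF h.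
    exact: ex_derive.
  - rewrite in_itv/= => /andP[c0 c1] ->; rewrite subr0 mulr1 BF//.
    by rewrite !ltW.
apply: lerD.
  rewrite (_ : complex.Re _ = complex.Re (f 1) - complex.Re (f 0)); last by case: (f 1); case: (f 0).
  apply: (key (fun s => complex.Re (f s)) (fun x => complex.Re (df x))) => x x01.
    exact: (H x x01).1.
  by apply: le_trans (B x x01); exact: le_Re_normc.
rewrite (_ : complex.Im _ = complex.Im (f 1) - complex.Im (f 0)); last by case: (f 1); case: (f 0).
apply: (key (fun s => complex.Im (f s)) (fun x => complex.Im (df x))) => x x01.
  exact: (H x x01).2.
by apply: le_trans (B x x01); exact: le_Im_normc.
Qed.

Lemma exp_rem0 n : exp_rem n.+1 (0 : R[i]) = 0.
Proof.
rewrite /exp_rem big_ord_recl expr0 fact0 invr1 mulr1 big1 ?addr0 ?cexp0 ?subrr//.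
by move=> i _; rewrite expr0n/= mulr0.
Qed.

(** Each step of the induction applies the mean value inequality on [[0, 1]] and pays its factor 2
    for the two real components; a power of a multiple of [|w|] with a constant independent of [n]
    is all that is needed. *)
Lemma exp_rem_bound n w : normc (exp_rem n w) <= (2 * normc w) ^+ n * expR (normc w).
Proof.
elim: n w => [|n IH] w.
  rewrite expr0 mul1r /exp_rem big_ord0 subr0 normc_cexp ler_expR.
  exact: le_trans (ler_norm _) (le_Re_normc _).
rewrite -[X in exp_rem _ X]mulr1 -[exp_rem _ _]subr0 -(exp_rem0 n) -(mulr0 w).
apply: le_trans (cderive1_MVT (fun x _ => cderive1_exp_rem n w x) (M := normc w * ((2 * normc w) ^+ n * expR (normc w))) _) _.
  move=> x /andP[x0 x1]; rewrite normcM ler_wpM2l ?normc_ge0//.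
  have wx : normc (w * x%:C) <= normc w.
    by rewrite normcM normc_real ger0_norm// ler_piMr ?normc_ge0.
  apply: le_trans (IH _) _; apply: ler_pM; rewrite ?exprn_ge0 ?expR_ge0 ?mulr_ge0 ?normc_ge0//.
    by apply: lerXn2r; rewrite ?nnegrE ?mulr_ge0 ?normc_ge0// ler_pM2l.
  by rewrite ler_expR.
by rewrite exprS !mulrA.
Qed.

End complex_exponential.

Section finite_laplace.
Variable R : realType.
Notation mu := (@lebesgue_measure R).
Implicit Types (f g : R -> R[i]) (h k : R -> R).

Lemma segment_bounded h (a b : R) : a <= b -> {within `[a, b], continuous h} ->
  exists M, forall x, a <= x <= b -> `|h x| <= M.
Proof.
move=> ab ch; have [c _ Hc] := EVT_max ab ch; have [d _ Hd] := EVT_min ab ch.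
exists (Num.max `|h c| `|h d|) => x xab.
rewrite ler_norml le_max; apply/andP; split; last first.
  by rewrite (le_trans (Hc x _) (ler_norm _))// in_itv.
rewrite lerNl; have := Hd x; rewrite in_itv/= => /(_ xab); rewrite -lerN2 => hx.
by rewrite le_max; apply/orP; right; apply: le_trans hx _; rewrite -normrN ler_norm.
Qed.

Lemma within_contM h k (A : set R) : {within A, continuous h} ->
  {within A, continuous k} -> {within A, continuous (fun x => h x * k x)}.
Proof. by move=> ch ck x; have H := continuousM (ch x) (ck x); exact: H. Qed.

Lemma within_contD h k (A : set R) : {within A, continuous h} ->
  {within A, continuous k} -> {within A, continuous (fun x => h x + k x)}.
Proof. by move=> ch ck x; have H := continuousD (ch x) (ck x); exact: H. Qed.

Lemma within_contB h k (A : set R) : {within A, continuous h} ->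
  {within A, continuous k} -> {within A, continuous (fun x => h x - k x)}.
Proof. by move=> ch ck x; have H := continuousB (ch x) (ck x); exact: H. Qed.

Lemma ccontM f g (a b : R) : ccont f a b -> ccont g a b ->
  ccont (fun x => f x * g x) a b.
Proof.
move=> [f1 f2] [g1 g2]; split.
  rewrite (_ : (fun _ => _) = (fun x => complex.Re (f x) * complex.Re (g x)
    - complex.Im (f x) * complex.Im (g x))).
    by apply: within_contB; exact: within_contM.
  by apply/funext => y; rewrite cReM.
rewrite (_ : (fun _ => _) = (fun x => complex.Re (f x) * complex.Im (g x)
    + complex.Im (f x) * complex.Re (g x))).
  by apply: within_contD; exact: within_contM.
by apply/funext => y; rewrite cImM.
Qed.

Lemma ccont_real h (a b : R) : {within `[a, b], continuous h} ->
  ccont (fun x => (h x)%:C) a b.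
Proof. by move=> ch; split => //= x; exact: cvg_cst. Qed.

Lemma ccont_cst (c : R[i]) (a b : R) : ccont (fun=> c) a b.
Proof. by split => x; exact: cvg_cst. Qed.

Lemma cderive1_ccont f (df : R -> R[i]) (a b : R) :
  (forall x : R, cderive1 f x (df x)) -> ccont f a b.
Proof.
move=> H; split; apply: derivable_within_continuous => x _; have [h1 h2] := H x;
  exact: ex_derive.
Qed.

Lemma ccont_cexp (w : R[i]) (a b : R) : ccont (fun t => cexp (w * t%:C)) a b.
Proof. exact: (cderive1_ccont _ _ (cderive1_cexp w)). Qed.

Lemma ccont_exp_rem n (w : R[i]) (a b : R) :
  ccont (fun t => exp_rem n (w * t%:C)) a b.
Proof.
case: n => [|n]; last exact: (cderive1_ccont _ _ (cderive1_exp_rem n w)).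
rewrite (_ : (fun _ => _) = (fun t => cexp (w * t%:C))); first exact: ccont_cexp.
by apply/funext => t; rewrite /exp_rem big_ord0 subr0.
Qed.

(** Integration stops at [T], so that the transform of a continuous [h] is entire. This is what
    compact support in time provides. *)
Definition finite_laplace (T : R) h (l : R[i]) : R[i] :=
  cintegral mu `[0, T] (fun t => cexp (- l * t%:C) * (h t)%:C).

(* The [j]-th Taylor coefficient at [l] of [finite_laplace T h]. *)
Definition laplace_coef (T : R) h (l : R[i]) (j : nat) : R[i] :=
  cintegral mu `[0, T]
    (fun t => (j`!%:R^-1 * (- t) ^+ j)%:C * (cexp (- l * t%:C) * (h t)%:C)).

(** With [exp (- l t)] factored out of [exp (- (l + z) t)], the remainder of the exponential series
    in [z] is integrated; raising [n] by one peels off one Taylor coefficient. *)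
Definition laplace_remainder (T : R) h (l z : R[i]) n : R[i] :=
  cintegral mu `[0, T]
    (fun t => exp_rem n (- z * t%:C) * (cexp (- l * t%:C) * (h t)%:C)).

Variable T : R.
Hypothesis T0 : 0 < T.

Lemma ccont_kernel h l : {within `[0, T], continuous h} ->
  ccont (fun t => cexp (- l * t%:C) * (h t)%:C) 0 T.
Proof.
by move=> ch; apply: ccontM; [exact: ccont_cexp|exact: ccont_real].
Qed.

Lemma continuous_monomial (k : R) j : continuous (fun t : R => k * (- t) ^+ j).
Proof.
move=> x; rewrite (_ : (fun t => _) = (fun t : R => (k * (-1) ^+ j) * t ^+ j)).
  case: j => [|j]; first by under eq_fun do rewrite expr0; exact: cvg_cst.
  have /@ex_derive /derivable1_diffP := is_derive_mono (k * (-1) ^+ j.+1) j x.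
  exact: differentiable_continuous.
by apply/funext => t; rewrite -mulrA -exprMn mulN1r.
Qed.

Lemma ccont_coef h l j : {within `[0, T], continuous h} ->
  ccont (fun t => (j`!%:R^-1 * (- t) ^+ j)%:C * (cexp (- l * t%:C) * (h t)%:C)) 0 T.
Proof.
move=> ch; apply: ccontM; last exact: ccont_kernel.
by apply: ccont_real; apply: continuous_subspaceT; exact: continuous_monomial.
Qed.

Lemma laplace_remainder0 h l z : laplace_remainder T h l z 0 = finite_laplace T h (l + z).
Proof.
apply: eq_cintegral => t _; rewrite /exp_rem big_ord0 subr0 mulrA -cexpD.
by congr (cexp _ * _); ring.
Qed.

Lemma laplace_remainderS h l z n : {within `[0, T], continuous h} ->
  laplace_remainder T h l z n.+1 =
  laplace_remainder T h l z n - z ^+ n * laplace_coef T h l n.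
Proof.
move=> ch; rewrite /laplace_remainder /laplace_coef.
have ic := ccont_integrable (ccont_coef l n ch).
have ir : cintegrable mu `[0, T]
    (fun t => exp_rem n (- z * t%:C) * (cexp (- l * t%:C) * (h t)%:C)).
  by apply: ccont_integrable; apply: ccontM; [exact: ccont_exp_rem|exact: ccont_kernel].
rewrite -cintegralZ// -cintegralB//; last exact: cintegrableZ.
apply: eq_cintegral => t _; rewrite exp_remS mulrBl; congr (_ - _).
rewrite !mulrA; congr (_ * _ * _).
by rewrite mulNr -mulrN -rmorphN exprMn rmorphM rmorphXn/=; ring.
Qed.

Lemma laplace_taylorE h l z n : {within `[0, T], continuous h} ->
  finite_laplace T h (l + z) - \sum_(j < n) z ^+ j * laplace_coef T h l j =
  laplace_remainder T h l z n.
Proof.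
move=> ch; elim: n => [|n IH]; first by rewrite big_ord0 subr0 laplace_remainder0.
by rewrite big_ord_recr/= opprD addrA IH laplace_remainderS.
Qed.

Lemma normc_kernel_bound h l (M : R) : (forall t, 0 <= t <= T -> `|h t| <= M) ->
  forall t, 0 <= t <= T ->
  normc (cexp (- l * t%:C) * (h t)%:C) <= expR (normc l * T) * M.
Proof.
move=> hM t tT; rewrite normcM normc_cexp normc_real.
apply: ler_pM; rewrite ?expR_ge0 ?normr_ge0//; last exact: hM.
rewrite ler_expR; apply: le_trans (ler_norm _) _; apply: le_trans (le_Re_normc _) _.
move: tT => /andP[t0 tT].
by rewrite normcM normcN normc_real ger0_norm// ler_wpM2l// normc_ge0.
Qed.

(** [C] is chosen before [h]: the final estimate compares infinitely many test functions and needs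
    this uniformity. *)
Lemma laplace_coef_bound l j : exists2 C, 0 <= C & forall h M,
  {within `[0, T], continuous h} -> (forall t, 0 <= t <= T -> `|h t| <= M) ->
  normc (laplace_coef T h l j) <= C * M.
Proof.
exists (2 * ((j`!%:R^-1 * T ^+ j) * expR (normc l * T) * T)).
  by rewrite !mulr_ge0 ?expR_ge0 ?exprn_ge0 ?invr_ge0// ltW.
move=> h M ch hM.
rewrite (_ : _ * M = 2 * ((j`!%:R^-1 * T ^+ j) * (expR (normc l * T) * M) * (T - 0))); last by ring.
apply: cintegral_itv_bound => //; [exact: ltW|exact: ccont_coef|].
move=> t tT; rewrite normcM; apply: ler_pM; rewrite ?normc_ge0//; last exact: normc_kernel_bound.
rewrite normc_real normrM ger0_norm ?invr_ge0// ler_wpM2l ?invr_ge0//.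
move: tT => /andP[t0 tT].
by rewrite normrX normrN ger0_norm//; apply: lerXn2r; rewrite ?nnegrE// ltW.
Qed.

(** [B] does not depend on [n], so this is both an expansion to every order and convergence of the
    series for [|z| < 1 / (2 * T)], [|z| <= 1]. *)
Lemma laplace_taylor h l : {within `[0, T], continuous h} ->
  exists2 B, 0 <= B & forall n z, normc z <= 1 ->
  normc (finite_laplace T h (l + z) - \sum_(j < n) z ^+ j * laplace_coef T h l j)
  <= B * (2 * T * normc z) ^+ n.
Proof.
move=> ch; have [M HM] := segment_bounded (ltW T0) ch.
have M0 : 0 <= M by apply: le_trans (HM 0 _); rewrite ?normr_ge0// lexx ltW.
exists (2 * (expR T * (expR (normc l * T) * M) * T)).
  by rewrite !mulr_ge0 ?expR_ge0// ltW.
move=> n z z1; rewrite laplace_taylorE//.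
rewrite (_ : _ * _ ^+ n = 2 * ((2 * T * normc z) ^+ n * expR T * (expR (normc l * T) * M) * (T - 0))); last by ring.
apply: cintegral_itv_bound; first exact: ltW.
  by apply: ccontM; [exact: ccont_exp_rem|exact: ccont_kernel].
move=> t tT; rewrite normcM; apply: ler_pM; rewrite ?normc_ge0//; last exact: normc_kernel_bound.
move: tT => /andP[t0 tT].
have zt : normc (- z * t%:C) <= T * normc z.
  by rewrite normcM normcN normc_real ger0_norm// mulrC ler_wpM2r ?normc_ge0.
apply: le_trans (exp_rem_bound _ _) _; apply: ler_pM; rewrite ?exprn_ge0 ?expR_ge0 ?mulr_ge0 ?normc_ge0//.
  apply: lerXn2r; rewrite ?nnegrE ?mulr_ge0 ?normc_ge0 ?(ltW T0)//.
  by rewrite -mulrA ler_pM2l.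
rewrite ler_expR; apply: le_trans zt _.
by rewrite ler_piMr// ltW.
Qed.

Lemma finite_laplace_cdiff h : {within `[0, T], continuous h} ->
  forall z, exists L, cdiff_at (finite_laplace T h) z L.
Proof.
move=> ch l; have [B B0 HB] := laplace_taylor l ch.
exists (laplace_coef T h l 1) => e e0.
have k0 : 0 < 1 + B * (4 * T ^+ 2) by rewrite ltr_pwDl// !mulr_ge0// ?exprn_ge0// ltW.
exists (Num.min 1 (e / (1 + B * (4 * T ^+ 2)))); first by rewrite lt_min ltr01 divr_gt0.
move=> w; rewrite lt_min => /andP[/ltW w1 we].
have := HB 2 _ w1; rewrite [l + _]addrC subrK.
have H0 : finite_laplace T h l = laplace_coef T h l 0.
  apply: eq_cintegral => t _.
  by rewrite expr0 fact0 invr1 mulr1 mul1r.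
rewrite big_ord_recr big_ord1/= expr0 mul1r expr1 -H0 opprD addrA [_ * laplace_coef _ _ _ _]mulrC.
move=> /le_trans; apply.
have n0 := normc_ge0 (w - l).
move: we; rewrite ltr_pdivlMr// => /ltW we.
rewrite (_ : B * _ ^+ 2 = normc (w - l) * (B * (4 * T ^+ 2)) * normc (w - l)); last by ring.
by rewrite ler_wpM2r//; apply: le_trans we; rewrite ler_wpM2l// lerDr.
Qed.

Lemma zero_entire (f : R[i] -> R[i]) (c : R[i]) (r : R) : 0 < r ->
  (forall z, exists L, cdiff_at f z L) ->
  (forall z, normc (z - c) < r -> f z = 0) -> forall z, f z = 0.
Proof.
move=> r0 fd fz z; have n0 := normc_ge0 (z - c).
(* [zero_spreads] loses a factor 16 in the radius; differentiability everywhere allows any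
   radius. *)
apply: (@zero_spreads _ f c (16 * (normc (z - c) + 1)) r) => //; first by rewrite mulr_gt0// ltr_pwDr.
by lra.
Qed.

Lemma laplace_coef_eq0 h l : {within `[0, T], continuous h} ->
  (forall j, laplace_coef T h l j = 0) -> forall z, finite_laplace T h z = 0.
Proof.
move=> ch c0; have [B B0 HB] := laplace_taylor l ch.
(* Within this radius the ratio [2 * T * |z - l|] is at most one half, so the remainders tend to
   zero. *)
have r0 : 0 < Num.min 1 (4 * T)^-1 by rewrite lt_min ltr01 invr_gt0 mulr_gt0.
apply: (zero_entire (c := l) r0 (finite_laplace_cdiff ch)) => z.
rewrite lt_min => /andP[/ltW z1 zT].
have n0 := normc_ge0 (z - l).
have zT2 : 2 * T * normc (z - l) <= 2^-1.
  move: zT; rewrite -[_^-1]mul1r ltr_pdivlMr ?mulr_gt0// => zT; lra.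
apply: eq0_normc; apply/eqP; rewrite eq_le normc_ge0 andbT leNgt; apply/negP => f0.
have [n Hn] := half_pow_small B f0.
move: Hn; apply/negP; rewrite -leNgt.
have := HB n _ z1; rewrite [l + _]addrC subrK big1 ?subr0; last by move=> j _; rewrite c0 mulr0.
move=> /le_trans; apply; rewrite ler_wpM2l// -exprVn; apply: lerXn2r => //.
  by rewrite nnegrE !mulr_ge0// ltW.
by rewrite nnegrE invr_ge0.
Qed.

End finite_laplace.

(** * Asymptotic expansions at the origin and their quotients *)

Section expansions.
Variable R : realType.
Implicit Types (F : R[i] -> R[i]) (c d : nat -> R[i]).

Lemma le0_small (x C r : R) : 0 < r -> (forall t, 0 < t -> t < r -> x <= C * t) -> x <= 0.
Proof.
move=> r0 H; rewrite leNgt; apply/negP => x0.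
pose D := `|C| + 1; have D0 : 0 < D by rewrite ltr_pwDr.
pose t := Num.min (r / 2) (x / (2 * D)).
have t0 : 0 < t by rewrite lt_min !divr_gt0// mulr_gt0.
have tr : t < r by rewrite gt_min; apply/orP; left; lra.
have tx : t * (2 * D) <= x by rewrite -ler_pdivlMr ?mulr_gt0// ge_min lexx orbT.
have h1 := H t t0 tr.
have h2 : C * t <= D * t by rewrite ler_pM2r// /D; have := ler_norm C; lra.
have : 0 < D * t by rewrite mulr_gt0.
lra.
Qed.

(** An asymptotic expansion to all orders, with constants that may depend on [n]; this form is
    stable under the manipulations below and still determines the coefficients. *)
Definition expands F c := forall n, exists2 C, 0 <= C &
  forall z, normc z <= 1 -> normc (F z - \sum_(j < n) z ^+ j * c j) <= C * normc z ^+ n.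

(** The constant coefficient is killed by letting [z] tend to 0 along the positive reals; then a
    factor [z] is cancelled, which is why only nonzero [z] occur. *)
Lemma poly_small N d (C r : R) : 0 < r -> r <= 1 ->
  (forall z, z != 0 -> normc z < r -> normc (\sum_(j < N) z ^+ j * d j) <= C * normc z ^+ N) ->
  forall j, (j < N)%N -> d j = 0.
Proof.
move=> r0 r1; elim: N d => [//|N IH] d H.
have d0 : d 0%N = 0.
  apply: eq0_normc; apply/eqP; rewrite eq_le normc_ge0 andbT.
  pose S := \sum_(j < N) normc (d j.+1).
  apply: (@le0_small _ (`|C| + S) r r0) => t t0 tr.
  have nt : normc (t%:C : R[i]) = t by rewrite normc_real ger0_norm// ltW.
  have t1 : t <= 1 by apply: le_trans r1; exact: ltW.
  have := H t%:C; rewrite nt eq_complex /= gt_eqF// => /(_ erefl tr).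
  rewrite big_ord_recl/= expr0 mul1r => h.
  rewrite -(addrK (\sum_(i < N) t%:C ^+ bump 0 i * d (bump 0 i)) (d 0%N)).
  apply: le_trans (le_normcB _ _) _; rewrite mulrDl lerD//.
    apply: le_trans h _; apply: (@le_trans _ _ (`|C| * t ^+ N.+1)).
      by rewrite ler_wpM2r ?ler_norm// exprn_ge0// ltW.
    by rewrite ler_wpM2l// exprS ler_piMr// ?exprn_ile1// ltW.
  rewrite /S mulr_suml.
  elim/big_ind2 : _ => [|x1 x2 y1 y2 h1 h2|i _]; first by rewrite normc0.
    by apply: le_trans (le_normcD _ _) _; exact: lerD.
  rewrite normcM normcX nt mulrC ler_wpM2l ?normc_ge0// /bump/= add1n exprS.
  by rewrite ler_piMr// ?exprn_ile1// ltW.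
case=> [//|j]; rewrite ltnS => jN.
apply: (IH (fun j => d j.+1)) => // z z0 zr.
have := H z z0 zr; rewrite big_ord_recl/= d0 mulr0 add0r.
rewrite (eq_bigr (fun i : 'I_N => z * (z ^+ i * d i.+1))); last first.
  by move=> i _; rewrite /bump/= add1n exprS mulrA.
rewrite -mulr_sumr normcM exprS mulrCA ler_pM2l//; exact: normc_gt0.
Qed.

Lemma expands_uniq F c d (r : R) : 0 < r -> expands F c ->
  (forall n, exists2 C, 0 <= C & forall z, z != 0 -> normc z < r ->
     normc (F z - \sum_(j < n) z ^+ j * d j) <= C * normc z ^+ n) ->
  c =1 d.
Proof.
move=> r0 Fc Fd j.
have [C C0 HC] := Fc j.+1; have [D D0 HD] := Fd j.+1.
have r10 : 0 < Num.min r 1 by rewrite lt_min r0 ltr01.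
apply/eqP; rewrite -subr_eq0; apply/eqP.
apply: (@poly_small j.+1 (fun j => c j - d j) (C + D) _ r10) => //.
  by rewrite ge_min lexx orbT.
move=> z z0; rewrite lt_min => /andP[zr /ltW z1].
rewrite (_ : \sum_(i < _) _ = (F z - \sum_(i < j.+1) z ^+ i * d i) - (F z - \sum_(i < j.+1) z ^+ i * c i)).
  apply: le_trans (le_normcB _ _) _; rewrite addrC mulrDl.
  by apply: lerD; [exact: HC|exact: HD].
rewrite opprB addrC addrA subrK -sumrB; apply: eq_bigr => i _; ring.
Qed.

Lemma expands_lead F c n : expands F c -> (forall j, (j < n)%N -> c j = 0) ->
  exists2 C, 0 <= C & forall z, normc z <= 1 ->
    normc (F z - z ^+ n * c n) <= C * normc z ^+ n.+1.
Proof.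
move=> /(_ n.+1)[C C0 HC] c0; exists C => // z /HC.
by rewrite big_ord_recr/= big1 ?add0r// => j _; rewrite c0 ?mulr0.
Qed.

(* If [f] tends to zero at the origin and [A = f B] there, with [B] of order [p]
   and [A] of order [q], then [p < q], and any other pair with [A1 = f B1]
   satisfies [A1 = O(z^(q-p))] with the stated leading coefficient. *)
Lemma expands_ratio (A B A1 B1 f : R[i] -> R[i]) a b a1 b1 (p q : nat) (r : R) :
  0 < r -> expands A a -> expands B b -> expands A1 a1 -> expands B1 b1 ->
  (forall e, 0 < e -> exists2 d, 0 < d & forall z, normc z < d -> normc (f z) < e) ->
  (forall z, normc z < r -> A z = f z * B z) ->
  (forall z, normc z < r -> A1 z = f z * B1 z) ->
  (forall j, (j < q)%N -> a j = 0) -> a q != 0 ->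
  (forall j, (j < p)%N -> b j = 0) -> b p != 0 ->
  (p < q)%N /\ (forall j, (j < q - p)%N -> a1 j = 0) /\ a1 (q - p)%N = a q / b p * b1 0%N.
Proof.
move=> r0 Aa Bb Aa1 Bb1 f0 AE AE1 aq0 aq bp0 bp.
have [Ca Ca0 HA] := expands_lead Aa aq0.
have [Cb Cb0 HB] := expands_lead Bb bp0.
have [C1 C10 HB1] : exists2 C, 0 <= C & forall z, normc z <= 1 ->
    normc (B1 z - b1 0%N) <= C * normc z.
  have [//|C C0 H] := @expands_lead _ _ 0 Bb1; exists C => // z /H.
  by rewrite expr0 mul1r expr1.
have naq := normc_gt0 aq; have nbp := normc_gt0 bp.
have pq : (p < q)%N.
  rewrite ltnNge; apply/negP => qp.
  (* If [q <= p], this size of [f] makes [f B] at most half of the leading term of [A], so the other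
     half would have to be [O(z ^ (q + 1))]. *)
  pose e := normc (a q) / (2 * (normc (b p) + Cb)).
  have bC : 0 < normc (b p) + Cb by rewrite ltr_pwDl.
  have e0 : 0 < e by rewrite divr_gt0// mulr_gt0.
  have [d d0 Hd] := f0 e e0.
  suff : normc (a q) / 2 <= 0 by lra.
  have m0 : 0 < Num.min 1 (Num.min d r) by rewrite !lt_min ltr01 d0.
  apply: (@le0_small _ Ca _ m0) => t t0.
  rewrite !lt_min => /andP[/ltW t1 /andP[td tr]].
  have nt : normc (t%:C : R[i]) = t by rewrite normc_real ger0_norm// ltW.
  have := HA t%:C; rewrite nt => /(_ t1) hA.
  have := HB t%:C; rewrite nt => /(_ t1) hB.
  have := Hd t%:C; rewrite nt => /(_ td) /ltW hf.
  have AEt := AE t%:C; rewrite nt in AEt; have {}AEt := AEt tr.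
  have tq : 0 < t ^+ q by rewrite exprn_gt0.
  have hB' : normc (B t%:C) <= t ^+ q * (normc (b p) + Cb).
    rewrite -(subrK (t%:C ^+ p * b p) (B _)); apply: le_trans (le_normcD _ _) _.
    rewrite normcM normcX nt addrC mulrDr lerD//.
      by rewrite ler_wpM2r ?normc_ge0// ler_wiXn2l// ltW.
    apply: le_trans hB _; rewrite mulrC ler_wpM2r//.
    by rewrite ler_wiXn2l ?(ltW t0)// ltnW.
  have hA' : t ^+ q * normc (a q) <= e * (t ^+ q * (normc (b p) + Cb)) + Ca * t ^+ q.+1.
    have -> : t ^+ q * normc (a q) = normc (t%:C ^+ q * a q) by rewrite normcM normcX nt.
    rewrite -(subKr (A t%:C) (_ * _)); apply: le_trans (le_normcB _ _) _.
    rewrite lerD// AEt normcM; apply: ler_pM; rewrite ?normc_ge0//.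
  have ee : e * (t ^+ q * (normc (b p) + Cb)) = t ^+ q * (normc (a q) / 2).
    by rewrite /e; field; lra.
  have : t ^+ q * (normc (a q) / 2) <= t ^+ q * (Ca * t).
    by move: hA'; rewrite ee exprSr; lra.
  by rewrite ler_pM2l.
split=> //; set m := (q - p)%N.
pose k := a q / b p * b1 0%N.
pose d j := if j == m then k else 0.
have [r1 r10 [C C0 HC]] : exists2 r1, 0 < r1 & exists2 C, 0 <= C & forall z, z != 0 -> normc z < r1 ->
    normc (A1 z - z ^+ m * k) <= C * normc z ^+ m.+1.
  (* The last bound keeps [beta], defined below, within [N / 2] of [b p], hence away from zero. *)
  have rr : 0 < Num.min r (Num.min 1 (normc (b p) / (2 * (Cb + 1)))).
    by rewrite !lt_min r0 ltr01 divr_gt0// mulr_gt0// ltr_pwDr.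
  exists (Num.min r (Num.min 1 (normc (b p) / (2 * (Cb + 1))))) => //.
  pose N := normc (b p); pose M := (normc (a q) + Ca) * (normc (b1 0%N) + C1).
  pose D := normc (a q) * C1 + Ca * (normc (b1 0%N) + C1).
  have M0 : 0 <= M by rewrite mulr_ge0// addr_ge0// ?normc_ge0.
  have D0 : 0 <= D by rewrite addr_ge0// mulr_ge0// ?addr_ge0 ?normc_ge0.
  exists (N^-1 * (D + 2 * M / N * Cb)).
    by rewrite !(normc_ge0, mulr_ge0, addr_ge0, invr_ge0)//.
  move=> z z0; rewrite !lt_min => /andP[zr /andP[/ltW z1]].
  rewrite ltr_pdivlMr ?mulr_gt0 ?ltr_pwDr// => zN.
  have nz := normc_gt0 z0.
  set x := normc z in nz zN z1 *.
  pose beta := B z / z ^+ p; pose alpha := A z / z ^+ q.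
  have zp0 : z ^+ p != 0 by rewrite expf_neq0.
  have zq0 : z ^+ q != 0 by rewrite expf_neq0.
  have hb : normc (beta - b p) <= Cb * x.
    have -> : beta - b p = (B z - z ^+ p * b p) / z ^+ p by rewrite /beta; field.
    rewrite normcM normcV normcX ler_pdivrMr ?exprn_gt0// -mulrA -exprS; exact: HB.
  have ha : normc (alpha - a q) <= Ca * x.
    have -> : alpha - a q = (A z - z ^+ q * a q) / z ^+ q by rewrite /alpha; field.
    rewrite normcM normcV normcX ler_pdivrMr ?exprn_gt0// -mulrA -exprS; exact: HA.
  have hb1 := HB1 z z1; rewrite -/x in hb1.
  (* Elimination of [f] from the two relations: [A1 * B = A * B1], divided by [z ^ p]. The
     normalised factors [alpha] and [beta] tend to [a q] and [b p]. *)
  have E : A1 z * beta = z ^+ m * (alpha * B1 z).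
    have zqE : z ^+ q = z ^+ m * z ^+ p by rewrite -exprD subnK// ltnW.
    rewrite /beta /alpha (AE1 _ zr) (AE _ zr) zqE.
    have zm0 : z ^+ m != 0 by rewrite expf_neq0.
    by field; rewrite zp0 zm0.
  have beta_lb : N / 2 <= normc beta.
    have : N <= normc beta + normc (beta - b p).
      by have := le_normcB beta (beta - b p); rewrite subKr.
    move: hb; rewrite -/N => h; have : Cb * x <= N / 2; last lra.
    by have := zN; rewrite -/N; lra.
  have alpha_ub : normc alpha <= normc (a q) + Ca.
    rewrite -(subrK (a q) alpha); apply: le_trans (le_normcD _ _) _; rewrite addrC lerD2l.
    by apply: le_trans ha _; rewrite ler_piMr.
  have B1_ub : normc (B1 z) <= normc (b1 0%N) + C1.
    rewrite -(subrK (b1 0%N) (B1 z)); apply: le_trans (le_normcD _ _) _; rewrite addrC lerD2l.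
    by apply: le_trans hb1 _; rewrite ler_piMr.
  have A1_ub : normc (A1 z) <= 2 * M / N * x ^+ m.
    have h : normc (A1 z) * (N / 2) <= x ^+ m * M.
      apply: (@le_trans _ _ (normc (A1 z) * normc beta)).
        by rewrite ler_wpM2l ?normc_ge0.
      rewrite -normcM E normcM normcX ler_wpM2l ?exprn_ge0 ?(ltW nz)//.
      by rewrite normcM /M; apply: ler_pM; rewrite ?normc_ge0.
    have -> : 2 * M / N * x ^+ m = x ^+ m * M / (N / 2) by field; rewrite gt_eqF.
    by rewrite ler_pdivlMr// divr_gt0.
  have E2 : b p * (A1 z - z ^+ m * k) =
      z ^+ m * ((alpha - a q) * B1 z + a q * (B1 z - b1 0%N)) - A1 z * (beta - b p).
    have -> : A1 z * (beta - b p) = z ^+ m * (alpha * B1 z) - A1 z * b p by rewrite mulrBr E.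
    by rewrite /k; field.
  have h : N * normc (A1 z - z ^+ m * k) <= x ^+ m.+1 * (D + 2 * M / N * Cb).
    rewrite -normcM E2 [x ^+ _ * _]mulrDr; apply: le_trans (le_normcB _ _) _; apply: lerD.
      rewrite normcM normcX exprSr -mulrA ler_wpM2l ?exprn_ge0 ?(ltW nz)//.
      rewrite (_ : x * D = Ca * x * (normc (b1 0%N) + C1) + normc (a q) * (C1 * x)); last by rewrite /D; ring.
      apply: le_trans (le_normcD _ _) _; rewrite !normcM; apply: lerD.
        by apply: ler_pM; rewrite ?normc_ge0.
      by rewrite ler_wpM2l ?normc_ge0.
    rewrite normcM (_ : x ^+ m.+1 * _ = (2 * M / N * x ^+ m) * (Cb * x)); last by rewrite exprSr; ring.
    by apply: ler_pM; rewrite ?normc_ge0.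
  rewrite -[leRHS]mulrA ler_pdivlMl//.
  by apply: le_trans h _; rewrite mulrC.
have ad : forall j, (j < m.+1)%N -> a1 j - d j = 0.
  have [C2 C20 HC2] := Aa1 m.+1.
  have r11 : 0 < Num.min r1 1 by rewrite lt_min r10 ltr01.
  apply: (@poly_small m.+1 _ (C2 + C) _ r11); first by rewrite ge_min lexx orbT.
  move=> z z0; rewrite lt_min => /andP[zr1 /ltW z1].
  have -> : \sum_(j < m.+1) z ^+ j * (a1 j - d j) =
     (A1 z - z ^+ m * k) - (A1 z - \sum_(j < m.+1) z ^+ j * a1 j).
    under eq_bigr do rewrite mulrBr.
    rewrite sumrB [X in _ - X](_ : _ = z ^+ m * k); first by ring.
    rewrite big_ord_recr/= /d eqxx big1 ?add0r// => i _.
    by rewrite ltn_eqF// mulr0.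
  apply: le_trans (le_normcB _ _) _; rewrite addrC mulrDl lerD//.
    exact: HC2.
  exact: HC.
split.
  move=> j jm; have := ad j (ltnW jm); rewrite /d ltn_eqF// subr0; exact.
by have := ad m (ltnSn m); rewrite /d eqxx => /eqP; rewrite subr_eq0 => /eqP.
Qed.

End expansions.

(** * Taylor coefficients of the pairings at a root of the kernel's transform *)

Section laplace_root.
Variables (R : realType) (V : Type) (W : V -> Prop) (Lap : V -> V).
Variables (h h1 : V -> R -> R) (xi : V -> R) (T a : R).
Variables (G : set R[i]^o) (Khat : R[i]^o -> R[i]^o) (l0 : R[i]).
Hypothesis T0 : 0 < T.
Hypothesis WL : forall eta, W eta -> W (Lap eta).
Hypothesis ch : forall eta, W eta -> {within `[0, T], continuous (h eta)}.
Hypothesis ch1 : forall eta, W eta -> {within `[0, T], continuous (h1 eta)}.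
Hypothesis hA : forall eta l, W eta ->
  l * finite_laplace T (h eta) l - (xi eta)%:C = finite_laplace T (h1 eta) l.
Hypothesis hK : forall eta (l : R[i]), W eta -> a < complex.Re l ->
  finite_laplace T (h1 eta) l = Khat l * finite_laplace T (h (Lap eta)) l.
Hypotheses (oG : open G) (cG : connected G).
Hypothesis dK : forall z, G z -> derivable Khat z 1.
Hypothesis GRe : forall z : R[i], a < complex.Re z -> G z.
Hypotheses (Gl0 : G l0) (l0n0 : l0 != 0) (Kl0 : Khat l0 = 0).

Lemma finite_laplace_expands k : {within `[0, T], continuous k} ->
  expands (fun z => finite_laplace T k (l0 + z)) (laplace_coef T k l0).
Proof.
move=> ck n; have [B B0 HB] := laplace_taylor T0 l0 ck.
exists (B * (2 * T) ^+ n); first by rewrite !mulr_ge0// exprn_ge0// mulr_ge0// ltW.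
by move=> z /(HB n); rewrite [(_ * normc z) ^+ n]exprMn mulrA.
Qed.

(** Both sides are differentiable on [G] and agree on the unit disc about [a + 1], which lies in the
    half-plane of [hK]. *)
Lemma laplace_extension_eq eta z : W eta -> G z ->
  finite_laplace T (h1 eta) z = Khat z * finite_laplace T (h (Lap eta)) z.
Proof.
move=> We Gz; apply/eqP; rewrite -subr_eq0; apply/eqP.
pose f : R[i]^o -> R[i]^o := fun z => finite_laplace T (h1 eta) z - Khat z * finite_laplace T (h (Lap eta)) z.
have df w : G w -> derivable f w 1.
  move=> Gw; apply/derivable_cdiff; apply: cdiff_sub.
    exact: (finite_laplace_cdiff T0 (ch1 We)).
  apply: cdiff_mul; first by apply/derivable_cdiff; exact: dK.
  exact: (finite_laplace_cdiff T0 (ch (WL We))).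
have Ga : G ((a + 1)%:C) by apply: GRe => /=; rewrite ltrDl.
have fa (w : R[i]) : normc (w - (a + 1)%:C) < 1 -> f w = 0.
  move=> wa; rewrite /f hK ?subrr//.
  have := le_lt_trans (le_Re_normc _) wa; case: w {wa} => x y /=.
  by rewrite ltr_norml; lra.
exact: (identity_theorem oG cG df Ga ltr01 fa Gz).
Qed.

(** Comparison of coefficients in [hA] at [l0 + z]: the factor [l0 + z] mixes two consecutive
    coefficients, and the datum takes the place of the missing coefficient of index -1. *)
Lemma laplace_coef_rec eta j : W eta -> laplace_coef T (h1 eta) l0 j =
  l0 * laplace_coef T (h eta) l0 j +
  (if j is j'.+1 then laplace_coef T (h eta) l0 j' else - (xi eta)%:C).
Proof.
move=> We; have E := finite_laplace_expands (ch We).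
have E1 := finite_laplace_expands (ch1 We).
set H := laplace_coef T (h eta) l0 in E *.
pose d j := l0 * H j + (if j is j'.+1 then H j' else - (xi eta)%:C).
rewrite -/(d j); apply: (expands_uniq ltr01 E1 _ j); case=> [|k].
  have [C C0 HC] := E1 0; exists C => // z _ /ltW /HC.
  by rewrite !big_ord0.
have [C C0 HC] := E k.+1; have [D D0 HD] := E k.
exists (normc l0 * C + D); first by rewrite addr_ge0// mulr_ge0// normc_ge0.
move=> z _ /ltW z1; rewrite -hA//.
set F := finite_laplace _ _ _ in HC HD *.
rewrite (_ : _ - _ = l0 * (F - \sum_(j < k.+1) z ^+ j * H j) + z * (F - \sum_(j < k) z ^+ j * H j)).
  apply: le_trans (le_normcD _ _) _; rewrite !normcM mulrDl; apply: lerD.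
    by rewrite -mulrA ler_wpM2l ?normc_ge0// HC.
  by rewrite exprS mulrCA ler_wpM2l ?normc_ge0// HD.
have -> : \sum_(i < k.+1) z ^+ i * d i =
    l0 * (\sum_(i < k.+1) z ^+ i * H i) + (z * (\sum_(i < k) z ^+ i * H i) - (xi eta)%:C).
  under eq_bigr do rewrite mulrDr mulrCA.
  rewrite big_split/= -mulr_sumr; congr (_ + _).
  rewrite big_ord_recl/= expr0 mul1r addrC; congr (_ - _).
  by rewrite mulr_sumr; apply: eq_bigr => i _; rewrite /bump/= add1n exprS mulrA.
by ring.
Qed.

Variable eta0 : V.
Hypotheses (W0 : W eta0) (xi0 : xi eta0 != 0).

Lemma laplace_order (k : R -> R) : {within `[0, T], continuous k} ->
  (exists z, finite_laplace T k z != 0) ->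
  exists n, laplace_coef T k l0 n != 0 /\ forall j, (j < n)%N -> laplace_coef T k l0 j = 0.
Proof.
move=> ck [z kz].
have [j0 j0n] : exists j, laplace_coef T k l0 j != 0.
  apply: contrapT => /forallNP c0; move: kz; apply/negP; rewrite negbK; apply/eqP.
  by apply: (laplace_coef_eq0 T0 ck (l := l0)) => j; have /negP := c0 j; rewrite negbK => /eqP.
have ex : exists j, laplace_coef T k l0 j != 0 by exists j0.
exists (ex_minn ex); case: ex_minnP => n cn mn; split => // j jn.
by apply/eqP/negPn/negP => /mn; rewrite leqNgt jn.
Qed.

(** Here [m] and [c] play the role of the order and leading coefficient of [Khat] at [l0]. For every
    [eta] the coefficients of [h1 eta] of index below [m] vanish, so the recursion expresses those
    of [h eta] by [xi eta]; at index [m] the right side becomes [c] times the value of the transform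
    of [h (Lap eta)] at [l0], that is [c * xi (Lap eta) / l0]. *)
Lemma laplace_root_coef : exists m (a0 b0 : R[i]), b0 != 0 /\
  forall eta, W eta ->
    laplace_coef T (h eta) l0 m = a0 * (xi eta)%:C + b0 * (xi (Lap eta))%:C.
Proof.
(* At [l = 0] the relation [hA] gives the value [- xi eta0], so this transform has a finite order
   [q] at [l0]. *)
have A0 : finite_laplace T (h1 eta0) 0 != 0.
  rewrite -hA// mul0r sub0r oppr_eq0; apply: contra xi0 => /eqP/complexI ->//.
have [|q [aq aq0]] := laplace_order (ch1 W0); first by exists 0.
have [|p [bp bp0]] := laplace_order (ch (WL W0)).
  (* If the transform of [h (Lap eta0)] were identically zero, that of [h1 eta0] would vanish on a
     disc of the half-plane, hence everywhere. *)
  apply: contrapT => /forallNP c0; move: A0; apply/negP; rewrite negbK; apply/eqP.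
  apply: (@zero_entire _ _ (a + 1)%:C 1 ltr01 (finite_laplace_cdiff T0 (ch1 W0))) => z za.
  rewrite laplace_extension_eq//.
    by have /negP := c0 z; rewrite negbK => /eqP ->; rewrite mulr0.
  apply: GRe; have := le_lt_trans (le_Re_normc _) za; case: z {za} => x y /=.
  by rewrite ltr_norml; lra.
have [r r0 Hr] := (open_normcP G).1 oG _ Gl0.
pose f z := Khat (l0 + z).
(* The root enters here: [Khat] tends to zero at [l0], which forces [p < q]. *)
have f0 e : 0 < e -> exists2 d, 0 < d & forall z, normc z < d -> normc (f z) < e.
  move=> e0; have [L HL] := (derivable_cdiff _ _).1 (dK Gl0).
  have [d d0 Hd] := cdiff_cont HL e0; exists d => // z zd.
  by have := Hd (l0 + z); rewrite Kl0 subr0 addrC addKr; apply.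
have ratio eta : W eta -> (p < q)%N /\ (forall j, (j < q - p)%N -> laplace_coef T (h1 eta) l0 j = 0) /\
    laplace_coef T (h1 eta) l0 (q - p) =
    laplace_coef T (h1 eta0) l0 q / laplace_coef T (h (Lap eta0)) l0 p *
    laplace_coef T (h (Lap eta)) l0 0.
  move=> We.
  have fE eta' : W eta' -> forall z, normc z < r ->
      finite_laplace T (h1 eta') (l0 + z) = f z * finite_laplace T (h (Lap eta')) (l0 + z).
    move=> We' z zr; apply: laplace_extension_eq => //; apply: Hr.
    by rewrite addrC addKr.
  apply: (@expands_ratio _ (fun z => finite_laplace T (h1 eta0) (l0 + z))
    (fun z => finite_laplace T (h (Lap eta0)) (l0 + z))
    (fun z => finite_laplace T (h1 eta) (l0 + z))
    (fun z => finite_laplace T (h (Lap eta)) (l0 + z)) f _ _ _ _ p q r r0) => //.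
  - exact/finite_laplace_expands/ch1.
  - exact/finite_laplace_expands/ch/WL.
  - exact/finite_laplace_expands/ch1.
  - exact/finite_laplace_expands/ch/WL.
  - exact: fE.
  - exact: fE.
have [pq _] := ratio _ W0.
set c := laplace_coef T (h1 eta0) l0 q / laplace_coef T (h (Lap eta0)) l0 p in ratio.
have c0 : c != 0 by rewrite mulf_neq0 ?invr_eq0.
set m := (q - p)%N in ratio; have m0 : (0 < m)%N by rewrite subn_gt0.
(* Since [0 < m], the transform of [h1 eta] vanishes at [l0]. *)
have H0 eta : W eta -> l0 * laplace_coef T (h eta) l0 0 = (xi eta)%:C.
  move=> We; have [_ [/(_ 0 m0)]] := ratio _ We.
  by rewrite laplace_coef_rec// => /eqP; rewrite subr_eq0 => /eqP.
have HS eta j : W eta -> (j < m)%N ->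
    l0 ^+ j.+1 * laplace_coef T (h eta) l0 j = (-1) ^+ j * (xi eta)%:C.
  move=> We; elim: j => [|j IH] jm; first by rewrite expr1 H0// mul1r.
  have [_ [/(_ _ jm) + _]] := ratio _ We.
  rewrite laplace_coef_rec// => /eqP; rewrite addr_eq0 => /eqP E.
  rewrite exprSr -mulrA E mulrN IH; last exact: ltnW.
  by rewrite exprS; ring.
have l0m : l0 ^+ m.+1 != 0 by rewrite expf_neq0.
exists m, ((-1) ^+ m / l0 ^+ m.+1), (c / l0 ^+ 2); split.
  by rewrite mulf_neq0// invr_eq0 expf_neq0.
move=> eta We; have [_ [_ Em]] := ratio _ We.
have := H0 _ (WL We) => E0.
move: Em; rewrite laplace_coef_rec//; case: m m0 HS l0m {ratio} => [//|m] _ HS l0m.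
have := HS _ m We (ltnSn _); set Hm := laplace_coef _ _ _ m => Em EE.
have s2 : (-1 : R[i]) ^+ m * (-1) ^+ m = 1 by rewrite -exprMn mulrNN mulr1 expr1n.
have xE : (xi eta)%:C = (-1) ^+ m * (l0 ^+ m.+1 * Hm).
  by rewrite Em mulrA s2 mul1r.
apply: (mulfI l0n0).
have -> : l0 * laplace_coef T (h eta) l0 m.+1 = c * laplace_coef T (h (Lap eta)) l0 0 - Hm.
  by rewrite -EE; ring.
rewrite -E0 xE (exprS l0 m.+1) (exprS l0 m) expr2 [(-1) ^+ m.+1]exprS.
have -> : l0 * (-1 * (-1) ^+ m / (l0 * (l0 * l0 ^+ m)) * ((-1) ^+ m * (l0 * l0 ^+ m * Hm)) +
   c / (l0 * l0) * (l0 * laplace_coef T (h (Lap eta)) l0 0)) =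
   - ((-1) ^+ m * (-1) ^+ m) * Hm + c * laplace_coef T (h (Lap eta)) l0 0.
  by field; rewrite l0n0 expf_neq0.
by rewrite s2 mulN1r addrC.
Qed.

End laplace_root.

(** * Convolutions *)

Section convolution.
Variable R : realType.
Notation mu := (@lebesgue_measure R).

Lemma measurable_shift (s : R) :
  measurable_fun [set: measurableTypeR R] (fun t : measurableTypeR R => t - s : measurableTypeR R).
Proof. by apply: measurable_funB => //; exact: measurable_cst. Qed.

(** Translation invariance from uniqueness: the image measure gives half-open intervals their
    length. *)
Lemma lebesgue_measure_shift (s : R) (A : set (measurableTypeR R)) : measurable A ->
  pushforward mu (fun t : measurableTypeR R => t - s : measurableTypeR R) A = mu A.
Proof.
move=> mA; have ms := measurable_shift s.
pose nu := [the measure _ _ of pushforward mu (fun t : measurableTypeR R => t - s : measurableTypeR R)].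
apply/esym; apply: (@lebesgue_measure_unique R (nu ms)) => //= _ [[a b]] _ <-.
rewrite /pushforward (_ : _ @^-1` _ = `]a + s, b + s]%classic); last first.
  by apply/seteqP; split => x /=; rewrite !in_itv/= ltrBrDr lerBlDr.
by rewrite !lebesgue_measure_itv/= !lte_fin ltrD2r -!EFinD opprD addrACA subrr addr0.
Qed.

Lemma ge0_integral_shift (s : R) (f : R -> \bar R) : measurable_fun setT f ->
  (forall x, 0 <= f x)%E -> (\int[mu]_t f (t - s)%R = \int[mu]_t f t)%E.
Proof.
move=> mf f0.
have := ge0_integral_pushforward (measurable_shift s) mu measurableT mf (fun x _ => f0 x).
rewrite preimage_setT => <-.
apply: eq_measure_integral => [|mf2 A mA _]; [exact: measurable_shift|exact: lebesgue_measure_shift].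
Qed.

Lemma integral_shift (s : R) (f : R -> \bar R) : mu.-integrable setT f ->
  (\int[mu]_t f (t - s)%R = \int[mu]_t f t)%E.
Proof.
move=> fi; have mf := measurable_int _ fi.
rewrite [LHS]integralE [RHS]integralE; congr (_ - _)%E.
  have h := ge0_integral_shift s (measurable_funepos mf) (fun x => funepos_ge0 f x).
  by rewrite -h; apply: eq_integral => x _; rewrite !funeposE.
have h := ge0_integral_shift s (measurable_funeneg mf) (fun x => funeneg_ge0 f x).
by rewrite -h; apply: eq_integral => x _; rewrite !funenegE.
Qed.

Variables p q : R -> R.
Hypothesis ip : mu.-integrable setT (EFin \o p).
Hypothesis iq : mu.-integrable setT (EFin \o q).

Definition conv_kernel (z : R * R) : \bar R := (p (z.1 - z.2) * q z.2)%:E.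

Lemma measurable_conv_kernel : measurable_fun setT conv_kernel.
Proof.
apply/measurable_EFinP; apply: measurable_funM.
  apply: measurableT_comp; last by apply: measurable_funB; [exact: measurable_fst|exact: measurable_snd].
  by apply/measurable_EFinP; exact: measurable_int ip.
apply: measurableT_comp; last exact: measurable_snd.
by apply/measurable_EFinP; exact: measurable_int iq.
Qed.

(** Tonelli with the integral over the first variable inside: a translation turns it into the
    integral of [|p|], and a multiple of [|q|] remains. *)
Lemma integrable_conv_kernel : (mu \x mu)%E.-integrable setT conv_kernel.
Proof.
apply/integrable21ltyP; first exact: measurable_conv_kernel.
have /integrableP[mp lp] := ip; have /integrableP[mq lq] := iq.
rewrite (_ : (fun y => _) = (fun y => `|(q y)%:E| * \int[mu]_t `|(p t)%:E|)%E); last first.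
  apply/funext => s.
  under eq_integral do rewrite /conv_kernel EFinM abseM muleC /fst /snd.
  rewrite ge0_integralZl//.
    congr (_ * _)%E; rewrite -[RHS](ge0_integral_shift s)//.
    exact: measurableT_comp.
  apply: measurableT_comp => //; apply/measurable_EFinP.
  apply: (measurableT_comp (f := p)); first exact/measurable_EFinP.
  exact: measurable_shift.
rewrite ge0_integralZr//.
- by apply: lte_mul_pinfty => //; rewrite ?integral_ge0// ge0_fin_numE ?integral_ge0.
- exact: measurableT_comp.
- exact: integral_ge0.
Qed.

Lemma integral_conv_kernel :
  (\int[mu \x mu]_z conv_kernel z = (\int[mu]_t (p t)%:E) * (\int[mu]_s (q s)%:E))%E.
Proof.
rewrite -integral21_prod_meas1; last exact: integrable_conv_kernel.
have fp := integrable_fin_num measurableT ip.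
rewrite /fubini_G (_ : (fun y => _) = (fun y => (q y)%:E * (fine (\int[mu]_t (p t)%:E))%:E)%E); last first.
  apply/funext => s; rewrite fineK//.
  under eq_integral do rewrite /conv_kernel EFinM muleC /fst /snd.
  rewrite integralZl//; first by rewrite (integral_shift s ip).
  apply/integrableP; split.
    apply/measurable_EFinP; apply: (measurableT_comp (f := p)); last exact: measurable_shift.
    by apply/measurable_EFinP; exact: measurable_int ip.
  rewrite (ge0_integral_shift s (f := fun t => `|(p t)%:E|)%E)//.
    by have /integrableP[] := ip.
  by apply: measurableT_comp => //; exact: measurable_int ip.
by rewrite integralZr// fineK// muleC.
Qed.

End convolution.

Section laplace_convolution.
Variable R : realType.
Notation mu := (@lebesgue_measure R).

(** Two products are treated together because the real and the imaginary part of a product of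
    complex transforms are each a sum of two real products. *)
Lemma integral_conv_sum (p1 q1 p2 q2 F : R -> R) :
  mu.-integrable setT (EFin \o p1) -> mu.-integrable setT (EFin \o q1) ->
  mu.-integrable setT (EFin \o p2) -> mu.-integrable setT (EFin \o q2) ->
  (forall t, (\int[mu]_s (p1 (t - s) * q1 s + p2 (t - s) * q2 s)%R%:E = (F t)%:E)%E) ->
  \int[mu]_t F t = (\int[mu]_t p1 t) * (\int[mu]_t q1 t) + (\int[mu]_t p2 t) * (\int[mu]_t q2 t).
Proof.
move=> ip1 iq1 ip2 iq2 HF.
have i1 := integrable_conv_kernel ip1 iq1.
have i2 := integrable_conv_kernel ip2 iq2.
have i12 : (mu \x mu)%E.-integrable setT (conv_kernel p1 q1 \+ conv_kernel p2 q2)%E.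
  exact: integrableD.
have := integral12_prod_meas1 i12.
rewrite /fubini_F (_ : (fun x => _) = (fun t => (F t)%:E)); last first.
  by apply/funext => t; rewrite -HF; apply: eq_integral => s _; rewrite /conv_kernel EFinD.
rewrite /Rintegral => ->.
rewrite integralD// !integral_conv_kernel//.
have f1 := integrable_fin_num measurableT ip1.
have f2 := integrable_fin_num measurableT iq1.
have f3 := integrable_fin_num measurableT ip2.
have f4 := integrable_fin_num measurableT iq2.
by rewrite fineD ?fin_numM// !fineM.
Qed.

Lemma integrable_patch d (X : measurableType d) (nu : {measure set X -> \bar R})
    (D : set X) (f : X -> R) : measurable D ->
  nu.-integrable D (EFin \o f) -> nu.-integrable setT (EFin \o (f \_ D)).
Proof.
by move=> mD h; have := (integrable_mkcond (EFin \o f) mD).1 h; rewrite restrict_EFin.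
Qed.

Definition halfline_kernel (K : R -> R) (l : R[i]) (t : R) : R[i] :=
  cexp (- l * t%:C) * (K t)%:C.

Lemma laplace_integrable (K : R -> R) (l : R[i]) :
  {within [set t : R | 0 <= t], continuous K} -> laplace_abs_cv K l ->
  cintegrable mu [set t : R | 0 <= t] (halfline_kernel K l).
Proof.
move=> cK absK.
have mD : measurable ([set t : R | 0 <= t] : set (measurableTypeR R)).
  rewrite (_ : [set t : R | 0 <= t] = `[0, +oo[%classic) //.
  by apply/seteqP; split => x /=; rewrite in_itv/= andbT.
have mK : measurable_fun [set t : R | 0 <= t] K by exact: subspace_continuous_measurable_fun.
have mker (F : R[i] -> R) : (forall z w, F (z * w%:C) = F z * w) ->
    continuous (fun t : R => F (cexp (- l * t%:C))) ->
    measurable_fun [set t : R | 0 <= t] (fun t => F (halfline_kernel K l t)).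
  move=> FM cF; rewrite (_ : (fun t => _) = (fun t => F (cexp (- l * t%:C)) * K t)); last first.
    by apply/funext => t; exact: FM.
  apply: measurable_funM => //; apply: measurable_funTS.
  exact: continuous_measurable_fun.
have FRe (z : R[i]) (w : R) : complex.Re (z * w%:C) = complex.Re z * w.
  by rewrite cReM/= mulr0 subr0.
have FIm (z : R[i]) (w : R) : complex.Im (z * w%:C) = complex.Im z * w.
  by rewrite cImM/= mulr0 add0r.
have dom (F : R[i] -> R) : measurable_fun [set t : R | 0 <= t] (fun t => F (halfline_kernel K l t)) ->
    (forall z, `|F z| <= cmod z) ->
    mu.-integrable [set t : R | 0 <= t] (EFin \o (fun t => F (halfline_kernel K l t))).
  move=> mF Fle; apply/integrableP; split; first exact/measurable_EFinP.
  apply: le_lt_trans absK; apply: ge0_le_integral => //.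
  - by apply: measurableT_comp => //; exact/measurable_EFinP.
  - apply/measurable_EFinP.
    apply: (measurableT_comp (f := @Num.sqrt R)).
      by apply: continuous_measurable_fun; exact: sqrt_continuous.
    apply: measurable_funD; apply: measurable_funX.
      apply: (mker (@complex.Re R)) => // t; have [h _] := cderive1_cexp (- l) t.
      by have /@ex_derive /derivable1_diffP := h; exact: differentiable_continuous.
    apply: (mker (@complex.Im R)) => // t; have [_ h] := cderive1_cexp (- l) t.
    by have /@ex_derive /derivable1_diffP := h; exact: differentiable_continuous.
  - by move=> t _; rewrite lee_fin; exact: Fle.
split; apply: dom.
- apply: mker => // t; have [h _] := cderive1_cexp (- l) t.
  by have /@ex_derive /derivable1_diffP := h; exact: differentiable_continuous.
- by move=> z; case: z => x y; exact: (le_Re_normc (x +i* y)).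
- apply: mker => // t; have [_ h] := cderive1_cexp (- l) t.
  by have /@ex_derive /derivable1_diffP := h; exact: differentiable_continuous.
- by move=> z; case: z => x y; exact: (le_Im_normc (x +i* y)).
Qed.

End laplace_convolution.

Section laplace_identities.
Variable R : realType.
Notation mu := (@lebesgue_measure R).

Lemma measurable_halfline : measurable ([set t : R | 0 <= t] : set (measurableTypeR R)).
Proof.
rewrite (_ : [set t : R | 0 <= t] = `[0, +oo[%classic) //.
by apply/seteqP; split => x /=; rewrite in_itv/= andbT.
Qed.

Lemma patchE_if (A : set R) (f : R -> R) (b : bool) t : (A t <-> b) ->
  (f \_ A) t = if b then f t else 0.
Proof.
move=> [h1 h2]; rewrite patchE; case: ifPn => [/set_mem/h1 ->//|/negP nt].
by case: b h1 h2 => // h1 h2; case: nt; apply/mem_set/h2.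
Qed.

Lemma within_subset (A B : set R) (f : R -> R) : B `<=` A ->
  {within A, continuous f} -> {within B, continuous f}.
Proof. by move=> BA; apply: continuous_subspaceW. Qed.

Lemma within_contC (A B : set R) (f g : R -> R) :
  (forall x, A x -> B (g x)) -> {within A, continuous g} ->
  {within B, continuous f} -> {within A, continuous (fun x => f (g x))}.
Proof.
move=> AB /subspace_continuousP cg /subspace_continuousP cf.
apply/subspace_continuousP => x Ax U HU.
have h : within A (nbhs x) (fun s => B (g s) -> U (f (g s))).
  exact: cg x Ax _ (cf _ (AB _ Ax) _ HU).
have hA : within A (nbhs x) A by exact: withinT.
by apply: filterS2 h hA => s h1 h2; exact: h1 (AB s h2).
Qed.

(** Fubini applied to [exp (- l t) K (t - s) g s], extended by zero. The support of the factors does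
    not make the convolution vanish past [T]; that [c] does so is a hypothesis, and it reduces the
    transform of [c] to a finite one. *)
Lemma laplace_convolution (K g c : R -> R) (T : R) (l : R[i]) : 0 < T ->
  {within [set t : R | 0 <= t], continuous K} ->
  {within [set t : R | 0 <= t], continuous g} ->
  {within `[0, T], continuous c} ->
  (forall s, T <= s -> g s = 0) -> laplace_abs_cv K l ->
  (forall t, 0 < t -> c t = \int[mu]_(s in `[0, t]) (K (t - s) * g s)) ->
  (forall t, T < t -> c t = 0) ->
  finite_laplace T c l = laplace K l * finite_laplace T g l.
Proof.
move=> T0 cK cg cc g0 absK cE c0.
have [iP1 iP2] := laplace_integrable cK absK.
have mD := measurable_halfline.
pose D := [set t : R | 0 <= t].
pose P t := halfline_kernel K l t; pose Q t := halfline_kernel g l t.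
pose p1 := (fun t => complex.Re (P t)) \_ D; pose p2 := (fun t => complex.Im (P t)) \_ D.
(* The null point 0 is left out, so that for [t <= 0] the product [p (t - s) * q s] vanishes for
   every [s]; the formula for [c] is only given for [t > 0]. *)
pose q1 := (fun t => complex.Re (Q t)) \_ `]0, T]; pose q2 := (fun t => complex.Im (Q t)) \_ `]0, T].
have ip1 : mu.-integrable setT (EFin \o p1) by exact: integrable_patch.
have ip2 : mu.-integrable setT (EFin \o p2) by exact: integrable_patch.
have cgT : {within `[0, T], continuous g}.
  by apply: within_subset cg => x /=; rewrite in_itv/= => /andP[].
have [iQ1 iQ2] := ccont_integrable (ccont_kernel l cgT).
have sub : (`]0, T] `<=` `[0, T])%classic by apply: subset_itvr; rewrite bnd_simp.
have iQ1' : mu.-integrable `]0, T] (EFin \o (fun t => complex.Re (Q t))).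
  by apply: integrableS iQ1.
have iQ2' : mu.-integrable `]0, T] (EFin \o (fun t => complex.Im (Q t))).
  by apply: integrableS iQ2.
have iq1 : mu.-integrable setT (EFin \o q1) by exact: integrable_patch.
have iq2 : mu.-integrable setT (EFin \o q2) by exact: integrable_patch.
have iNq2 : mu.-integrable setT (EFin \o (fun s => - q2 s)).
  have := integrable_mulr measurableT (-1) iq2; apply: eq_integrable => // s _ /=.
  by rewrite mulN1r.
have Ip1 : \int[mu]_t p1 t = complex.Re (laplace K l).
  by rewrite /p1 -Rintegral_mkcond.
have Ip2 : \int[mu]_t p2 t = complex.Im (laplace K l).
  by rewrite /p2 -Rintegral_mkcond.
have Iq1 : \int[mu]_t q1 t = complex.Re (finite_laplace T g l).
  rewrite /q1 -Rintegral_mkcond Rintegral_itv_obnd_cbnd//.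
have Iq2 : \int[mu]_t q2 t = complex.Im (finite_laplace T g l).
  rewrite /q2 -Rintegral_mkcond Rintegral_itv_obnd_cbnd//.
pose C t := cexp (- l * t%:C) * (c t)%:C.
have [iC1 iC2] := ccont_integrable (ccont_kernel l cc).
have IC1 : complex.Re (finite_laplace T c l) = \int[mu]_t ((fun t => complex.Re (C t)) \_ `]0, T]) t.
  rewrite -Rintegral_mkcond Rintegral_itv_obnd_cbnd//.
  by apply: integrableS iC1.
have IC2 : complex.Im (finite_laplace T c l) = \int[mu]_t ((fun t => complex.Im (C t)) \_ `]0, T]) t.
  rewrite -Rintegral_mkcond Rintegral_itv_obnd_cbnd//.
  by apply: integrableS iC2.
have PQ t s : s <= t -> 0 < s -> P (t - s) * Q s = cexp (- l * t%:C) * (K (t - s) * g s)%:C.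
  move=> st s0; rewrite /P /Q /halfline_kernel mulrACA -cexpD rmorphM/=; congr (cexp _ * _).
  by rewrite rmorphB/=; ring.
(* One computation of the inner integral for both components: [F] is the real or the imaginary part,
   of which only linearity in a real factor is used. *)
have key (F : R[i] -> R) (f : R -> R -> R) :
    (forall z (w : R), F (z * w%:C) = F z * w) ->
    (forall t s, s <= t -> 0 < s -> s <= T -> f t s = F (P (t - s) * Q s)) ->
    (forall t s, ~~ [&& s <= t, 0 < s & s <= T] -> f t s = 0) ->
    forall t, (\int[mu]_s (f t s)%:E = (((fun t => F (C t)) \_ `]0, T]) t)%:E)%E.
  move=> FM f1 f0 t.
  have [t0|t0] := leP t 0.
    rewrite (@patchE_if _ _ false) ?integral0_eq//; last first.
      by rewrite /= in_itv/= (le_gtF t0).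
    move=> s _; rewrite f0//; apply/negP => /and3P[st s0 _].
    by have := lt_le_trans s0 (le_trans st t0); rewrite ltxx.
  have fE s : f t s = ((fun s => F (cexp (- l * t%:C)) * (K (t - s) * g s)) \_ `]0, t]) s.
    rewrite (@patchE_if _ _ ((0 < s) && (s <= t))); last by rewrite /= in_itv/=.
    case: ifPn => [/andP[s0 st]|nst]; last first.
      by rewrite f0//; apply: contra nst => /and3P[-> -> _].
    have [sT|Ts] := leP s T; first by rewrite f1// PQ// FM.
    rewrite f0; first by rewrite g0 ?mulr0// ltW.
    by rewrite st s0/= -ltNge.
  under eq_integral do rewrite fE.
  have cKg : {within `[0, t], continuous (fun s => K (t - s) * g s)}.
    apply: within_contM; last by apply: within_subset cg => x /=; rewrite in_itv/= => /andP[].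
    have cts : {within `[0, t], continuous (fun s : R => t - s)}.
      apply: continuous_subspaceT => x; apply: continuousB; [exact: cvg_cst|exact: cvg_id].
    apply: (@within_contC `[0, t]%classic D) => //.
    by move=> x /=; rewrite in_itv/= => /andP[_ xt]; rewrite /D/= subr_ge0.
  have iKg := continuous_itv_integrable cKg.
  rewrite (_ : (fun s => _) = ((EFin \o (fun s => F (cexp (- l * t%:C)) * (K (t - s) * g s))) \_ `]0, t])); last first.
    by rewrite restrict_EFin.
  rewrite -integral_mkcond integral_itv_obnd_cbnd; last first.
    have := integrable_mulr _ (F (cexp (- l * t%:C))) iKg => /(_ (measurable_itv _)) h.
    by apply: measurable_funS (measurable_int _ h) => //; apply: subset_itvr; rewrite bnd_simp.
  under eq_integral do rewrite /= EFinM.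
  rewrite integralZl//.
  have -> : (\int[mu]_(s in [set` `[0%R, t]%R]) (K (t - s) * g s)%R%:E = (c t)%:E)%E.
    by rewrite cE//; symmetry; apply: fineK; exact: (integrable_fin_num _ iKg).
  (* For [t > T] the inner integral is a multiple of [c t], which is zero by hypothesis. *)
  have [tT|Tt] := leP t T.
    rewrite (@patchE_if _ _ true); last by rewrite /= in_itv/= t0 tT.
    by rewrite /C FM EFinM.
  rewrite c0// mule0 (@patchE_if _ _ false)//.
  by rewrite /= in_itv/= t0/= leNgt Tt.
have zero (t s : R) : ~~ [&& s <= t, 0 < s & s <= T] ->
    (p1 (t - s) = 0 /\ p2 (t - s) = 0) \/ (q1 s = 0 /\ q2 s = 0).
  rewrite negb_and => /orP[st|nsT].
    left; rewrite /p1 /p2; split; rewrite (@patchE_if _ _ false)//;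
    by rewrite /D/= subr_ge0; split => //; move/negP: st.
  right; rewrite /q1 /q2; split; rewrite (@patchE_if _ _ false)//;
  by rewrite /= in_itv/=; split => //; move/negP: nsT.
have nz (t s : R) : s <= t -> 0 < s -> s <= T ->
    [/\ p1 (t - s) = complex.Re (P (t - s)), p2 (t - s) = complex.Im (P (t - s)),
        q1 s = complex.Re (Q s) & q2 s = complex.Im (Q s)].
  move=> st s0 sT; rewrite /p1 /p2 /q1 /q2; split; rewrite (@patchE_if _ _ true)//;
  by rewrite /D/= ?subr_ge0 ?in_itv/= ?s0 ?sT.
apply: eq_complexP.
  rewrite IC1 cReM -Ip1 -Ip2 -Iq1 -Iq2.
  have -> : (\int[mu]_t p2 t) * (\int[mu]_t q2 t) = - ((\int[mu]_t p2 t) * (\int[mu]_t - q2 t)).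
    rewrite -mulrN; congr (_ * _).
    have E : \int[mu]_t (-1 * q2 t) = -1 * \int[mu]_t q2 t by rewrite RintegralZl.
    rewrite (_ : (fun t => - q2 t) = (fun t => -1 * q2 t)).
      by rewrite E mulN1r opprK.
    by apply/funext => t; rewrite mulN1r.
  rewrite opprK; apply: integral_conv_sum => //.
  apply: (key (@complex.Re R) (fun t s => p1 (t - s) * q1 s + p2 (t - s) * - q2 s)).
  - by move=> z w; rewrite cReM/= mulr0 subr0.
  - by move=> t s st s0 sT; have [-> -> -> ->] := nz t s st s0 sT; rewrite cReM mulrN.
  - by move=> t s /zero[[-> ->]|[-> ->]]; rewrite ?mul0r ?oppr0 ?mulr0 addr0.
rewrite IC2 cImM -Ip1 -Ip2 -Iq1 -Iq2.
apply: integral_conv_sum => //.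
apply: (key (@complex.Im R) (fun t s => p1 (t - s) * q2 s + p2 (t - s) * q1 s)).
- by move=> z w; rewrite cImM/= mulr0 add0r.
- by move=> t s st s0 sT; have [-> -> -> ->] := nz t s st s0 sT; rewrite cImM.
- by move=> t s /zero[[-> ->]|[-> ->]]; rewrite ?mul0r ?mulr0 addr0.
Qed.

End laplace_identities.

Section laplace_derivative.
Variable R : realType.
Notation mu := (@lebesgue_measure R).

Lemma LRcontinuous_within (f : R -> R) (a b : R) : a < b ->
  {within `[a, b], continuous f} -> (forall x, a < x < b -> derivable f x 1) ->
  derivable_oo_LRcontinuous f a b.
Proof.
move=> ab cf df; have [_ ca cb] := (continuous_within_itvP _ ab).1 cf.
by split => // x; rewrite in_itv/=; exact: df.
Qed.

Lemma ReZ (z : R[i]) (w : R) : complex.Re (z * w%:C) = complex.Re z * w.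
Proof. by rewrite cReM/= mulr0 subr0. Qed.

Lemma ImZ (z : R[i]) (w : R) : complex.Im (z * w%:C) = complex.Im z * w.
Proof. by rewrite cImM/= mulr0 add0r. Qed.

Lemma ReN (z : R[i]) : complex.Re (- z) = - complex.Re z.
Proof. by case: z. Qed.

Lemma ImN (z : R[i]) : complex.Im (- z) = - complex.Im z.
Proof. by case: z. Qed.

(** Integration by parts against each component of [exp (- l t)]; [h T = 0] removes the boundary
    term at [T], and the one at 0 is the initial value. *)
Lemma laplace_derivative (h h1 : R -> R) (T : R) (l : R[i]) : 0 < T ->
  {within `[0, T], continuous h} -> {within `[0, T], continuous h1} ->
  (forall t : R, 0 < t < T -> is_derive t 1 h (h1 t)) -> h T = 0 ->
  l * finite_laplace T h l - (h 0)%:C = finite_laplace T h1 l.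
Proof.
move=> T0 ch ch1 dh hT.
have LRh : derivable_oo_LRcontinuous h 0 T.
  by apply: LRcontinuous_within => // x /dh hx; exact: ex_derive.
have dhE : {in `]0, T[%R, h^`()%classic =1 h1}.
  by move=> x; rewrite in_itv/= => /dh hx; rewrite derive1E derive_val.
have key (e de : R -> R) : (forall t : R, is_derive t 1 e (de t)) ->
    {within `[0, T], continuous de} ->
    \int[mu]_(t in `[0, T]) (e t * h1 t) = - (e 0 * h 0) - \int[mu]_(t in `[0, T]) (de t * h t).
  move=> ede cde.
  have ce : {within `[0, T], continuous e}.
    by apply: derivable_within_continuous => x _; have he := ede x; exact: ex_derive.
  rewrite (@Rintegration_by_parts R e h de h1 0 T)//.
  - by rewrite hT mulr0 sub0r.
  - by apply: LRcontinuous_within => // x _; have he := ede x; exact: ex_derive.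
  - by move=> x _; have he := ede x; rewrite derive1E derive_val.
have c0 : cexp (- l * 0%:C) = 1 by rewrite mulr0 cexp0.
have [cE1 cE2] : ccont (fun t => - l * cexp (- l * t%:C)) 0 T.
  by apply: ccontM; [exact: ccont_cst|exact: ccont_cexp].
have d1 t := (cderive1_cexp (- l) t).1; have d2 t := (cderive1_cexp (- l) t).2.
have k1 := key _ _ d1 cE1; have k2 := key _ _ d2 cE2.
rewrite c0 /= mul1r in k1; rewrite c0 /= mul0r oppr0 sub0r in k2.
rewrite /finite_laplace -cintegralZ//; last exact/ccont_integrable/ccont_kernel.
have [iR iI] : cintegrable mu `[0, T] (fun t => l * (cexp (- l * t%:C) * (h t)%:C)).
  by apply: cintegrableZ => //; exact/ccont_integrable/ccont_kernel.
apply: eq_complexP => /=.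
  have -> : \int[mu]_(x in `[0, T]) complex.Re (cexp (- l * x%:C) * (h1 x)%:C) =
      \int[mu]_(t in `[0, T]) (complex.Re (cexp (- l * t%:C)) * h1 t).
    by apply: eq_Rintegral => x _; rewrite ReZ.
  rewrite k1 addrC; congr (_ + _); apply: oppr_inj; rewrite opprK -[LHS]mulN1r -RintegralZl//.
  apply: eq_Rintegral => t _; rewrite mulN1r [- l * cexp _]mulNr mulrA ReZ ReN; ring.
have -> : \int[mu]_(x in `[0, T]) complex.Im (cexp (- l * x%:C) * (h1 x)%:C) =
    \int[mu]_(t in `[0, T]) (complex.Im (cexp (- l * t%:C)) * h1 t).
  by apply: eq_Rintegral => x _; rewrite ImZ.
rewrite k2 oppr0 addr0; apply: oppr_inj; rewrite opprK -[LHS]mulN1r -RintegralZl//.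
apply: eq_Rintegral => t _; rewrite mulN1r [- l * cexp _]mulNr mulrA ImZ ImN; ring.
Qed.

End laplace_derivative.

(** * Square integrable functions on the plane *)

Section square_integrable.
Context d (T : measurableType d) (R : realType).
Variables (mu : {measure set T -> \bar R}) (D : set T).
Hypothesis mD : measurable D.
Implicit Types f g : T -> R.

Definition sq_integrable f :=
  measurable_fun D f /\ mu.-integrable D (EFin \o (fun x => f x ^+ 2)).

Definition sq_norm f := Num.sqrt (\int[mu]_(x in D) (f x ^+ 2)).

Lemma integrable_le (f g : T -> R) : measurable_fun D f ->
  mu.-integrable D (EFin \o g) -> (forall x, D x -> `|f x| <= g x) ->
  mu.-integrable D (EFin \o f).
Proof.
move=> mf ig fg; apply: le_integrable ig => //; first exact/measurable_EFinP.
by move=> x Dx /=; rewrite lee_fin; apply: le_trans (fg x Dx) _; exact: ler_norm.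
Qed.

Lemma sq_integrableM f g : sq_integrable f -> sq_integrable g ->
  mu.-integrable D (EFin \o (fun x => f x * g x)).
Proof.
move=> [mf if2] [mg ig2].
apply: (integrable_le _ (integrable_addr mD if2 ig2)); first exact: measurable_funM.
move=> x _; rewrite ler_norml; have := sqr_ge0 (f x + g x); have := sqr_ge0 (f x - g x).
have := sqr_ge0 (f x); have := sqr_ge0 (g x).
by move=> h1 h2 h3 h4; apply/andP; split; lra.
Qed.

Lemma sq_integrableD f g : sq_integrable f -> sq_integrable g ->
  sq_integrable (fun x => f x + g x).
Proof.
move=> hf hg; have ifg := sq_integrableM hf hg.
move: hf hg => [mf if2] [mg ig2]; split; first exact: measurable_funD.
rewrite (_ : (fun x => _) = (fun x => (f x ^+ 2 + 2 * (f x * g x)) + g x ^+ 2)).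
  by apply: integrable_addr => //; apply: integrable_addr => //; exact: integrable_mulr.
by apply/funext => x; ring.
Qed.

Lemma sq_integrableZ (c : R) f : sq_integrable f -> sq_integrable (fun x => c * f x).
Proof.
move=> [mf if2]; split; first by apply: measurable_funM => //; exact: measurable_cst.
rewrite (_ : (fun x => _) = (fun x => c ^+ 2 * (f x ^+ 2))).
  exact: integrable_mulr.
by apply/funext => x; ring.
Qed.

Lemma sq_integrableB f g : sq_integrable f -> sq_integrable g ->
  sq_integrable (fun x => f x - g x).
Proof.
move=> hf hg; have := sq_integrableD hf (sq_integrableZ (-1) hg).
by under eq_fun do rewrite mulN1r.
Qed.

Lemma sq_integral_ge0 f : 0 <= \int[mu]_(x in D) (f x ^+ 2).
Proof. by apply: Rintegral_ge0 => x _; exact: sqr_ge0. Qed.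

Lemma cauchy_schwarz f g : sq_integrable f -> sq_integrable g ->
  `|\int[mu]_(x in D) (f x * g x)| <= sq_norm f * sq_norm g.
Proof.
move=> hf hg; have ifg := sq_integrableM hf hg.
have [mf if2] := hf; have [mg ig2] := hg.
set A := \int[mu]_(x in D) (f x ^+ 2); set B := \int[mu]_(x in D) (g x ^+ 2).
set C := \int[mu]_(x in D) (f x * g x).
have A0 : 0 <= A by exact: sq_integral_ge0.
have B0 : 0 <= B by exact: sq_integral_ge0.
have Q s : 0 <= A - 2 * s * C + s ^+ 2 * B.
  have := sq_integral_ge0 (fun x => f x - s * g x).
  rewrite (_ : (fun x => _) = (fun x => f x ^+ 2 - (2 * s) * (f x * g x) + s ^+ 2 * (g x ^+ 2))); last first.
    by apply/funext => x; ring.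
  rewrite RintegralD//; [|by apply: integrable_subr => //; exact: integrable_mulr|exact: integrable_mulr].
  rewrite RintegralB//; [|exact: integrable_mulr].
  by rewrite !RintegralZl.
rewrite /sq_norm -/A -/B -sqrtrM// -sqrtr_sqr ler_wsqrtr//.
have [B00|B00] := eqVneq B 0.
  rewrite B00 mulr0; have [->|C0] := eqVneq C 0; first by rewrite expr0n.
  (* When [B = 0] the expression is affine in [s], and at this [s] it takes the value -1. *)
  have := Q ((A + 1) / (2 * C)); rewrite B00 mulr0 addr0.
  rewrite (_ : 2 * _ * C = A + 1); last by field.
  by move=> h; exfalso; lra.
have Bp : 0 < B by rewrite lt_neqAle eq_sym B00.
have := Q (C / B); rewrite (_ : A - _ + _ = A - C ^+ 2 / B); last by field.
by rewrite subr_ge0 ler_pdivrMr.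
Qed.

End square_integrable.

Section plane.
Variable R : realType.
Notation mR := (measurableTypeR R).
Notation mu2 := (leb2 R).

Definition rational_square (i : rat * rat * nat) : set (R * R) :=
  [set p | (`|p.1 - ratr i.1.1| < i.2.+1%:R^-1) && (`|p.2 - ratr i.1.2| < i.2.+1%:R^-1)].

(** Covering an open set by open squares whose closed versions lie inside it leaves room for
    compactly supported cutoffs; the lemma of du Bois-Reymond relies on this. *)
Definition rational_closed_square (i : rat * rat * nat) : set (R * R) :=
  [set p | (`|p.1 - ratr i.1.1| <= i.2.+1%:R^-1) && (`|p.2 - ratr i.1.2| <= i.2.+1%:R^-1)].

Lemma ball_planeP (p q : R * R) (e : R) :
  ball p e q <-> `|p.1 - q.1| < e /\ `|p.2 - q.2| < e.
Proof.
by rewrite -[ball p e q]/(ball p.1 e q.1 /\ ball p.2 e q.2) -!ball_normE.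
Qed.

Lemma open_bigcup_rational_square (A : set (R * R)) : open A ->
  A = \bigcup_(i in [set i | rational_closed_square i `<=` A]) rational_square i.
Proof.
move=> oA; apply/seteqP; split=> [p Ap|p [i iA] /andP[h1 h2]]; last first.
  by apply: iA; rewrite /rational_closed_square/= !ltW.
have /nbhs_ballP[e /= e0 He] : nbhs p A by exact: open_nbhs_nbhs.
have [n Hn] : exists n : nat, 2 * n.+1%:R^-1 < e.
  exists (Num.bound (2 / e)); rewrite ltr_pdivrMr// mulrC -ltr_pdivrMr//.
  apply: (@lt_le_trans _ _ (Num.bound (2 / e))%:R); last by rewrite ler_nat.
  by apply: archi_boundP; rewrite divr_ge0// ltW.
have n0 : 0 < (n.+1%:R : R)^-1 by rewrite invr_gt0.
have near (x : R) : exists q : rat, `|x - ratr q| < n.+1%:R^-1.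
  have [|q] := @rat_in_itvoo R x (x + n.+1%:R^-1); first by rewrite ltrDl.
  rewrite in_itv/=; move: n0; set r := n.+1%:R^-1 => n0 /andP[h1 h2].
  by exists q; rewrite distrC ltr_norml; apply/andP; split; lra.
have [q1 h1] := near p.1; have [q2 h2] := near p.2.
exists (q1, q2, n); last by rewrite /rational_square/= h1 h2.
move=> q /andP[/= k1 k2]; apply: He; apply/ball_planeP.
move: Hn n0 h1 h2 k1 k2; set r := n.+1%:R^-1 => Hn n0 h1 h2 k1 k2.
rewrite !ltr_norml in h1 h2 *; rewrite !ler_norml in k1 k2.
move: h1 h2 k1 k2 => /andP[? ?] /andP[? ?] /andP[? ?] /andP[? ?].
by split; apply/andP; split; lra.
Qed.

Lemma measurable_rect (a b c d : R) (s1 s2 s3 s4 : bool) :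
  measurable ([set` Interval (BSide s1 a) (BSide s2 b)] `*`
    [set` Interval (BSide s3 c) (BSide s4 d)] : set (mR * mR)).
Proof. by apply: measurableX; exact: measurable_itv. Qed.

Lemma rational_squareE i : rational_square i =
  `]ratr i.1.1 - i.2.+1%:R^-1, ratr i.1.1 + i.2.+1%:R^-1[%classic `*`
  `]ratr i.1.2 - i.2.+1%:R^-1, ratr i.1.2 + i.2.+1%:R^-1[%classic.
Proof.
by apply/seteqP; split=> -[x y] /=; rewrite /rational_square/= !in_itv/= !ltr_distl => /andP.
Qed.

Lemma open_measurable_plane (A : set (R * R)) : open A ->
  measurable (A : set (mR * mR)).
Proof.
move=> /open_bigcup_rational_square ->; rewrite bigcup_mkcond.
apply: countable_bigcupT_measurable => [|i]; first exact: countableP.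
by case: ifP => _ //; rewrite rational_squareE; exact: measurable_rect.
Qed.

Lemma continuous_measurable_plane (f : R * R -> R) : continuous f ->
  measurable_fun [set: mR * mR] (f : mR * mR -> mR).
Proof.
move=> /continuousP cf; apply: (measurability _ (RGenOpens.measurableE R)).
move=> _ [_ [a [b ->] <-]]; rewrite setTI; apply: open_measurable_plane.
exact/cf/interval_open.
Qed.

Lemma measure_rect (a b c d : R) : a <= b -> c <= d ->
  mu2 (`[a, b]%classic `*` `[c, d]%classic) = ((b - a) * (d - c))%:E.
Proof.
move=> ab cd; transitivity (lebesgue_measure `[a, b]%classic * lebesgue_measure `[c, d]%classic)%E.
  by apply: product_measure1E; exact: measurable_itv.
rewrite !lebesgue_measure_itv/= !lte_fin.
have E (x y : R) : x <= y -> (if (x < y)%R then (y%:E - x%:E)%E else 0%E) = (y - x)%:E.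
  by rewrite le_eqVlt => /predU1P[->|->//]; rewrite ltxx subrr.
by rewrite !E// EFinM.
Qed.

Lemma bounded_measure (Omega : set (R * R)) : bounded_set Omega ->
  measurable (Omega : set (mR * mR)) -> (mu2 Omega < +oo)%E.
Proof.
move=> [M [Mr HM]] mO; pose N := `|M| + 1.
have N0 : 0 <= N by rewrite addr_ge0.
have sub : Omega `<=` `[- N, N]%classic `*` `[- N, N]%classic.
  have MN : M < N by rewrite /N (le_lt_trans (ler_norm M))// ltrDl.
  move=> p Op; have := HM N MN p Op; rewrite /= prod_normE.
  by rewrite ge_max !ler_norml => /andP[h1 h2]; split; rewrite /= in_itv/=.
apply: (@le_lt_trans _ _ (mu2 (`[- N, N]%classic `*` `[- N, N]%classic))).
  by apply: le_measure; rewrite ?inE//; exact: measurable_rect.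
by rewrite measure_rect ?ltry//; lra.
Qed.

End plane.

(** * Smooth functions and the lemma of du Bois-Reymond *)

Section smooth_class.
Variable R : realType.

Lemma is_derive_quadratic (f : R -> R) (C : R) :
  f 0 = 0 -> (forall h, `|f h| <= C * h ^+ 2) -> is_derive (0 : R) 1 f 0.
Proof.
move=> f0 H.
have cv : h^-1 *: ((f \o shift 0) (h *: (1 : R)) - f 0) @[h --> (0 : R)^'] --> (0 : R).
  apply/cvgrPdist_lt => e e0.
  have C1 : 0 < `|C| + 1 by rewrite ltr_pwDr.
  near=> h.
  have h0 : h != 0 by near: h; exact: nbhs_dnbhs_neq.
  rewrite sub0r normrN /= [h *: 1]mulr1 addr0 f0 subr0 normrZ normfV.
  have nh : 0 < `|h| by rewrite normr_gt0.
  rewrite mulrC ltr_pdivrMr//; apply: le_lt_trans (H h) _.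
  apply: (@le_lt_trans _ _ ((`|C| + 1) * `|h| ^+ 2)).
    rewrite -normrX [`|h ^+ 2|]ger0_norm ?sqr_ge0// ler_wpM2r ?sqr_ge0//.
    by rewrite (le_trans (ler_norm C))// lerDl.
  rewrite expr2 mulrA ltr_pM2r// mulrC -ltr_pdivlMr//.
  near: h; apply: dnbhs0_lt; exact: divr_gt0.
by apply: DeriveDef; [apply/cvg_ex; exists 0|exact: cvg_lim].
Unshelve. all: by end_near. Qed.

(* [flat 0] is the standard flat function [exp (-1/x)]; the family is closed
   under derivatives up to linear combinations. *)
Definition flat (n : nat) (x : R) : R :=
  if 0 < x then x^-1 ^+ n * expR (- x^-1) else 0.

(** From [y ^ (n + 2) / (n + 2)! <= exp y] at [y = 1 / x]. The quadratic bound is what yields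
    derivative zero at the origin. *)
Lemma flat_le n (x : R) : `|flat n x| <= (n.+2)`!%:R * x ^+ 2.
Proof.
rewrite /flat; case: ltP => [x0|_]; last by rewrite normr0 mulr_ge0 ?sqr_ge0.
have y0 : 0 < x^-1 by rewrite invr_gt0.
rewrite ger0_norm ?mulr_ge0 ?expR_ge0 ?exprn_ge0 ?(ltW y0)//.
rewrite expRN ler_pdivrMr ?expR_gt0//.
have := @expR_ge1Dxn R x^-1 n.+1 (ltW y0) => h.
have h1 : x^-1 ^+ n.+2 / (n.+2)`!%:R <= expR x^-1 by apply: le_trans h; rewrite lerDr.
rewrite ler_pdivrMr ?ltr0n ?fact_gt0// in h1.
have x2 : 0 < x ^+ 2 by rewrite exprn_gt0.
have E : x^-1 ^+ n = x ^+ 2 * x^-1 ^+ n.+2 by rewrite !exprS expr0; field; rewrite gt_eqF.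
have -> : (n.+2)`!%:R * x ^+ 2 * expR x^-1 = x ^+ 2 * (expR x^-1 * (n.+2)`!%:R) by ring.
by rewrite E ler_pM2l.
Qed.

Lemma flat_derive n (x : R) :
  is_derive x 1 (flat n) (- n%:R * flat n.+1 x + flat n.+2 x).
Proof.
have [x0|x0|->] := ltgtP x 0.
- have -> : - n%:R * flat n.+1 x + flat n.+2 x = 0.
    by rewrite /flat ltNge (ltW x0)/= mulr0 addr0.
  have h0 : is_derive x 1 (fun _ : R => 0 : R) 0 by exact: is_derive_cst.
  apply: near_eq_is_derive h0.
  near=> y; rewrite /flat ltNge (_ : y <= 0)//.
  by apply: ltW; near: y; exact: lt_nbhsl.
- pose g (y : R) := y^-1 ^+ n * expR (- y^-1).
  suff hg : is_derive x 1 g (- n%:R * flat n.+1 x + flat n.+2 x).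
    apply: near_eq_is_derive hg.
    near=> y; rewrite /flat (_ : 0 < y)//.
    by near: y; exact: lt_nbhsr.
  have xn0 : x != 0 by rewrite gt_eqF.
  have hV : is_derive x 1 (fun y : R => y^-1) (- x ^- 2).
    have h := @is_deriveV R id x 1 1 xn0 (is_derive_id x 1).
    by apply: (is_derive_eq h); rewrite /GRing.scale/= mulr1.
  have hX := @is_deriveX R _ (fun y : R => y^-1) n x 1 _ hV.
  have hN := is_deriveN hV.
  have hE := @is_derive1_comp R expR _ x _ _ (is_derive_expR _) hN.
  have hM := is_deriveM hX hE.
  rewrite (_ : g = (fun y : R => y^-1) ^+ n * (expR \o - (fun y : R => y^-1))); last first.
    by apply/funext => y; rewrite /g fctE exprfctE.
  apply: (is_derive_eq hM).
  rewrite /flat x0 exprfctE /GRing.scale/= opprfctE/= opprK !exprS.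
  case: n {g hX hM} => [|n]; first by rewrite !expr0 !mul0r; field.
  by rewrite /= exprS; field.
- have -> : - n%:R * flat n.+1 0 + flat n.+2 0 = 0.
    by rewrite /flat ltxx mulr0 addr0.
  by apply: is_derive_quadratic; [rewrite /flat ltxx|exact: flat_le].
Unshelve. all: by end_near. Qed.

Lemma flat_continuous n : continuous (flat n).
Proof.
move=> x; have h := flat_derive n x.
by have /@ex_derive /derivable1_diffP := h; exact: differentiable_continuous.
Qed.

Lemma flat_ge0 n x : 0 <= flat n x.
Proof.
rewrite /flat; case: ltP => // x0.
by rewrite mulr_ge0 ?expR_ge0 ?exprn_ge0// invr_ge0 ltW.
Qed.

Lemma flat0_le1 x : flat 0 x <= 1.
Proof.
rewrite /flat; case: ltP => // x0; rewrite expr0 mul1r -expR0 ler_expR.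
by rewrite oppr_le0 invr_ge0 ltW.
Qed.

Lemma flat_gt0 n x : 0 < x -> 0 < flat n x.
Proof. by move=> x0; rewrite /flat x0 mulr_gt0 ?expR_gt0 ?exprn_gt0 ?invr_gt0. Qed.

Lemma flat_eq0 n x : x <= 0 -> flat n x = 0.
Proof. by move=> x0; rewrite /flat ltNge x0. Qed.

(** The algebra generated by the functions [flat n] of an affine function of one coordinate. Being
    closed under partial derivatives, it reduces smoothness of all orders to a single
    differentiation and to continuity. *)
Inductive flat_class : (R * R -> R) -> Prop :=
| flat_class_x n a b : flat_class (fun q => flat n (a + b * q.1))
| flat_class_y n a b : flat_class (fun q => flat n (a + b * q.2))
| flat_class_cst c : flat_class (fun=> c)
| flat_class_add f g : flat_class f -> flat_class g -> flat_class (fun q => f q + g q)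
| flat_class_mul f g : flat_class f -> flat_class g -> flat_class (fun q => f q * g q).

Lemma is_derive_line (f : R * R -> R) (q v : R * R) (d : R) :
  is_derive (0 : R) 1 (fun h : R => f (h *: v + q)) d -> is_derive q v f d.
Proof.
move=> H; have D : derivable f q v by apply/derivable1P; exact: ex_derive.
apply: DeriveDef => //; have <- := @derive_val _ _ _ _ _ _ _ H.
rewrite /derive (_ : (fun h : R => h^-1 *: (((fun h0 : R => f (h0 *: v + q)) \o shift 0) (h *: 1) -
   f (0 *: v + q))) = (fun h : R => h^-1 *: ((f \o shift q) (h *: v) - f q)))//.
by apply/funext => h /=; rewrite scale0r add0r addr0 [h *: 1]mulr1.
Qed.

Lemma is_derive_affine (f : R -> R) (df a b x s t : R) :
  is_derive (a + b * x) 1 f df ->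
  is_derive (0 : R) 1 (fun h : R => f (a + b * (s * h + x))) (b * s * df).
Proof.
move=> H.
have hg : is_derive (0 : R) 1 (fun h : R => (a + b * x) + (b * s) * h) (b * s).
  have h1 := is_deriveZ (b * s) (is_derive_id (0 : R) (1 : R)).
  have h2 := is_deriveD (is_derive_cst (a + b * x) (0 : R) (1 : R)) h1.
  by apply: (is_derive_eq h2); rewrite add0r [_ *: _]mulr1.
have H0 : is_derive ((a + b * x) + (b * s) * 0) 1 f df by rewrite mulr0 addr0.
have h := @is_derive1_comp R f _ 0 _ _ H0 hg.
rewrite (_ : (fun h : R => _) = f \o (fun h : R => (a + b * x) + (b * s) * h)); last first.
  by apply/funext => u /=; congr f; ring.
by apply: (is_derive_eq h); ring.
Qed.

Lemma flat_class_derive f (i : bool) : flat_class f ->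
  exists2 g, flat_class g & forall q, is_derive q (axis R i) f (g q).
Proof.
have dflat n a b (x : R) (s : R) :
    is_derive (0 : R) 1 (fun h : R => flat n (a + b * (s * h + x)))
      (b * s * (- n%:R * flat n.+1 (a + b * x) + flat n.+2 (a + b * x))).
  by apply: is_derive_affine => //; exact: flat_derive.
elim => [n a b|n a b|c|{}f g _ [df cf hf] _ [dg cg hg]|{}f g cf0 [df cf hf] cg0 [dg cg hg]].
- exists (fun q => (if i then 0 else b) * ((- n%:R) * flat n.+1 (a + b * q.1) + flat n.+2 (a + b * q.1))).
    apply: flat_class_mul; first exact: flat_class_cst.
    apply: flat_class_add; last exact: flat_class_x.
    by apply: flat_class_mul; [exact: flat_class_cst|exact: flat_class_x].
  move=> [x y]; refine (is_derive_line _).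
  have := dflat n a b x (if i then 0 else 1).
  have -> : b * (if i then 0 else 1) = (if i then 0 else b) by case: i; rewrite ?mulr0 ?mulr1.
  congr is_derive; apply/funext => h; congr (flat _ (_ + _ * (_ + _))).
  by case: i => /=; rewrite ?mul0r ?mul1r// [h *: _]mulrC ?mul0r ?mul1r.
- exists (fun q => (if i then b else 0) * ((- n%:R) * flat n.+1 (a + b * q.2) + flat n.+2 (a + b * q.2))).
    apply: flat_class_mul; first exact: flat_class_cst.
    apply: flat_class_add; last exact: flat_class_y.
    by apply: flat_class_mul; [exact: flat_class_cst|exact: flat_class_y].
  move=> [x y]; refine (is_derive_line _).
  have := dflat n a b y (if i then 1 else 0).
  have -> : b * (if i then 1 else 0) = (if i then b else 0) by case: i; rewrite ?mulr0 ?mulr1.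
  congr is_derive; apply/funext => h; congr (flat _ (_ + _ * (_ + _))).
  by case: i => /=; rewrite ?mul0r ?mul1r// [h *: _]mulrC ?mul0r ?mul1r.
- by exists (fun=> 0); [exact: flat_class_cst|move=> q; exact: is_derive_cst].
- exists (fun q => df q + dg q); first exact: flat_class_add.
  by move=> q; have h := is_deriveD (hf q) (hg q); exact: h.
- exists (fun q => f q * dg q + g q * df q).
    by apply: flat_class_add; exact: flat_class_mul.
  by move=> q; have h := is_deriveM (hf q) (hg q); exact: h.
Qed.

Lemma flat_class_continuous f : flat_class f -> continuous f.
Proof.
have aff n (a b : R) (pr : R * R -> R) : continuous pr -> continuous (fun q => flat n (a + b * pr q)).
  move=> cpr q.
  have h1 : {for q, continuous (fun q => a + b * pr q)}.
    have hm : {for q, continuous (fun q => b * pr q)}.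
      by have hm := continuousM (cvg_cst b : {for q, continuous (fun _ : R * R => b)}) (cpr q); exact: hm.
    by have h := continuousD (cvg_cst a : {for q, continuous (fun _ : R * R => a)}) hm; exact: h.
  exact: (continuous_comp h1 (flat_continuous (n := n) (x := _))).
elim => [n a b|n a b|c|{}f g _ cf _ cg|{}f g _ cf _ cg].
- by apply: aff => q; exact: cvg_fst.
- by apply: aff => q; exact: cvg_snd.
- by move=> q; exact: cvg_cst.
- by move=> q; have h := continuousD (cf q) (cg q); exact: h.
- by move=> q; have h := continuousM (cf q) (cg q); exact: h.
Qed.

Lemma flat_class_iter_partial f w : flat_class f -> flat_class (iter_partial f w).
Proof.
move=> cf; elim: w => [//|i w IH] /=.
have [g cg hg] := flat_class_derive i IH.
rewrite (_ : (fun p => _) = g)//; apply/funext => p.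
by have h := hg p; exact: derive_val.
Qed.

Lemma flat_class_smooth f : flat_class f -> smooth f.
Proof.
move=> cf w; have cw := flat_class_iter_partial w cf; split.
  exact: flat_class_continuous.
move=> i p; have [g cg hg] := flat_class_derive i cw; have h := hg p.
exact: ex_derive.
Qed.

Implicit Types f g : R * R -> R.

Lemma smooth_continuous f : smooth f -> continuous f.
Proof. by move=> /(_ [::])[]. Qed.

Lemma smooth_derivable f i p : smooth f -> derivable f p (axis R i).
Proof. by move=> /(_ [::])[_]; apply. Qed.

Lemma smooth_partial f i : smooth f -> smooth ('D_(axis R i) f).
Proof.
move=> sf w; have := sf (rcons w i).
by rewrite -cats1 /iter_partial foldr_cat.
Qed.

Lemma iter_partialD f g w : smooth f -> smooth g ->
  iter_partial (fun p => f p + g p) w = (fun p => iter_partial f w p + iter_partial g w p).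
Proof.
move=> sf sg; elim: w => [//|i w IH]; rewrite /= IH; apply/funext => p.
by have h := deriveD ((sf w).2 i p) ((sg w).2 i p); exact: h.
Qed.

Lemma smoothD f g : smooth f -> smooth g -> smooth (fun p => f p + g p).
Proof.
move=> sf sg w; rewrite iter_partialD//; have [cf df] := sf w; have [cg dg] := sg w.
split; first by move=> p; have h := continuousD (cf p) (cg p); exact: h.
by move=> i p; have h := derivableD (df i p) (dg i p); exact: h.
Qed.

Lemma iter_partialZ (c : R) f w : smooth f ->
  iter_partial (fun p => c * f p) w = (fun p => c * iter_partial f w p).
Proof.
move=> sf; elim: w => [//|i w IH]; rewrite /= IH; apply/funext => p.
by have h := deriveZ c ((sf w).2 i p); exact: h.
Qed.

Lemma smoothZ (c : R) f : smooth f -> smooth (fun p => c * f p).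
Proof.
move=> sf w; rewrite iter_partialZ//; have [cf df] := sf w.
split.
  by move=> p; have h := continuousM (cvg_cst c : {for p, continuous (fun _ : R * R => c)}) (cf p); exact: h.
by move=> i p; have h := derivableM (derivable_cst c p (axis R i)) (df i p); exact: h.
Qed.

Lemma smooth_cst (c : R) : smooth (fun=> c).
Proof. exact/flat_class_smooth/flat_class_cst. Qed.

Lemma smooth_sum (I : Type) (s : seq I) (f : I -> R * R -> R) :
  (forall i, smooth (f i)) -> smooth (fun p => \sum_(i <- s) f i p).
Proof.
move=> sf; elim: s => [|i s IH].
  by under eq_fun do rewrite big_nil; exact: smooth_cst.
by under eq_fun do rewrite big_cons; exact: smoothD.
Qed.

End smooth_class.

Section vanishing_integrals.
Context d (T : measurableType d) (R : realType).
Variables (mu : {measure set T -> \bar R}) (D : set T) (f : T -> R).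
Hypotheses (mD : measurable D) (fi : mu.-integrable D (EFin \o f)).

Lemma measurable_of_integrable : measurable_fun D f.
Proof. by apply/measurable_EFinP; exact: measurable_int fi. Qed.

Lemma integrable_mul_bounded (chi : T -> R) : measurable_fun D chi ->
  (forall x, D x -> `|chi x| <= 1) -> mu.-integrable D (EFin \o (fun x => f x * chi x)).
Proof.
move=> mc c1; have mf := measurable_of_integrable.
apply: (integrable_le mD _ (integrable_norm fi)); first exact: measurable_funM.
by move=> x Dx /=; rewrite normrM ler_piMr// c1.
Qed.

(** Dominated convergence with majorant [|f|]. It serves twice: for cutoffs tending to the indicator
    of a rectangle, and for increasing unions in the lambda-system argument. *)
Lemma integral_vanish_limit (chi_ : nat -> T -> R) (chi : T -> R) :
  (forall n, measurable_fun D (chi_ n)) -> measurable_fun D chi ->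
  (forall n x, D x -> `|chi_ n x| <= 1) ->
  (forall x, D x -> chi_ ^~ x @ \oo --> chi x) ->
  (forall n, \int[mu]_(x in D) (f x * chi_ n x) = 0) ->
  \int[mu]_(x in D) (f x * chi x) = 0.
Proof.
move=> mn mc cn1 cvg_chi H; have mf := measurable_of_integrable.
have [|||||] := @dominated_convergence _ _ _ mu D mD (fun n x => (f x * chi_ n x)%:E)
   (fun x => (f x * chi x)%:E) (fun x => `|(f x)%:E|%E).
- by move=> n; apply/measurable_EFinP; exact: measurable_funM.
- by apply/measurable_EFinP; exact: measurable_funM.
- apply: aeW => x Dx; apply: cvg_EFin; first by apply: nearW.
  have h := cvgM (cvg_cst (f x) : (fun _ : nat => f x) @ \oo --> f x) (cvg_chi x Dx); exact: h.
- exact: integrable_abse.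
- by apply: aeW => x n Dx /=; rewrite lee_fin normrM ler_piMr// cn1.
move=> ifc _; rewrite (_ : [sequence _]_n = (fun=> 0%E)); last first.
  apply/funext => n /=; have h := integrable_mul_bounded (mn n) (cn1 n).
  by rewrite -[LHS]fineK; [congr EFin; exact: H|exact: (integrable_fin_num mD h)].
move=> h; have h2 : (fun _ : nat => 0%E : \bar R) @ \oo --> (0%E : \bar R) by exact: cvg_cst.
by rewrite /Rintegral; rewrite (cvg_unique _ h h2).
Qed.

End vanishing_integrals.

Section du_bois_reymond.
Variable R : realType.
Notation mR := (measurableTypeR R).
Notation mu2 := (leb2 R).
Implicit Types (f g eta : R * R -> R) (Omega : set (R * R)).

(** Complex test functions are reduced to real ones by splitting into parts, in
    [weak_partial_of_parts]. *)
Definition test_real Omega eta := smooth eta /\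
  exists D : set (R * R), [/\ compact D, D `<=` Omega & forall p, ~ D p -> eta p = 0].

(** The factors [1] and [-1] are written out to match the constructors of [flat_class]. *)
Definition rect_bump (a b c d : R) (q : R * R) : R :=
  flat 0 (- a + 1 * q.1) * flat 0 (b + (- 1) * q.1) *
  (flat 0 (- c + 1 * q.2) * flat 0 (d + (- 1) * q.2)).

Lemma rect_bump_class a b c d : flat_class (rect_bump a b c d).
Proof.
by apply: flat_class_mul; apply: flat_class_mul;
  [exact: flat_class_x|exact: flat_class_x|exact: flat_class_y|exact: flat_class_y].
Qed.

Lemma rect_bump_01 a b c d q : 0 <= rect_bump a b c d q <= 1.
Proof.
apply/andP; split; first by rewrite !mulr_ge0// flat_ge0.
by rewrite !mulr_ile1 ?mulr_ge0 ?flat_ge0 ?flat0_le1.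
Qed.

Lemma rect_bump_gt0 a b c d q : a < q.1 < b -> c < q.2 < d -> 0 < rect_bump a b c d q.
Proof.
move=> /andP[? ?] /andP[? ?].
by rewrite /rect_bump !mulr_gt0// flat_gt0//; lra.
Qed.

Lemma rect_bump_eq0 a b c d q : ~~ ((a < q.1 < b) && (c < q.2 < d)) ->
  rect_bump a b c d q = 0.
Proof.
rewrite !negb_and -!leNgt /rect_bump => /orP[/orP[]|/orP[]] h.
- by rewrite [flat 0 (- a + _)]flat_eq0 ?mul0r//; lra.
- by rewrite [flat 0 (b + _)]flat_eq0 ?(mul0r, mulr0)//; lra.
- by rewrite [flat 0 (- c + _)]flat_eq0 ?(mul0r, mulr0)//; lra.
- by rewrite [flat 0 (d + _)]flat_eq0 ?(mul0r, mulr0)//; lra.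
Qed.

(* Tends to the indicator function of the open rectangle as [n] grows. *)
Definition rect_cutoff (a b c d : R) (n : nat) (q : R * R) : R :=
  1 + (-1) * (1 + (-1) * rect_bump a b c d q) ^+ n.

Lemma rect_cutoff_class a b c d n : flat_class (rect_cutoff a b c d n).
Proof.
apply: flat_class_add; first exact: flat_class_cst.
apply: flat_class_mul; first exact: flat_class_cst.
elim: n => [|n IH]; first exact: (flat_class_cst 1).
rewrite (_ : (fun q => _) = (fun q => (1 + (-1) * rect_bump a b c d q) * (1 + (-1) * rect_bump a b c d q) ^+ n)).
  apply: flat_class_mul IH; apply: flat_class_add; first exact: flat_class_cst.
  by apply: flat_class_mul; [exact: flat_class_cst|exact: rect_bump_class].
by apply/funext => q; rewrite exprS.
Qed.

Definition open_rect (a b c d : R) : set (R * R) :=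
  [set q | (a < q.1 < b) && (c < q.2 < d)].

Definition closed_rect (a b c d : R) : set (R * R) :=
  [set q | (a <= q.1 <= b) && (c <= q.2 <= d)].

Lemma closed_rectE a b c d : closed_rect a b c d = `[a, b]%classic `*` `[c, d]%classic.
Proof. by apply/seteqP; split => -[x y]; rewrite /closed_rect/= !in_itv/= => /andP. Qed.

Lemma open_rectE a b c d : open_rect a b c d = `]a, b[%classic `*` `]c, d[%classic.
Proof. by apply/seteqP; split => -[x y]; rewrite /open_rect/= !in_itv/= => /andP. Qed.

Lemma compact_closed_rect a b c d : compact (closed_rect a b c d).
Proof. by rewrite closed_rectE; apply: compact_setX; exact: segment_compact. Qed.

Lemma measurable_open_rect a b c d : measurable (open_rect a b c d : set (mR * mR)).
Proof. by rewrite open_rectE; exact: measurable_rect. Qed.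

Lemma measurable_closed_rect a b c d : measurable (closed_rect a b c d : set (mR * mR)).
Proof. by rewrite closed_rectE; exact: measurable_rect. Qed.

Lemma rect_cutoff_test Omega a b c d n : closed_rect a b c d `<=` Omega ->
  test_real Omega (rect_cutoff a b c d n).
Proof.
move=> sub; split; first exact/flat_class_smooth/rect_cutoff_class.
exists (closed_rect a b c d); split => //; first exact: compact_closed_rect.
move=> p np; rewrite /rect_cutoff rect_bump_eq0; first by rewrite mulr0 addr0 expr1n mulr1 subrr.
apply/negP => /andP[/andP[? ?]/andP[? ?]]; apply: np.
by rewrite /closed_rect/= !ltW.
Qed.

Lemma rect_cutoff_le1 a b c d n q : `|rect_cutoff a b c d n q| <= 1.
Proof.
have /andP[h1 h2] := rect_bump_01 a b c d q.
rewrite /rect_cutoff !mulN1r; set x := 1 - rect_bump _ _ _ _ _.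
have x0 : 0 <= x by rewrite subr_ge0.
have x1 : x <= 1 by rewrite gerBl.
have xn0 : 0 <= x ^+ n by rewrite exprn_ge0.
have xn1 : x ^+ n <= 1 by rewrite exprn_ile1.
by rewrite ler_norml; apply/andP; split; lra.
Qed.

Lemma rect_cutoff_cvg a b c d q :
  rect_cutoff a b c d ^~ q @ \oo --> (\1_(open_rect a b c d) q : R).
Proof.
have [qO|qO] := boolP ((a < q.1 < b) && (c < q.2 < d)); last first.
  rewrite indicE memNset; last by apply/negP.
  rewrite (_ : rect_cutoff _ _ _ _ ^~ _ = fun=> 0); first exact: cvg_cst.
  by apply/funext => n; rewrite /rect_cutoff rect_bump_eq0// mulr0 addr0 expr1n mulr1 subrr.
rewrite indicE mem_set//.
have /andP[h1 h2] := qO; have b0 := rect_bump_gt0 h1 h2.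
have /andP[_ b1] := rect_bump_01 a b c d q.
have cx : (1 + -1 * rect_bump a b c d q) ^+ n @[n --> \oo] --> 0.
  by apply: cvg_expr; rewrite mulN1r ger0_norm ?subr_ge0// gtrBl.
have h : (fun n : nat => 1 - (1 + -1 * rect_bump a b c d q) ^+ n) @ \oo --> (1 - 0 : R).
  by apply: cvgB => //; exact: cvg_cst.
rewrite subr0 in h; move: h; rewrite (_ : (fun n => _) = rect_cutoff a b c d ^~ q)//.
by apply/funext => n; rewrite /rect_cutoff [in RHS]mulN1r.
Qed.

Lemma integral_open_rect_eq0 Omega f a b c d : measurable (Omega : set (mR * mR)) ->
  mu2.-integrable Omega (EFin \o f) ->
  (forall eta, test_real Omega eta -> \int[mu2]_(p in Omega) (f p * eta p) = 0) ->
  closed_rect a b c d `<=` Omega ->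
  \int[mu2]_(p in Omega) (f p * \1_(open_rect a b c d) p) = 0.
Proof.
move=> mO fi H sub.
apply: (@integral_vanish_limit _ _ _ mu2 Omega f mO fi (rect_cutoff a b c d)).
- move=> n; apply: measurable_funTS; apply: continuous_measurable_plane.
  exact/flat_class_continuous/rect_cutoff_class.
- by apply: measurable_indic; exact: measurable_open_rect.
- by move=> n x _; exact: rect_cutoff_le1.
- by move=> x _; exact: rect_cutoff_cvg.
- by move=> n; apply: H; exact: rect_cutoff_test.
Qed.

Definition open_rects : set (set (R * R)) :=
  [set A | exists a b c d, A = open_rect a b c d].

Lemma open_rects_setI : setI_closed open_rects.
Proof.
move=> _ _ [a [b [c [d ->]]]] [a' [b' [c' [d' ->]]]].
exists (Num.max a a'), (Num.min b b'), (Num.max c c'), (Num.min d d').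
apply/seteqP; split => p; rewrite /open_rect/= !gt_max !lt_min.
  by move=> [/andP[/andP[-> ->] /andP[-> ->]] /andP[/andP[-> ->] /andP[-> ->]]].
by move=> /andP[/andP[/andP[-> ->] /andP[-> ->]] /andP[/andP[-> ->] /andP[-> ->]]].
Qed.

(** Both projections are measurable for the sigma-algebra generated by the rectangles: the preimage
    of an interval is a countable union of rectangles whose other side grows. *)
Lemma measurable_plane_generated (A : set (mR * mR)) : measurable A ->
  <<s open_rects >> (A : set (R * R)).
Proof.
have cover (x : R) : exists n : nat, - n%:R < x < n%:R.
  by exists (Num.bound `|x|); rewrite -ltr_norml archi_boundP.
pose S := g_sigma_algebraType open_rects.
have mrects a b c d : measurable (open_rect a b c d : set S).
  by apply: sub_sigma_algebra; exists a, b, c, d.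
have mfst : measurable_fun [set: S] (fst : S -> mR).
  apply: (measurability _ (RGenOpens.measurableE R)).
  move=> _ [_ [a [b ->] <-]]; rewrite setTI.
  rewrite (_ : _ @^-1` _ = \bigcup_n (open_rect a b (- n%:R) n%:R)).
    by apply: bigcupT_measurable => n; exact: mrects.
  apply/seteqP; split => [p|p [n _]]; rewrite /open_rect/= in_itv/=.
    by move=> h; have [n hn] := cover p.2; exists n => //=; rewrite h hn.
  by move=> /andP[].
have msnd : measurable_fun [set: S] (snd : S -> mR).
  apply: (measurability _ (RGenOpens.measurableE R)).
  move=> _ [_ [a [b ->] <-]]; rewrite setTI.
  rewrite (_ : _ @^-1` _ = \bigcup_n (open_rect (- n%:R) n%:R a b)).
    by apply: bigcupT_measurable => n; exact: mrects.
  apply/seteqP; split => [p|p [n _]]; rewrite /open_rect/= in_itv/=.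
    by move=> h; have [n hn] := cover p.1; exists n => //=; rewrite h hn.
  by move=> /andP[].
rewrite measurable_prod_measurableType; apply: smallest_sub.
  exact: (smallest_sigma_algebra setT open_rects).
move=> _ [B mB [C mC <-]].
have h1 := mfst measurableT B mB; have h2 := msnd measurableT C mC.
have h := measurableI _ _ h1 h2.
by move: h; rewrite !setTI; congr (measurable _); apply/seteqP; split.
Qed.

Lemma Rintegral_indic_subset (S Omega : set (R * R)) f : S `<=` Omega ->
  \int[mu2]_(p in S) f p = \int[mu2]_(p in Omega) (f p * \1_S p).
Proof.
move=> SO; rewrite Rintegral_mkcond [RHS]Rintegral_mkcond.
apply: eq_Rintegral => p _; rewrite !patchE indicE.
have [pS|pS] := boolP (p \in S).
  by rewrite (_ : p \in Omega) ?mulr1//; apply/mem_set/SO/set_mem.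
by rewrite mulr0 if_same.
Qed.

Lemma open_closed_rect a b c d : open_rect a b c d `<=` closed_rect a b c d.
Proof. by move=> p /andP[/andP[? ?] /andP[? ?]]; rewrite /closed_rect/= !ltW. Qed.

(** The sets over whose trace on [S] the integral of [f] vanishes form a lambda-system containing
    the open rectangles, which are stable under intersection; so it vanishes over every Borel subset
    of [S], and [f] is zero almost everywhere there. *)
Lemma vanish_on_rect Omega f a b c d : measurable (Omega : set (mR * mR)) ->
  mu2.-integrable Omega (EFin \o f) ->
  (forall eta, test_real Omega eta -> \int[mu2]_(p in Omega) (f p * eta p) = 0) ->
  closed_rect a b c d `<=` Omega ->
  {ae mu2, forall p, open_rect a b c d p -> f p = 0}.
Proof.
move=> mO fi H sub; pose S := open_rect a b c d.
have mS : measurable (S : set (mR * mR)) by exact: measurable_open_rect.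
have SO : S `<=` Omega by apply: subset_trans sub; exact: open_closed_rect.
have fiS : mu2.-integrable S (EFin \o f) by apply: integrableS fi.
have bi (E : set (R * R)) : measurable (E : set (mR * mR)) ->
    mu2.-integrable S (EFin \o (fun p => f p * \1_E p)).
  move=> mE; apply: (integrable_mul_bounded mS fiS); first exact: measurable_indic.
  by move=> p _; rewrite indicE; case: (_ \in _); rewrite ?normr1 ?normr0.
pose Hs := [set E : set (R * R) | measurable (E : set (mR * mR)) /\
  \int[mu2]_(p in S) (f p * \1_E p) = 0].
have HsG : <<s open_rects >> `<=` Hs.
  apply: lambda_system_subset; [exact: open_rects_setI| | |by []].
  - split => //.
    + split; first exact: measurableT.
      rewrite -[RHS](integral_open_rect_eq0 mO fi H sub) -/S -(@Rintegral_indic_subset S Omega f SO).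
      by apply: eq_Rintegral => p _; rewrite indicE in_setT mulr1.
    + move=> B A AB [mB IB] [mA IA]; split; first exact: measurableD.
      rewrite -[RHS](subr0 0) -{1}IB -IA -RintegralB//; [|exact: bi|exact: bi].
      apply: eq_Rintegral => p _; rewrite -mulrBr; congr (_ * _).
      rewrite !indicE in_setD.
      have [pA|pA] := boolP (p \in A); last by rewrite /= subr0 andbT.
      by rewrite (_ : p \in B) ?subrr//; apply/mem_set/AB/set_mem.
    + move=> F ndF HF; split; first by apply: bigcupT_measurable => n; have [] := HF n.
      apply: (@integral_vanish_limit _ _ _ mu2 S f mS fiS (fun n p => \1_(F n) p)).
      * by move=> n; apply: measurable_indic; have [] := HF n.
      * by apply: measurable_indic; apply: bigcupT_measurable => n; have [] := HF n.
      * by move=> n p _; rewrite indicE; case: (_ \in _); rewrite ?normr1 ?normr0.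
      * move=> p _; have [[n _ pn]|np] := pselect ((\bigcup_n F n) p).
          rewrite indicE mem_set; last by exists n.
          apply: cvg_near_cst; exists n => // m /= nm; apply/eqP.
          by rewrite indicE mem_set//; have /subsetPset := ndF _ _ nm; apply.
        rewrite indicE memNset//; apply: cvg_near_cst; exists 0 => // m _ /=.
        by rewrite indicE memNset// => pm; apply: np; exists m.
      * by move=> n; have [] := HF n.
  (* The intersection with [S] is again an open rectangle, and its closed version still lies in
     [Omega]. *)
  - move=> _ [a' [b' [c' [d' ->]]]]; split; first exact: measurable_open_rect.
    have [a2 [b2 [c2 [d2 E2]]]] := open_rects_setI
      (ex_intro _ a (ex_intro _ b (ex_intro _ c (ex_intro _ d erefl))))
      (ex_intro _ a' (ex_intro _ b' (ex_intro _ c' (ex_intro _ d' erefl)))).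
    pose a3 := Num.max a a'; pose b3 := Num.min b b'; pose c3 := Num.max c c'; pose d3 := Num.min d d'.
    have sub3 : closed_rect a3 b3 c3 d3 `<=` Omega.
      move=> p; rewrite /closed_rect/= !ge_max !le_min => /andP[/andP[/andP[h1 _] /andP[h2 _]] /andP[/andP[h3 _] /andP[h4 _]]].
      by apply: sub; rewrite /closed_rect/= h1 h2 h3 h4.
    rewrite -[RHS](integral_open_rect_eq0 mO fi H sub3).
    rewrite (Rintegral_indic_subset _ SO); apply: eq_Rintegral => p _.
    rewrite -mulrA; congr (_ * _); rewrite !indicE -natrM mulnb; congr (_%:R : R); congr nat_of_bool.
    apply/idP/idP.
      move=> /andP[/set_mem h1 /set_mem h2]; apply/mem_set; move: h1 h2.
      rewrite /S /open_rect/= !gt_max !lt_min.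
      by move=> /andP[/andP[-> ->] /andP[-> ->]] /andP[/andP[-> ->] /andP[-> ->]].
    move=> /set_mem; rewrite /open_rect/= !gt_max !lt_min.
    move=> /andP[/andP[/andP[h1 k1] /andP[h2 k2]] /andP[/andP[h3 k3] /andP[h4 k4]]].
    by apply/andP; split; apply/mem_set; rewrite /S /open_rect/= ?h1 ?h2 ?h3 ?h4 ?k1 ?k2 ?k3 ?k4.
have : ae_eq mu2 S (EFin \o f) (cst 0%E).
  apply: integral_ae_eq => // E ES mE.
  have [_ IE] := HsG _ (measurable_plane_generated mE).
  have iE : mu2.-integrable E (EFin \o f) by apply: integrableS fiS.
  rewrite integral0 -[LHS]fineK; last exact: (integrable_fin_num mE iE).
  by congr EFin; rewrite -[RHS]IE; exact: Rintegral_indic_subset.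
by apply: filterS => p h Sp; have := h Sp => /= -[].
Qed.

Lemma ae_plane_mono (P Q : R * R -> Prop) : (forall p, P p -> Q p) ->
  {ae mu2, forall p, P p} -> {ae mu2, forall p, Q p}.
Proof.
move=> PQ [A [mA A0 sub]]; exists A; split => // p nq; apply: sub => /= h.
by apply: nq; exact: PQ.
Qed.

Theorem du_bois_reymond Omega f : open Omega ->
  mu2.-integrable Omega (EFin \o f) ->
  (forall eta, test_real Omega eta -> \int[mu2]_(p in Omega) (f p * eta p) = 0) ->
  {ae mu2, forall p, Omega p -> f p = 0}.
Proof.
move=> oO fi H; have mO := open_measurable_plane oO.
(* The rational squares are numbered, so that a countable intersection of almost sure events can be
   taken; numbers that encode no square impose nothing. *)
pose P (n : nat) (p : R * R) := if (unpickle n : option (rat * rat * nat)) is Some i then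
  @rational_closed_square R i `<=` Omega -> @rational_square R i p -> f p = 0 else True.
have : {ae mu2, forall p, forall n, P n p}.
  apply: ae_foralln => n; rewrite /P; case: (unpickle n) => [i|]; last exact: aeW.
  have [sub|nsub] := pselect (@rational_closed_square R i `<=` Omega); last exact: aeW.
  pose e : R := i.2.+1%:R^-1.
  have := @vanish_on_rect Omega f (ratr i.1.1 - e) (ratr i.1.1 + e) (ratr i.1.2 - e) (ratr i.1.2 + e) mO fi H.
  have sub' : closed_rect (ratr i.1.1 - e) (ratr i.1.1 + e) (ratr i.1.2 - e) (ratr i.1.2 + e) `<=` Omega.
    move=> p h; apply: sub; move: h.
    by rewrite /closed_rect /rational_closed_square/= !ler_distl.
  move=> /(_ sub'); apply: ae_plane_mono => p h _ hp; apply: h; move: hp.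
  by rewrite /open_rect /rational_square/= !ltr_distl.
apply: ae_plane_mono => p h; rewrite {1}(open_bigcup_rational_square oO) => -[i iO ip].
by have := h (pickle i); rewrite /P pickleK; apply.
Qed.

End du_bois_reymond.

Section plane_calculus.
Variable R : realType.
Notation mR := (measurableTypeR R).
Notation mu := (@lebesgue_measure R).
Notation mu2 := (leb2 R).
Implicit Types (f g eta F : R * R -> R) (Omega : set (R * R)).

Lemma is_derive_slice_x F (x y d : R) : is_derive (x, y) (axis R false) F d ->
  is_derive x 1 (fun t => F (t, y)) d.
Proof.
move=> H.
have E : (fun h : R => h^-1 *: (((fun t => F (t, y)) \o shift x) (h *: 1) - F (x, y))) =
   (fun h : R => h^-1 *: ((F \o shift (x, y)) (h *: axis R false) - F (x, y))).
  apply/funext => h /=; congr (_ *: (F _ - _)).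
  by congr pair; rewrite /= [h *: _]mulr0 add0r.
have D : derivable F (x, y) (axis R false) by exact: ex_derive.
have V := @derive_val _ _ _ _ _ _ _ H.
apply: DeriveDef; first by rewrite /derivable E; exact: D.
by rewrite -V /derive E.
Qed.

Lemma is_derive_slice_y F (x y d : R) : is_derive (x, y) (axis R true) F d ->
  is_derive y 1 (fun t => F (x, t)) d.
Proof.
move=> H.
have E : (fun h : R => h^-1 *: (((fun t => F (x, t)) \o shift y) (h *: 1) - F (x, y))) =
   (fun h : R => h^-1 *: ((F \o shift (x, y)) (h *: axis R true) - F (x, y))).
  apply/funext => h /=; congr (_ *: (F _ - _)).
  by congr pair; rewrite /= [h *: _]mulr0 add0r.
have D : derivable F (x, y) (axis R true) by exact: ex_derive.
have V := @derive_val _ _ _ _ _ _ _ H.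
apply: DeriveDef; first by rewrite /derivable E; exact: D.
by rewrite -V /derive E.
Qed.

Lemma continuous_slice_x F (y : R) : continuous F -> continuous (fun t : R => F (t, y)).
Proof.
move=> cF x; apply: (@continuous_comp _ _ _ (fun t : R => (t, y)) F); last exact: cF.
have h := @cvg_pair _ _ _ (nbhs x) (nbhs x) (nbhs y) _ _ _ (fun t : R => t) (fun=> y)
  (@cvg_id _ _) (@cvg_cst _ _ _ _ _).
exact: h.
Qed.

Lemma continuous_slice_y F (x : R) : continuous F -> continuous (fun t : R => F (x, t)).
Proof.
move=> cF y; apply: (@continuous_comp _ _ _ (fun t : R => (x, t)) F); last exact: cF.
have h := @cvg_pair _ _ _ (nbhs y) (nbhs x) (nbhs y) _ _ _ (fun=> x) (fun t : R => t)
  (@cvg_cst _ _ _ _ _) (@cvg_id _ _).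
exact: h.
Qed.

Lemma integral_slice0 (G G' : R -> R) (N : R) : 0 < N ->
  (forall t : R, is_derive t 1 G (G' t)) -> continuous G' ->
  (forall t : R, N <= `|t| -> G t = 0 /\ G' t = 0) -> (\int[mu]_t (G' t)%:E = 0)%E.
Proof.
move=> N0 dG cG' G0.
have NN : - N < N by lra.
have cG : {within `[- N, N], continuous G}.
  by apply: derivable_within_continuous => x _; have h := dG x; exact: ex_derive.
have := @continuous_FTC2 R G' G (- N) N NN.
rewrite (G0 N _).1 ?(G0 (- N) _).1 ?normrN ?ler_norm// sube0.
have -> : (\int[mu]_(x in `[(- N)%R, N]) (G' x)%:E = \int[mu]_t (G' t)%:E)%E.
  rewrite integral_mkcond; apply: eq_integral => t _; rewrite patchE.
  case: ifPn => // /negP nt; rewrite (G0 t _).2// leNgt; apply/negP => tN; apply: nt.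
  by rewrite inE/= in_itv/= -ler_norml ltW.
move=> -> //.
- exact: continuous_subspaceT.
- by apply: LRcontinuous_within => // x _; have h := dG x; exact: ex_derive.
- by move=> x _; have h := dG x; rewrite derive1E derive_val.
Qed.

Lemma closed_rect_bounded F (a b c d : R) : continuous F ->
  exists M : R, forall p, closed_rect a b c d p -> `|F p| <= M.
Proof.
move=> cF.
have : compact (F @` closed_rect a b c d).
  by apply: continuous_compact; [exact: continuous_subspaceT|exact: compact_closed_rect].
move=> /compact_bounded[M [_ HM]]; exists (M + 1) => p hp.
by apply: (HM (M + 1)); [rewrite ltrDl|exists p].
Qed.

Lemma measure_closed_rect_lty (a b c d : R) : (mu2 (closed_rect a b c d) < +oo)%E.
Proof.
have [ab|ba] := leP a b; last first.
  rewrite (_ : closed_rect _ _ _ _ = set0) ?measure0//.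
  by apply/seteqP; split => // p /andP[/andP[h1 h2] _]; lra.
have [cd|dc] := leP c d; last first.
  rewrite (_ : closed_rect _ _ _ _ = set0) ?measure0//.
  by apply/seteqP; split => // p /andP[_ /andP[h1 h2]]; lra.
by rewrite closed_rectE measure_rect// ltry.
Qed.

Lemma bounded_integrable (D : set (R * R)) f (M : R) : measurable (D : set (mR * mR)) ->
  (mu2 D < +oo)%E -> measurable_fun (D : set (mR * mR)) (f : mR * mR -> mR) ->
  (forall p, D p -> `|f p| <= M) -> mu2.-integrable D (EFin \o f).
Proof.
move=> mD Doo mf fM; apply: measurable_bounded_integrable => //.
exists (M + 1); split; first exact: num_real.
move=> K MK p Dp; have h := fM p Dp.
by apply: (le_trans h); apply: le_trans (ltW MK); rewrite lerDl.
Qed.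

Lemma integrable_compact_support F (a b c d : R) : continuous F ->
  (forall p, ~ closed_rect a b c d p -> F p = 0) -> mu2.-integrable setT (EFin \o F).
Proof.
move=> cF F0; have [M HM] := closed_rect_bounded a b c d cF.
have mD := measurable_closed_rect a b c d.
have h : mu2.-integrable (closed_rect a b c d) (EFin \o F).
  apply: (bounded_integrable mD (measure_closed_rect_lty a b c d) _ HM).
  by apply: measurable_funTS; exact: continuous_measurable_plane.
have := (@integrable_mkcond _ _ R mu2 _ (EFin \o F) mD).1 h.
rewrite (_ : _ \_ _ = EFin \o F)//; apply/funext => p; rewrite patchE.
by case: ifPn => // /negP np; rewrite /= F0// => hp; apply: np; exact/mem_set.
Qed.

(** Fubini with the inner integral in the direction of differentiation, where the fundamental
    theorem of calculus gives zero. *)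
Lemma integral_partial0 (i : bool) F F' (N : R) : 0 < N ->
  (forall p : R * R, is_derive p (axis R i) F (F' p)) -> continuous F' ->
  (forall p, N <= `|p.1| \/ N <= `|p.2| -> F p = 0 /\ F' p = 0) ->
  \int[mu2]_p F' p = 0.
Proof.
move=> N0 dF cF' F0.
have iF' : mu2.-integrable setT (EFin \o F').
  apply: (@integrable_compact_support _ (- N) N (- N) N) => // p np.
  apply: (F0 p _).2; apply: contrapT => /not_orP[/negP h1 /negP h2]; apply: np.
  rewrite -!ltNge !ltr_norml in h1 h2.
  by move: h1 h2 => /andP[? ?] /andP[? ?]; rewrite /closed_rect/= !ltW.
rewrite /Rintegral; case: i dF => dF.
  rewrite -integral12_prod_meas1// /fubini_F integral0_eq// => x _ /=.
  apply: (@integral_slice0 (fun t => F (x, t)) _ N) => //.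
  - by move=> t; exact: is_derive_slice_y.
  - exact: continuous_slice_y.
  - by move=> t Nt; apply: F0; right.
rewrite -integral21_prod_meas1// /fubini_G integral0_eq// => y _ /=.
apply: (@integral_slice0 (fun t => F (t, y)) _ N) => //.
- by move=> t; exact: is_derive_slice_x.
- exact: continuous_slice_x.
- by move=> t Nt; apply: F0; left.
Qed.

Lemma plane_hausdorff : hausdorff_space (R * R)%type.
Proof. exact: norm_hausdorff. Qed.

Lemma zero_off_derive eta (D : set (R * R)) i : compact D ->
  (forall p, ~ D p -> eta p = 0) -> forall p, ~ D p -> 'D_(axis R i) eta p = 0.
Proof.
move=> cD e0 p np.
have oD : open (~` D) by apply: closed_openC; apply: compact_closed => //; exact: plane_hausdorff.
rewrite (@near_eq_derive _ _ _ eta (fun=> 0)); first exact: derive_cst.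
have : nbhs p (~` D) by exact: open_nbhs_nbhs.
by apply: filterS => q nq; exact: e0.
Qed.

Lemma test_real_partial Omega eta i : test_real Omega eta ->
  test_real Omega ('D_(axis R i) eta).
Proof.
move=> [se [D [cD DO e0]]]; split; first exact: smooth_partial.
by exists D; split => //; exact: zero_off_derive.
Qed.

Lemma test_realD Omega eta zeta : test_real Omega eta -> test_real Omega zeta ->
  test_real Omega (fun p => eta p + zeta p).
Proof.
move=> [se [D [cD DO e0]]] [sz [D' [cD' DO' z0]]]; split; first exact: smoothD.
exists (D `|` D'); split; first exact: compactU.
  by move=> p [/DO|/DO'].
by move=> p /not_orP[h1 h2]; rewrite e0// z0// addr0.
Qed.

Lemma compact_in_square (D : set (R * R)) : compact D ->
  exists2 N, 0 < N & forall p, N <= `|p.1| \/ N <= `|p.2| -> ~ D p.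
Proof.
move=> /compact_bounded[M [_ HM]]; exists (`|M| + 2); first by rewrite ltr_wpDl.
move=> p h Dp; have := HM (`|M| + 1); rewrite (le_lt_trans (ler_norm M)) ?ltrDl//.
move=> /(_ erefl p Dp); rewrite /= prod_normE ge_max => /andP[h1 h2].
by case: h => h; lra.
Qed.

(** The compact support of [eta] inside [Omega] lets both integrals be taken over the whole plane,
    where the integral of the partial derivative of [f * eta] vanishes; the shape of [Omega] never
    enters. *)
Lemma integration_by_parts_plane Omega f eta i : measurable (Omega : set (mR * mR)) ->
  smooth f -> test_real Omega eta ->
  \int[mu2]_(p in Omega) (f p * 'D_(axis R i) eta p) =
  - \int[mu2]_(p in Omega) ('D_(axis R i) f p * eta p).
Proof.
move=> mO sf [se [D [cD DO e0]]].
have [N N0 HN] := compact_in_square cD.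
have d0 := zero_off_derive i cD e0.
have cf := smooth_continuous sf; have ce := smooth_continuous se.
have cdf := smooth_continuous (smooth_partial i sf).
have cde := smooth_continuous (smooth_partial i se).
have contM (u v : R * R -> R) : continuous u -> continuous v -> continuous (fun p => u p * v p).
  by move=> cu cv p; have h := continuousM (cu p) (cv p); exact: h.
have ext (u v : R * R -> R) : (forall p, ~ D p -> v p = 0) ->
    \int[mu2]_(p in Omega) (u p * v p) = \int[mu2]_p (u p * v p).
  move=> v0; rewrite Rintegral_mkcond; apply: eq_Rintegral => p _; rewrite patchE.
  by case: ifPn => // /negP np; rewrite v0 ?mulr0// => /DO Op; apply: np; exact/mem_set.
have int (u v : R * R -> R) : continuous u -> continuous v -> (forall p, ~ D p -> v p = 0) ->
    mu2.-integrable setT (EFin \o (fun p => u p * v p)).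
  move=> cu cv v0; apply: (@integrable_compact_support _ (- N) N (- N) N); first exact: contM.
  move=> p np; rewrite v0 ?mulr0//; apply: HN; apply: contrapT => /not_orP[/negP h1 /negP h2]; apply: np.
  rewrite -!ltNge !ltr_norml in h1 h2.
  by move: h1 h2 => /andP[? ?] /andP[? ?]; rewrite /closed_rect/= !ltW.
rewrite !ext//; apply/eqP; rewrite -subr_eq0 opprK; apply/eqP.
rewrite -RintegralD//; [|exact: int|exact: int].
apply: (@integral_partial0 i (fun p => f p * eta p) _ N) => //.
- move=> p.
  have h1 : is_derive p (axis R i) f ('D_(axis R i) f p).
    by apply/derivableP; exact: smooth_derivable.
  have h2 : is_derive p (axis R i) eta ('D_(axis R i) eta p).
    by apply/derivableP; exact: smooth_derivable.
  by have h := is_deriveM h1 h2; apply: (is_derive_eq h); rewrite /GRing.scale/=; ring.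
- by move=> p; have h := continuousD (contM _ _ cf cde p) (contM _ _ cdf ce p); exact: h.
- by move=> p /HN np; rewrite e0// d0// !mulr0 addr0.
Qed.

Lemma test_real_bounded Omega eta : test_real Omega eta -> exists M : R, forall p, `|eta p| <= M.
Proof.
move=> [se [D [cD DO e0]]]; have [N N0 HN] := compact_in_square cD.
have [M HM] := closed_rect_bounded (- N) N (- N) N (smooth_continuous se).
exists (Num.max M 0) => p; rewrite le_max.
have [h|h] := pselect (closed_rect (- N) N (- N) N p); first by rewrite HM.
rewrite e0 ?normr0 ?lexx ?orbT//; apply: HN; apply: contrapT => /not_orP[/negP h1 /negP h2]; apply: h.
rewrite -!ltNge !ltr_norml in h1 h2.
by move: h1 h2 => /andP[? ?] /andP[? ?]; rewrite /closed_rect/= !ltW.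
Qed.

Lemma bounded_sq_integrable (D : set (R * R)) f (M : R) : measurable (D : set (mR * mR)) ->
  (mu2 D < +oo)%E -> measurable_fun (D : set (mR * mR)) (f : mR * mR -> mR) ->
  (forall p, D p -> `|f p| <= M) -> sq_integrable mu2 D f.
Proof.
move=> mD Doo mf fM; split => //.
apply: (@bounded_integrable D _ (M ^+ 2) mD Doo); first exact: measurable_funX.
move=> p Dp; rewrite normrX; apply: lerXn2r; rewrite ?nnegrE//; last exact: fM.
exact: le_trans (fM _ Dp).
Qed.

Lemma test_real_sq_integrable Omega eta : measurable (Omega : set (mR * mR)) ->
  (mu2 Omega < +oo)%E -> test_real Omega eta -> sq_integrable mu2 Omega eta.
Proof.
move=> mO Ooo te; have [M HM] := test_real_bounded te.
apply: (@bounded_sq_integrable _ _ M mO Ooo) => //.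
apply: measurable_funTS; apply: continuous_measurable_plane; exact: smooth_continuous te.1.
Qed.

End plane_calculus.

(** * Weak derivatives *)

Section sobolev.
Variables (R : realType) (Omega : set (R * R)).
Notation mR := (measurableTypeR R).
Notation mu2 := (leb2 R).
Hypotheses (oO : open Omega) (Ooo : (mu2 Omega < +oo)%E).
Implicit Types (f g : planefun R) (eta : R * R -> R).

Let mO : measurable (Omega : set (mR * mR)) := open_measurable_plane oO.

Notation re f := (fun p => complex.Re (f p)).
Notation im f := (fun p => complex.Im (f p)).
Notation sqi := (sq_integrable mu2 Omega).
Notation sqn := (sq_norm mu2 Omega).

(** Only the real part of [f] is paired: [K], the test functions and the datum constructed later are
    real, so the paired equation closes on real functions of time. *)
Definition rpair f eta : R := \int[mu2]_(p in Omega) (complex.Re (f p) * eta p).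

Lemma cmod_sq (z : R[i]) : cmod z ^+ 2 = complex.Re z ^+ 2 + complex.Im z ^+ 2.
Proof. by rewrite sqr_sqrtr// addr_ge0// sqr_ge0. Qed.

Lemma inL2P f : inL2 Omega f <-> sqi (re f) /\ sqi (im f).
Proof.
have E p : cmod (f p) ^+ 2 = complex.Re (f p) ^+ 2 + complex.Im (f p) ^+ 2 by exact: cmod_sq.
split=> [[m1 m2 H]|[[m1 i1] [m2 i2]]].
  have mE : measurable_fun (Omega : set (mR * mR)) (fun p : mR * mR => cmod (f p) ^+ 2 : mR).
    rewrite (_ : (fun _ => _) = (fun p : mR * mR =>
      (complex.Re (f p) ^+ 2 + complex.Im (f p) ^+ 2 : mR))); last exact/funext.
    by apply: measurable_funD; exact: measurable_funX.
  have iE : mu2.-integrable Omega (EFin \o (fun p => cmod (f p) ^+ 2)).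
    apply/integrableP; split; first exact/measurable_EFinP.
    by under eq_integral => p _ do rewrite /= ger0_norm ?sqr_ge0//.
  split; split => //.
    apply: (integrable_le mO _ iE); first exact: measurable_funX.
    by move=> p _; rewrite E ger0_norm ?sqr_ge0// lerDl sqr_ge0.
  apply: (integrable_le mO _ iE); first exact: measurable_funX.
  by move=> p _; rewrite E ger0_norm ?sqr_ge0// lerDr sqr_ge0.
split => //; have /integrableP[_] := integrable_addr mO i1 i2.
by under eq_integral => p _ do rewrite /= -E ger0_norm ?sqr_ge0//.
Qed.

Lemma sqi_ext (h k : R * R -> R) : h =1 k -> sqi h -> sqi k.
Proof. by move=> /funext ->. Qed.

Lemma inL2D f g : inL2 Omega f -> inL2 Omega g -> inL2 Omega (fun p => f p + g p).
Proof.
move=> /inL2P[f1 f2] /inL2P[g1 g2]; apply/inL2P; split.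
  by apply: sqi_ext (sq_integrableD mO f1 g1) => p; case: (f p); case: (g p).
by apply: sqi_ext (sq_integrableD mO f2 g2) => p; case: (f p); case: (g p).
Qed.

Lemma inL2Z (c : R) f : inL2 Omega f -> inL2 Omega (fun p => c%:C * f p).
Proof.
move=> /inL2P[f1 f2]; apply/inL2P; split.
  by apply: sqi_ext (sq_integrableZ mO c f1) => p; rewrite cReM/= mul0r subr0.
by apply: sqi_ext (sq_integrableZ mO c f2) => p; rewrite cImM/= mul0r addr0.
Qed.

Lemma inL2B f g : inL2 Omega f -> inL2 Omega g -> inL2 Omega (fun p => f p - g p).
Proof.
move=> hf /(inL2Z (-1)) hg; have := inL2D hf hg.
by under eq_fun do rewrite rmorphN1 mulN1r.
Qed.

Lemma inL2_0 : inL2 Omega (fun=> 0).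
Proof.
suff h : sqi (fun=> 0) by apply/inL2P; split.
split; first exact: measurable_cst.
apply: (@bounded_integrable _ _ _ 0) => //.
by move=> p _; rewrite expr0n normr0.
Qed.

Lemma inL2_sum (I : Type) (s : seq I) (F : I -> planefun R) :
  (forall i, inL2 Omega (F i)) -> inL2 Omega (fun p => \sum_(i <- s) F i p).
Proof.
move=> HF; elim: s => [|i s IH].
  by under eq_fun do rewrite big_nil; exact: inL2_0.
by under eq_fun do rewrite big_cons; exact: inL2D.
Qed.

Lemma L2norm_ge0 f : 0 <= L2norm Omega f. Proof. exact: sqrtr_ge0. Qed.

Lemma sq_norm_re_le f : inL2 Omega f -> sqn (re f) <= L2norm Omega f.
Proof.
move=> /inL2P[[m1 i1] [m2 i2]]; rewrite ler_wsqrtr//.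
apply: le_Rintegral => //; last by move=> p _; rewrite cmod_sq lerDl sqr_ge0.
by under eq_fun do rewrite cmod_sq; exact: integrable_addr.
Qed.

Lemma test_sqi eta : test_real Omega eta -> sqi eta.
Proof. exact: test_real_sq_integrable. Qed.

Lemma rpair_le f eta : inL2 Omega f -> test_real Omega eta ->
  `|rpair f eta| <= L2norm Omega f * sqn eta.
Proof.
move=> hf te; have [h1 _] := (inL2P f).1 hf.
apply: le_trans (cauchy_schwarz mO h1 (test_sqi te)) _.
by rewrite ler_wpM2r ?sqrtr_ge0// sq_norm_re_le.
Qed.

Lemma rpair_integrable f eta : inL2 Omega f -> test_real Omega eta ->
  mu2.-integrable Omega (EFin \o (fun p => complex.Re (f p) * eta p)).
Proof. move=> /inL2P[h1 _] te; have h := sq_integrableM mO h1 (test_sqi te); exact: h. Qed.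

Lemma rpairD f g eta : inL2 Omega f -> inL2 Omega g -> test_real Omega eta ->
  rpair (fun p => f p + g p) eta = rpair f eta + rpair g eta.
Proof.
move=> hf hg te; rewrite /rpair -RintegralD//; [|exact: rpair_integrable..].
by apply: eq_Rintegral => p _; rewrite -mulrDl; case: (f p); case: (g p).
Qed.

Lemma rpairZ (c : R) f eta : inL2 Omega f -> test_real Omega eta ->
  rpair (fun p => c%:C * f p) eta = c * rpair f eta.
Proof.
move=> hf te; rewrite /rpair -RintegralZl//; last exact: rpair_integrable.
by apply: eq_Rintegral => p _; rewrite cReM/= mul0r subr0 mulrA.
Qed.

Lemma rpairB f g eta : inL2 Omega f -> inL2 Omega g -> test_real Omega eta ->
  rpair (fun p => f p - g p) eta = rpair f eta - rpair g eta.
Proof.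
move=> hf hg te; have := rpairD hf (inL2Z (-1) hg) te; rewrite rpairZ// mulN1r => <-.
by congr rpair; apply/funext => p; rewrite rmorphN1 mulN1r.
Qed.

Lemma rpair_sum (I : Type) (s : seq I) (F : I -> planefun R) eta :
  (forall i, inL2 Omega (F i)) -> test_real Omega eta ->
  rpair (fun p => \sum_(i <- s) F i p) eta = \sum_(i <- s) rpair (F i) eta.
Proof.
move=> HF te; elim: s => [|i s IH].
  rewrite big_nil /rpair; under eq_Rintegral do rewrite big_nil mul0r.
  by rewrite Rintegral_cst// mul0r.
rewrite big_cons -IH -rpairD//; last exact: inL2_sum.
by congr rpair; apply/funext => p; rewrite big_cons.
Qed.

Lemma rpairDr f eta zeta : inL2 Omega f -> test_real Omega eta -> test_real Omega zeta ->
  rpair f (fun p => eta p + zeta p) = rpair f eta + rpair f zeta.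
Proof.
move=> hf te tz; rewrite /rpair -RintegralD//; [|exact: rpair_integrable..].
by apply: eq_Rintegral => p _; rewrite -mulrDr.
Qed.

Lemma ae_eq_rpair (A : set (R * R)) f g eta : inL2 Omega f -> inL2 Omega g -> test_real Omega eta ->
  A `<=` Omega -> (forall p, Omega p -> ~ A p -> eta p = 0) ->
  ae_eq_on A f g -> rpair f eta = rpair g eta.
Proof.
move=> hf hg te AO e0 H; rewrite /rpair /Rintegral; congr fine.
apply: ae_eq_integral => //.
- exact: measurable_int (rpair_integrable hf te).
- exact: measurable_int (rpair_integrable hg te).
apply: ae_plane_mono H => p /= h Op.
have [Ap|nA] := pselect (A p); first by rewrite h.
by rewrite e0// !mulr0.
Qed.

Lemma test_function_real eta : test_real Omega eta ->
  test_function Omega (fun p => (eta p)%:C).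
Proof.
move=> [se [D [cD DO e0]]]; split; [exact: se|exact: smooth_cst|].
by exists D; split => // p /e0 ->.
Qed.

Lemma weak_partial_re i f g eta : weak_partial Omega i f g -> test_real Omega eta ->
  \int[mu2]_(p in Omega) (complex.Re (f p) * 'D_(axis R i) eta p)
    = - \int[mu2]_(p in Omega) (complex.Re (g p) * eta p).
Proof.
move=> H te; have := congr1 (@complex.Re R) (H _ (test_function_real te)).
rewrite /cintegral /=; congr (_ = - _); apply: eq_Rintegral => p _; rewrite cReM/=.
  by rewrite (_ : 'D__ (cst _) _ = 0) ?mulr0 ?subr0//; exact: derive_cst.
by rewrite mulr0 subr0.
Qed.

Lemma weak_partial_im i f g eta : weak_partial Omega i f g -> test_real Omega eta ->
  \int[mu2]_(p in Omega) (complex.Im (f p) * 'D_(axis R i) eta p)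
    = - \int[mu2]_(p in Omega) (complex.Im (g p) * eta p).
Proof.
move=> H te; have := congr1 (@complex.Im R) (H _ (test_function_real te)).
rewrite /cintegral /=; congr (_ = - _); apply: eq_Rintegral => p _; rewrite cImM/=.
  by rewrite (_ : 'D__ (cst _) _ = 0) ?mulr0 ?add0r//; exact: derive_cst.
by rewrite mulr0 add0r.
Qed.

Lemma test_function_parts phi : test_function Omega phi ->
  test_real Omega (re phi) /\ test_real Omega (im phi).
Proof.
move=> [s1 s2 [D [cD DO e0]]]; split; (split; first by []).
  by exists D; split => // p /e0 ->.
by exists D; split => // p /e0 ->.
Qed.

Lemma weak_partial_of_parts i f g : inL2 Omega f -> inL2 Omega g ->
  (forall eta, test_real Omega eta ->
    \int[mu2]_(p in Omega) (complex.Re (f p) * 'D_(axis R i) eta p)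
      = - \int[mu2]_(p in Omega) (complex.Re (g p) * eta p)) ->
  (forall eta, test_real Omega eta ->
    \int[mu2]_(p in Omega) (complex.Im (f p) * 'D_(axis R i) eta p)
      = - \int[mu2]_(p in Omega) (complex.Im (g p) * eta p)) ->
  weak_partial Omega i f g.
Proof.
move=> /inL2P[f1 f2] /inL2P[g1 g2] H1 H2 phi /test_function_parts[t1 t2].
have int (h eta : R * R -> R) : sqi h -> test_real Omega eta ->
    mu2.-integrable Omega (EFin \o (fun p => h p * eta p)).
  by move=> hh te; have r := sq_integrableM mO hh (test_sqi te); exact: r.
have d1 := test_real_partial i t1; have d2 := test_real_partial i t2.
apply: eq_complexP => /=.
- under eq_Rintegral do rewrite cReM.
  under [in RHS]eq_Rintegral do rewrite cReM.
  by rewrite !RintegralB ?H1 ?H2//=; [ring|exact: int..].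
- under eq_Rintegral do rewrite cImM.
  under [in RHS]eq_Rintegral do rewrite cImM.
  by rewrite !RintegralD ?H1 ?H2//=; [ring|exact: int..].
Qed.

Lemma wD_spec i f : inH1 Omega f ->
  inL2 Omega (wD Omega i f) /\ weak_partial Omega i f (wD Omega i f).
Proof. by move=> [_ /(_ i) H]; have := xgetPex (fun=> 0) H. Qed.

Lemma rpair_wD i f eta : inH1 Omega f -> test_real Omega eta ->
  rpair (wD Omega i f) eta = - rpair f ('D_(axis R i) eta).
Proof. by move=> /(wD_spec i)[_ w] te; rewrite /rpair (weak_partial_re w te) opprK. Qed.

Definition Lap eta : R * R -> R :=
  fun p => \sum_(i : bool) 'D_(axis R i) ('D_(axis R i) eta) p.

Lemma LapE eta : Lap eta = fun p => 'D_(axis R true) ('D_(axis R true) eta) p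
  + 'D_(axis R false) ('D_(axis R false) eta) p.
Proof. by apply/funext => p; rewrite /Lap big_bool. Qed.

Lemma test_real_Lap eta : test_real Omega eta -> test_real Omega (Lap eta).
Proof.
move=> te; rewrite LapE; apply: test_realD; apply: test_real_partial;
by apply: test_real_partial.
Qed.

Lemma inL2_laplacian f : inH2 Omega f -> inL2 Omega (laplacian Omega f).
Proof.
move=> [_ h]; apply: inL2_sum => i; exact: (wD_spec i (h i)).1.
Qed.

Lemma rpair_laplacian f eta : inH2 Omega f -> test_real Omega eta ->
  rpair (laplacian Omega f) eta = rpair f (Lap eta).
Proof.
move=> [h1 h2] te; have tD i : test_real Omega ('D_(axis R i) eta) by exact: test_real_partial.
have tDD i : test_real Omega ('D_(axis R i) ('D_(axis R i) eta)) by exact: test_real_partial.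
have E i : rpair (wD Omega i (wD Omega i f)) eta = rpair f ('D_(axis R i) ('D_(axis R i) eta)).
  by rewrite (rpair_wD i (h2 i) te) (rpair_wD i h1 (tD i)) opprK.
have A : rpair (laplacian Omega f) eta =
    \sum_(i : bool) rpair (wD Omega i (wD Omega i f)) eta.
  by apply: rpair_sum te => i; exact: (wD_spec i (h2 i)).1.
have B := rpairDr h1.1 (tDD true) (tDD false).
rewrite LapE; apply: (etrans A); apply: etrans (esym B).
by rewrite big_bool; congr (_ + _); exact: E.
Qed.

Lemma ae_plane_and (P Q : R * R -> Prop) : {ae mu2, forall p, P p} ->
  {ae mu2, forall p, Q p} -> {ae mu2, forall p, P p /\ Q p}.
Proof.
move=> [A [mA A0 sA]] [B [mB B0 sB]]; exists (A `|` B); split; first exact: measurableU.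
  exact: null_set_setU.
move=> p /= np; have [Pp|nP] := pselect (P p); last by left; apply: sA.
by right; apply: sB => /= Qp; apply: np.
Qed.

Lemma eq_ae_parts f g : {ae mu2, forall p, Omega p -> complex.Re (f p) - complex.Re (g p) = 0} ->
  {ae mu2, forall p, Omega p -> complex.Im (f p) - complex.Im (g p) = 0} -> ae_eq_on Omega f g.
Proof.
move=> h1 h2; have h := ae_plane_and h1 h2; apply: ae_plane_mono h => p /= [k1 k2] Op.
by apply: eq_complexP; apply/eqP; rewrite -subr_eq0; apply/eqP; [exact: k1|exact: k2].
Qed.

Lemma sqi_integrable (h : R * R -> R) : sqi h -> mu2.-integrable Omega (EFin \o h).
Proof.
move=> hh.
have h1 : sqi (fun=> 1).
  apply: (@bounded_sq_integrable _ _ _ 1) => //; first by move=> p _; rewrite normr1.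
have r := sq_integrableM mO hh h1.
by apply: eq_integrable r => // p _ /=; rewrite mulr1.
Qed.

Lemma ae_eq_of_pairings (h k : R * R -> R) : sqi h -> sqi k ->
  (forall eta, test_real Omega eta ->
    \int[mu2]_(p in Omega) (h p * eta p) = \int[mu2]_(p in Omega) (k p * eta p)) ->
  {ae mu2, forall p, Omega p -> h p - k p = 0}.
Proof.
move=> hh hk H; apply: (du_bois_reymond oO).
  by apply: sqi_integrable; exact: sq_integrableB.
move=> eta te; under eq_Rintegral do rewrite mulrBl.
rewrite RintegralB//; [by rewrite H// subrr|..].
- by have r := sq_integrableM mO hh (test_sqi te); exact: r.
- by have r := sq_integrableM mO hk (test_sqi te); exact: r.
Qed.

(** By the lemma of du Bois-Reymond on each component. It makes the chosen representative [wD]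
    comparable with any explicit weak derivative. *)
Lemma weak_partial_unique i f g g' : inL2 Omega g -> inL2 Omega g' ->
  weak_partial Omega i f g -> weak_partial Omega i f g' -> ae_eq_on Omega g g'.
Proof.
move=> /inL2P[g1 g2] /inL2P[g1' g2'] w w'.
apply: eq_ae_parts; apply: ae_eq_of_pairings => // eta te; apply: oppr_inj.
  by rewrite -(weak_partial_re w te) -(weak_partial_re w' te).
by rewrite -(weak_partial_im w te) -(weak_partial_im w' te).
Qed.

Lemma wD_ae i f g : inL2 Omega g -> weak_partial Omega i f g ->
  inH1 Omega f -> ae_eq_on Omega (wD Omega i f) g.
Proof. by move=> hg w hf; have [a b] := wD_spec i hf; exact: weak_partial_unique b w. Qed.

Lemma ae_eq_Rint (h k : R * R -> R) : sqi h -> sqi k ->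
  {ae mu2, forall p, Omega p -> h p = k p} -> forall eta, test_real Omega eta ->
  \int[mu2]_(p in Omega) (h p * eta p) = \int[mu2]_(p in Omega) (k p * eta p).
Proof.
move=> hh hk H eta te; rewrite /Rintegral; congr fine; apply: ae_eq_integral => //.
- by have r := sq_integrableM mO hh (test_sqi te); exact: measurable_int r.
- by have r := sq_integrableM mO hk (test_sqi te); exact: measurable_int r.
by apply: ae_plane_mono H => p /= h1 Op; rewrite h1.
Qed.

Lemma weak_partial_ae i f f' g : inL2 Omega f -> inL2 Omega f' -> inL2 Omega g ->
  ae_eq_on Omega f f' -> weak_partial Omega i f g -> weak_partial Omega i f' g.
Proof.
move=> hf hf' hg E w; have [f1 f2] := (inL2P f).1 hf; have [f1' f2'] := (inL2P f').1 hf'.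
apply: weak_partial_of_parts => // eta te.
  rewrite -(weak_partial_re w te); apply: ae_eq_Rint => //; last exact: test_real_partial.
  by apply: ae_plane_mono E => p /= h Op; rewrite h.
rewrite -(weak_partial_im w te); apply: ae_eq_Rint => //; last exact: test_real_partial.
by apply: ae_plane_mono E => p /= h Op; rewrite h.
Qed.

Lemma inH1_ae f f' : inL2 Omega f' -> ae_eq_on Omega f f' -> inH1 Omega f -> inH1 Omega f'.
Proof.
move=> hf' E [hf H]; split => // i; have [g [hg w]] := H i; exists g; split => //.
exact: weak_partial_ae w.
Qed.

Lemma weak_partialB i f f' g g' : inL2 Omega f -> inL2 Omega f' -> inL2 Omega g -> inL2 Omega g' ->
  weak_partial Omega i f g -> weak_partial Omega i f' g' ->
  weak_partial Omega i (fun p => f p - f' p) (fun p => g p - g' p).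
Proof.
move=> hf hf' hg hg' w w'.
have [f1 f2] := (inL2P f).1 hf; have [f1' f2'] := (inL2P f').1 hf'.
have [g1 g2] := (inL2P g).1 hg; have [g1' g2'] := (inL2P g').1 hg'.
have int (h eta : R * R -> R) : sqi h -> test_real Omega eta ->
    mu2.-integrable Omega (EFin \o (fun p => h p * eta p)).
  by move=> hh te; have r := sq_integrableM mO hh (test_sqi te); exact: r.
have B (h k eta : R * R -> R) : sqi h -> sqi k -> test_real Omega eta ->
    \int[mu2]_(p in Omega) ((h p - k p) * eta p) =
    \int[mu2]_(p in Omega) (h p * eta p) - \int[mu2]_(p in Omega) (k p * eta p).
  move=> hh hk te; under eq_Rintegral do rewrite mulrBl.
  by rewrite RintegralB//; exact: int.
apply: weak_partial_of_parts; [exact: inL2B|exact: inL2B|..] => eta te.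
  under eq_Rintegral do rewrite raddfB/=; under [in RHS]eq_Rintegral do rewrite raddfB/=.
  by rewrite !B//; [rewrite (weak_partial_re w te) (weak_partial_re w' te); ring|exact: test_real_partial].
under eq_Rintegral do rewrite raddfB/=; under [in RHS]eq_Rintegral do rewrite raddfB/=.
by rewrite !B//; [rewrite (weak_partial_im w te) (weak_partial_im w' te); ring|exact: test_real_partial].
Qed.

Lemma inH1B f g : inH1 Omega f -> inH1 Omega g -> inH1 Omega (fun p => f p - g p).
Proof.
move=> [hf Hf] [hg Hg]; split => [|i]; first exact: inL2B.
have [f1 [h1 w1]] := Hf i; have [g1 [h2 w2]] := Hg i.
by exists (fun p => f1 p - g1 p); split; [exact: inL2B|exact: weak_partialB].
Qed.

(** The chosen [wD] of a difference agrees with the difference of the chosen [wD] only almost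
    everywhere, so uniqueness and the invariance of [inH1] under such changes are both involved. *)
Lemma inH2B f g : inH2 Omega f -> inH2 Omega g -> inH2 Omega (fun p => f p - g p).
Proof.
move=> [hf Hf] [hg Hg]; have H1 := inH1B hf hg; split; [exact: H1|move=> i].
have [a1 w1] := wD_spec i hf; have [a2 w2] := wD_spec i hg; have [a3 w3] := wD_spec i H1.
have w4 := weak_partialB hf.1 hg.1 a1 a2 w1 w2.
exact: inH1_ae a3 (weak_partial_unique (inL2B a1 a2) a3 w4 w3) (inH1B (Hf i) (Hg i)).
Qed.

Lemma L2norm_le_H1norm f : L2norm Omega f <= H1norm Omega f.
Proof.
rewrite -[leLHS](ger0_norm (L2norm_ge0 f)) -sqrtr_sqr ler_wsqrtr// lerDl.
by apply: sumr_ge0 => i _; exact: sqr_ge0.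
Qed.

Lemma H1norm_le_H2norm f : H1norm Omega f <= H2norm Omega f.
Proof.
rewrite -[leLHS](ger0_norm (sqrtr_ge0 _)) -sqrtr_sqr ler_wsqrtr// lerDl.
by apply: sumr_ge0 => i _; apply: sumr_ge0 => j _; exact: sqr_ge0.
Qed.

Lemma le_double_sum_bool (F : bool -> bool -> R) (a : R) i j : 0 <= a ->
  (forall k l, 0 <= F k l) -> F i j <= a + \sum_(k : bool) \sum_(l : bool) F k l.
Proof.
move=> a0 F0; rewrite big_bool !big_bool/=.
have := (F0 true true, F0 true false, F0 false true, F0 false false).
by move=> [[[h1 h2] h3] h4]; case: i; case: j; lra.
Qed.

Lemma L2norm_wD2_le f i j : L2norm Omega (wD Omega j (wD Omega i f)) <= H2norm Omega f.
Proof.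
rewrite -[leLHS](ger0_norm (L2norm_ge0 _)) -sqrtr_sqr ler_wsqrtr//.
apply: (@le_double_sum_bool (fun i j => L2norm Omega (wD Omega j (wD Omega i f)) ^+ 2)).
  exact: sqr_ge0.
by move=> k l; exact: sqr_ge0.
Qed.

(** Moving the Laplacian onto [f] leaves the L_2 norm of [eta] itself. For a bump of half-side [r]
    this is [O(r)], whereas Cauchy-Schwarz with [Lap eta] would only give [O(1 / r)]. *)
Lemma rpair_Lap_le f eta : inH2 Omega f -> test_real Omega eta ->
  `|rpair f (Lap eta)| <= 2 * H2norm Omega f * sqn eta.
Proof.
move=> hf te; rewrite -(rpair_laplacian hf te).
have A : rpair (laplacian Omega f) eta =
    \sum_(i : bool) rpair (wD Omega i (wD Omega i f)) eta.
  by apply: rpair_sum te => i; exact: (wD_spec i (hf.2 i)).1.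
have B i : `|rpair (wD Omega i (wD Omega i f)) eta| <= H2norm Omega f * sqn eta.
  apply: le_trans (rpair_le (wD_spec i (hf.2 i)).1 te) _.
  by rewrite ler_wpM2r ?sqrtr_ge0// L2norm_wD2_le.
have key (x y z : R) : `|x| <= z -> `|y| <= z -> `|x + y| <= 2 * z.
  by move=> hx hy; apply: le_trans (ler_normD _ _) _; lra.
by rewrite A big_bool -mulrA; apply: key; exact: B.
Qed.

End sobolev.

(** * Pairings of a solution with test functions *)

Section riemann_sums.
Variable R : realType.
Notation mu := (@lebesgue_measure R).
Implicit Types (g : R -> R).

Lemma within_cvg0P g (A : set R) (t : R) : g s @[s --> within A (nbhs t)] --> (0 : R) ->
  forall e : R, 0 < e -> exists2 d : R, 0 < d &
  forall s : R, `|t - s| < d -> A s -> `|g s| < e.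
Proof.
move=> /cvgrPdist_lt H e e0; have := H e e0.
move=> /nbhs_ballP[d /= d0 Hd]; exists d => // s ts As.
have := Hd s; rewrite -ball_normE /= sub0r normrN; exact.
Qed.

Lemma within_dnbhs_cvg0P g (A : set R) (t : R) : g s @[s --> within A (t^')] --> (0 : R) ->
  forall e : R, 0 < e -> exists2 d : R, 0 < d &
  forall s : R, `|t - s| < d -> s != t -> A s -> `|g s| < e.
Proof.
move=> /cvgrPdist_lt H e e0; have := H e e0.
move=> /nbhs_ballP[d /= d0 Hd]; exists d => // s ts st As.
have := Hd s; rewrite -ball_normE /= sub0r normrN; exact.
Qed.

Lemma within_continuousP g (A : set R) :
  (forall t : R, A t -> forall e : R, 0 < e -> exists2 d : R, 0 < d &
    forall s : R, `|t - s| < d -> A s -> `|g t - g s| < e) -> {within A, continuous g}.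
Proof.
move=> H; apply/subspace_continuousP => t At; apply/cvgrPdist_lt => e e0.
have [d d0 Hd] := H t At e e0; by apply/nbhs_ballP; exists d.
Qed.

Lemma is_derive_epsP g (t l : R) : (forall e : R, 0 < e -> exists2 d : R, 0 < d &
    forall s : R, `|t - s| < d -> s != t -> `|(s - t)^-1 * (g s - g t) - l| < e) ->
  is_derive t 1 g l.
Proof.
move=> H.
have C : (h^-1 *: ((g \o shift t) (h *: 1) - g t)) @[h --> (0 : R)^'] --> l.
  apply/cvgrPdist_lt => e e0; have [d d0 Hd] := H e e0.
  apply/nbhs_ballP; exists d => // h; rewrite -ball_normE /= sub0r normrN => hd h0.
  have := Hd (h + t); rewrite opprD addrCA subrr addr0 normrN addrK => /(_ hd).
  rewrite distrC -subr_eq0 addrK => /(_ h0).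
  by rewrite [h *: 1]mulr1.
by apply: DeriveDef; [apply/cvg_ex; exists l|apply/cvg_lim].
Qed.

Lemma derivative_halfline_continuous (K K1 : R -> R) : derivative_halfline K K1 ->
  {within [set t : R | 0 <= t], continuous K}.
Proof.
move=> H; apply: within_continuousP => t t0 e e0.
have H1 : ((s - t)^-1 * (K s - K t) - K1 t) @[s --> within [set s : R | 0 <= s] (t^')] --> (0 : R).
  have h := cvgB (H t t0) (cvg_cst (K1 t)); rewrite subrr in h; exact: h.
have [d d0 Hd] := within_dnbhs_cvg0P H1 (@ltr01 R).
pose M := `|K1 t| + 1; have M0 : 0 < M by rewrite ltr_wpDl.
exists (Num.min d (e / M)); first by rewrite lt_min d0 divr_gt0.
move=> s; rewrite lt_min => /andP[sd se] s0.
have [->|st] := eqVneq s t; first by rewrite subrr normr0.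
have h := Hd s sd st s0; have st0 : s - t != 0 by rewrite subr_eq0.
have h2 : `|(s - t)^-1 * (K s - K t)| < M.
  rewrite -[X in `|X|](subrK (K1 t)); apply: le_lt_trans (ler_normD _ _) _.
  by rewrite /M addrC ltrD2l.
rewrite distrC -[K s - K t](mulKf (invr_neq0 st0)) invrK normrM distrC.
apply: le_lt_trans (ler_wpM2l (normr_ge0 _) (ltW h2)) _.
by rewrite -ltr_pdivlMr.
Qed.

Lemma integral_mean_value g (a b : R) : a <= b -> {within `[a, b], continuous g} ->
  exists2 c, a <= c <= b & (b - a) * g c = \int[mu]_(x in `[a, b]) g x.
Proof.
move=> ab cg; have ig := continuous_itv_integrable cg.
have [ab'|ba] := ltP a b; last first.
  have -> : b = a by apply/le_anti; rewrite ba ab.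
  exists a; rewrite ?lexx// subrr mul0r /Rintegral set_itv1.
  by rewrite (@integral_Sset1 _ _ _ a).
have [c1 c1i H1] := EVT_max ab cg; have [c2 c2i H2] := EVT_min ab cg.
pose v := \int[mu]_(x in `[a, b]) g x / (b - a).
have ba0 : 0 < b - a by rewrite subr_gt0.
have v1 : v <= g c1.
  rewrite ler_pdivrMr// -Rintegral_itv_cst//; apply: le_Rintegral => //.
  exact: integrable_itv_cst.
have v2 : g c2 <= v.
  rewrite ler_pdivlMr// -Rintegral_itv_cst//; apply: le_Rintegral => //.
  exact: integrable_itv_cst.
move: c1i c2i; rewrite !in_itv/= => /andP[a1 b1] /andP[a2 b2].
suff [c cab gc] : exists2 c, a <= c <= b & g c = v.
  by exists c => //; rewrite gc mulrC divfK// gt_eqF.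
have sub (x y : R) : a <= x -> y <= b -> {within `[x, y], continuous g}.
  move=> ax yb; apply: continuous_subspaceW cg.
  by apply: subset_itv; rewrite bnd_simp.
have [c12|c21] := leP c1 c2.
  have [|c] := IVT c12 (sub _ _ a1 b2) (v := v).
    by rewrite ge_min v2 orbT le_max v1.
  rewrite in_itv/= => /andP[h1 h2] gc; exists c => //.
  by rewrite (le_trans a1)// (le_trans h2).
have [|c] := IVT (ltW c21) (sub _ _ a2 b1) (v := v).
  by rewrite ge_min v2 le_max v1 orbT.
rewrite in_itv/= => /andP[h1 h2] gc; exists c => //.
by rewrite (le_trans a2)// (le_trans h2).
Qed.

(* Choosing the tags by the mean value theorem makes the Riemann sums exact, so
   that the L_2 integral in the equation can be paired with a test function
   without any uniform estimate. *)
Lemma exact_riemann_sum g (t d : R) : 0 < t -> 0 < d -> {within `[0, t], continuous g} ->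
  exists (n : nat) (x tau : nat -> R), [/\ x 0%N = 0, x n = t,
    forall i : nat, (i < n)%N -> x i <= tau i <= x i.+1 /\ x i.+1 - x i < d,
    forall i : nat, (i < n)%N -> 0 <= tau i <= t &
    \sum_(i < n) (x i.+1 - x i) * g (tau i) = \int[mu]_(x in `[0, t]) g x].
Proof.
move=> t0 d0 cg.
pose n := (Num.bound (t / d)).+1; have n0 : (0 : R) < n%:R by rewrite ltr0n.
pose x (i : nat) : R := t * i%:R / n%:R.
have dx i : x i.+1 - x i = t / n%:R.
  by rewrite /x -natr1 mulrDr mulr1 mulrDl addrC addKr.
have dx0 : 0 < t / n%:R by rewrite divr_gt0.
have dxd : t / n%:R < d.
  rewrite ltr_pdivrMr// mulrC -ltr_pdivrMr//.
  apply: (lt_trans (archi_boundP (divr_ge0 (ltW t0) (ltW d0)))).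
  by rewrite ltr_nat.
have x0 i : 0 <= x i by rewrite /x divr_ge0// ?mulr_ge0// ltW.
have xt i : (i <= n)%N -> x i <= t.
  move=> h; rewrite /x ler_pdivrMr//; apply: ler_wpM2l; first exact: ltW.
  by rewrite ler_nat.
have xS i : x i <= x i.+1 by rewrite -subr_ge0 dx ltW.
have sub (i : nat) (a : R) : (i <= n)%N -> 0 <= a -> {within `[a, x i], continuous g}.
  move=> h a0; apply: continuous_subspaceW cg.
  by apply: subset_itv; rewrite bnd_simp// xt.
have /choice[tau Htau] (i : nat) : exists c, (i < n)%N -> x i <= c <= x i.+1 /\
    (x i.+1 - x i) * g c = \int[mu]_(s in `[x i, x i.+1]) g s.
  have [h|h] := ltnP i n; last by exists 0.
  by have [c c1 c2] := integral_mean_value (xS i) (sub i.+1 (x i) h (x0 i)); exists c.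
have xn : x n = t by rewrite /x mulfK// gt_eqF.
exists n, x, tau; split => //.
- by rewrite /x mulr0 mul0r.
- by move=> i h; split; [exact: (Htau i h).1|rewrite dx].
- move=> i h; have /andP[h1 h2] := (Htau i h).1.
  by rewrite (le_trans (x0 i) h1) (le_trans h2 (xt _ h)).
- rewrite -xn; suff : forall m, (m <= n)%N ->
    \sum_(i < m) (x i.+1 - x i) * g (tau i) = \int[mu]_(x in `[0, x m]) g x by apply.
  elim=> [_|m IH mn].
    rewrite big_ord0 /x mulr0 mul0r /Rintegral set_itv1.
    by rewrite (@integral_Sset1 _ _ _ 0).
  rewrite big_ord_recr/= IH ?(ltnW mn)// (Htau m mn).2 -Rintegral_itv_split//.
  by apply: continuous_itv_integrable; exact: sub.
Qed.

End riemann_sums.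

Section time_pairings.
Variables (R : realType) (Omega : set (R * R)).
Notation mu := (@lebesgue_measure R).
Notation mu2 := (leb2 R).
Notation sqn := (sq_norm mu2 Omega).
Notation halfline := [set t : R | 0 <= t].
Hypotheses (oO : open Omega) (Ooo : (mu2 Omega < +oo)%E).

Lemma rpair_continuous (N : planefun R -> R) (g : R -> planefun R) eta :
  (forall f, L2norm Omega f <= N f) -> (forall t, 0 <= t -> inL2 Omega (g t)) ->
  continuous_for N halfline g -> test_real Omega eta ->
  {within halfline, continuous (fun t => rpair Omega (g t) eta)}.
Proof.
move=> N2 ig cg te; apply: within_continuousP => t t0 e e0.
(* Adding 1 keeps the denominator positive when the norm of [eta] is zero. *)
have s0 : 0 < sqn eta + 1 by rewrite ltr_wpDl// sqrtr_ge0.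
have [d d0 Hd] := within_cvg0P (cg t t0) (divr_gt0 e0 s0).
exists d => // s ts s0'; have := Hd s ts s0'; rewrite ltr_pdivlMr// => h.
have i1 := ig s s0'; have i2 := ig t t0.
rewrite distrC -(rpairB oO Ooo i1 i2 te).
apply: le_lt_trans (rpair_le oO Ooo (inL2B oO i1 i2) te) _.
apply: le_lt_trans h; apply: ler_pM; [exact: sqrtr_ge0|exact: sqrtr_ge0| |].
  exact: le_trans (N2 _) (ler_norm _).
by rewrite lerDl.
Qed.

Variables (K : R -> R) (theta theta' u : R -> planefun R) (D : set (R * R)).
Hypotheses (cK : {within halfline, continuous K})
  (th2 : forall t, 0 <= t -> inH2 Omega (theta t))
  (cth : continuous_for (H2norm Omega) halfline theta)
  (th'2 : forall t, 0 <= t -> inL2 Omega (theta' t))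
  (dth : derivative_for (L2norm Omega) theta theta')
  (cth' : continuous_for (L2norm Omega) halfline theta')
  (eqn : forall t, 0 < t -> exists2 I : planefun R,
     is_L2_integral Omega 0 t
       (fun s p => (K (t - s))%:C * laplacian Omega (theta s) p) I &
     ae_eq_on Omega (fun p => theta' t p - I p) (u t))
  (u2 : forall t, 0 <= t -> inL2 Omega (u t))
  (uD : forall t, 0 <= t -> ae_eq_on (Omega `\` D) (u t) (fun=> 0)).

Let th0 t : 0 <= t -> inL2 Omega (theta t).
Proof. by move=> /th2[[]]. Qed.

Lemma rpair_theta_continuous eta : test_real Omega eta ->
  {within halfline, continuous (fun t => rpair Omega (theta t) eta)}.
Proof.
move=> te; apply: rpair_continuous cth te => // f.
exact: le_trans (L2norm_le_H1norm _ _) (H1norm_le_H2norm _ _).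
Qed.

Lemma rpair_theta'_continuous eta : test_real Omega eta ->
  {within halfline, continuous (fun t => rpair Omega (theta' t) eta)}.
Proof. by move=> te; apply: rpair_continuous cth' te. Qed.

Lemma is_derive_rpair_theta eta (t : R) : test_real Omega eta -> 0 < t ->
  is_derive t 1 (fun t => rpair Omega (theta t) eta) (rpair Omega (theta' t) eta).
Proof.
move=> te t0; apply: is_derive_epsP => e e0.
have s0 : 0 < sqn eta + 1 by rewrite ltr_wpDl// sqrtr_ge0.
have [d d0 Hd] := within_dnbhs_cvg0P (dth (ltW t0)) (divr_gt0 e0 s0).
exists (Num.min d t); first by rewrite lt_min d0.
move=> s; rewrite lt_min => /andP[sd st] snt.
have s0' : 0 <= s by move: st; rewrite ltr_norml => /andP[_ h]; lra.
have := Hd s sd snt s0'; rewrite ltr_pdivlMr// => h.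
have i1 := th0 s0'; have i2 := th0 (ltW t0); have i3 := th'2 (ltW t0).
have i4 := inL2B oO i1 i2; have i5 := inL2Z oO ((s - t)^-1) i4.
rewrite -(rpairB oO Ooo i1 i2 te) -(rpairZ oO Ooo ((s - t)^-1) i4 te) -(rpairB oO Ooo i5 i3 te).
apply: le_lt_trans (rpair_le oO Ooo (inL2B oO i5 i3) te) _.
apply: le_lt_trans h; apply: ler_pM; [exact: sqrtr_ge0|exact: sqrtr_ge0|exact: ler_norm|].
by rewrite lerDl.
Qed.

Lemma test_real_sub (A B : set (R * R)) eta : A `<=` B -> test_real A eta -> test_real B eta.
Proof.
move=> AB [se [C [cC CA e0]]]; split => //; exists C; split => //.
exact: subset_trans CA AB.
Qed.

(** The control drops out because [eta] is supported off [D]. With the tags of [exact_riemann_sum]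
    the Riemann sums pair with [eta] to exactly the right-hand side, while their L_2 distance to [I]
    is arbitrarily small. *)
Lemma rpair_theta'E eta (t : R) : test_real (Omega `\` D) eta -> 0 < t ->
  rpair Omega (theta' t) eta =
  \int[mu]_(s in `[0, t]) (K (t - s) * rpair Omega (theta s) (Lap eta)).
Proof.
move=> teD t0; have te : test_real Omega eta by apply: test_real_sub teD => p [].
have [I [I2 HI] uE] := eqn t0; have i3 := th'2 (ltW t0).
have iu := u2 (ltW t0).
have Iu : rpair Omega (theta' t) eta = rpair Omega I eta.
  apply/eqP; rewrite -subr_eq0 -(rpairB oO Ooo i3 I2 te); apply/eqP.
  have A1 := ae_eq_rpair oO Ooo (inL2B oO i3 I2) iu te (@subset_refl _ _) _ uE.
  rewrite A1; last by [].
  have i0 := inL2_0 oO Ooo.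
  have [se [C [cC CO e0]]] := teD.
  rewrite (ae_eq_rpair oO Ooo iu i0 te (A := Omega `\` D) _ _ (uD (ltW t0))).
  - by rewrite /rpair; under eq_Rintegral do rewrite mul0r; rewrite Rintegral_cst ?mul0r//; exact: open_measurable_plane.
  - by move=> p [].
  - by move=> p Op np; apply: e0 => /CO.
rewrite Iu; pose g s := K (t - s) * rpair Omega (theta s) (Lap eta).
have tL := test_real_Lap te.
have cg : {within `[0, t], continuous g}.
  apply: within_contM.
    have h1 (s : R) : `[0, t]%classic s -> halfline (t - s).
      by rewrite /= in_itv/= => /andP[_ h]; rewrite subr_ge0.
    have h2 : {within `[0, t], continuous (fun s : R => t - s)}.
      by apply: continuous_subspaceT => s; have h := continuousB (cvg_cst t) (@cvg_id _ (nbhs s)); exact: h.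
    have h3 := @within_contC R `[0, t]%classic halfline K (fun s => t - s) h1 h2 cK; exact: h3.
  apply: continuous_subspaceW (rpair_theta_continuous tL) => s /=.
  by rewrite in_itv/= => /andP[].
apply/eqP; rewrite -subr_eq0 -normr_le0; apply/ler_addgt0Pl => e e0; rewrite addr0.
have s0 : 0 < sqn eta + 1 by rewrite ltr_wpDl// sqrtr_ge0.
have [d d0 Hd] := HI _ (divr_gt0 e0 s0).
have [n [x [tau [x0 xn xd taut S]]]] := exact_riemann_sum t0 d0 cg.
have := Hd n x tau x0 xn xd; rewrite ltr_pdivlMr// => h.
have iF (i : 'I_n) : inL2 Omega (fun p => (x i.+1 - x i)%:C *
    ((K (t - tau i))%:C * laplacian Omega (theta (tau i)) p)).
  have /andP[h1 h2] := taut i (ltn_ord i).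
  exact: (inL2Z oO _ (inL2Z oO _ (inL2_laplacian oO Ooo (th2 h1)))).
have iS := inL2_sum oO Ooo (index_enum 'I_n) iF.
rewrite -/(g) -S distrC.
have -> : \sum_(i < n) (x i.+1 - x i) * g (tau i) = rpair Omega (fun p =>
    \sum_(i < n) (x i.+1 - x i)%:C * ((K (t - tau i))%:C * laplacian Omega (theta (tau i)) p)) eta.
  rewrite (rpair_sum oO Ooo _ iF te); apply: eq_bigr => i _.
  have /andP[h1 h2] := taut i (ltn_ord i); have j := th2 h1.
  have jl := inL2_laplacian oO Ooo j.
  rewrite (rpairZ oO Ooo _ (inL2Z oO _ jl) te) (rpairZ oO Ooo _ jl te).
  by rewrite (rpair_laplacian oO Ooo j te).
rewrite -(rpairB oO Ooo iS I2 te).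
apply: le_trans (rpair_le oO Ooo (inL2B oO iS I2) te) _; apply: ltW.
apply: le_lt_trans h; apply: ler_wpM2l; first exact: sqrtr_ge0.
by rewrite lerDl.
Qed.

(** Near each time the [H2norm] of the increment of [theta] is less than 1, and compactness of
    [[0, T]] gives one [C]. The triangle inequality is applied to the pairing, which is linear,
    rather than to [H2norm], which involves chosen representatives. *)
Lemma rpair_theta_Lap_bound (T : R) : exists C : R, forall t, 0 <= t <= T ->
  forall eta, test_real Omega eta -> `|rpair Omega (theta t) (Lap eta)| <= C * sqn eta.
Proof.
(* The condition [0 <= t] is part of [P] because neighbourhoods of 0 contain negative times. *)
pose P (C t : R) := 0 <= t -> forall eta, test_real Omega eta ->
  `|rpair Omega (theta t) (Lap eta)| <= C * sqn eta.
have key (a b c x : R) : a < 1 -> 2 * b + 2 <= c -> 0 <= x -> 2 * a * x + 2 * b * x <= c * x.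
  by move=> h1 h2 h3; nra.
have := @segment_compact R 0 T => /compact_near_coveringP /(_ _ (+oo_R) P _).
have H (t : R) : `[0, T]%classic t -> \forall t' \near t & C \near +oo, P C t'.
  rewrite /= in_itv/= => /andP[t0 _].
  have [d d0 Hd] := within_cvg0P (cth t0) (@ltr01 R).
  exists (ball t d, [set C | 2 * H2norm Omega (theta t) + 2 <= C]); first split.
  - exact: nbhsx_ballx.
  - by exists (2 * H2norm Omega (theta t) + 2); split; [exact: num_real|move=> C /ltW].
  move=> [s C] [/= ts HC] s0 eta te; rewrite -ball_normE/= in ts.
  have tL := test_real_Lap te.
  have i1 := th2 s0; have i2 := th2 t0; have i12 := inH2B oO Ooo i1 i2.
  have E := rpairB oO Ooo i1.1.1 i2.1.1 tL.
  have h1 := rpair_Lap_le oO Ooo i12 te.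
  have h2 := rpair_Lap_le oO Ooo i2 te.
  have h3 := Hd s ts s0; rewrite ger0_norm ?sqrtr_ge0// in h3.
  have e0 : 0 <= sqn eta by exact: sqrtr_ge0.
  rewrite -[X in `|X|](subrK (rpair Omega (theta t) (Lap eta))) -E.
  apply: le_trans (ler_normD _ _) _; apply: le_trans (lerD h1 h2) _.
  exact: key h3 HC e0.
move=> /(_ H) [C [_ HC]]; exists (C + 1) => t tT.
by apply: (HC (C + 1)); [rewrite ltrDl|rewrite /= in_itv|case/andP: tT].
Qed.

End time_pairings.

(** * The initial datum *)

Section scaling.
Variable R : realType.
Implicit Types (f : R * R -> R) (c q v : R * R) (r : R).

Definition rescale r c f q : R := f (r^-1 *: (q - c)).

Lemma is_derive_rescale r c f q v (d : R) : is_derive (r^-1 *: (q - c)) v f d ->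
  is_derive q v (rescale r c f) (r^-1 * d).
Proof.
move=> H; have D : derivable f (r^-1 *: (q - c)) v by exact: ex_derive.
have H1 : is_derive (0 : R) 1 (fun h : R => f (h *: v + r^-1 *: (q - c))) d.
  have D1 : derivable (fun h : R => f (h *: v + r^-1 *: (q - c))) 0 1.
    by have [h _] := derivable1P f (r^-1 *: (q - c)) v; exact: h D.
  refine (DeriveDef D1 _).
  have <- := @derive_val _ _ _ _ _ _ _ H; rewrite /derive.
  rewrite (_ : (fun h : R => h^-1 *: (((fun h0 : R => f (h0 *: v + r^-1 *: (q - c))) \o shift 0) (h *: 1) -
     f (0 *: v + r^-1 *: (q - c)))) =
     (fun h : R => h^-1 *: ((f \o shift (r^-1 *: (q - c))) (h *: v) - f (r^-1 *: (q - c)))))//.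
  by apply/funext => h /=; rewrite scale0r add0r addr0 [h *: 1]mulr1.
apply: is_derive_line.
have H2 : is_derive (0 + 1 * 0 : R) 1 (fun h : R => f (h *: v + r^-1 *: (q - c))) d.
  by rewrite mulr0 addr0.
have := is_derive_affine r^-1 0 H2; rewrite mul1r.
congr is_derive; apply/funext => h; rewrite /rescale; congr f.
by rewrite add0r mul1r addr0 -scalerA -scalerDr addrA.
Qed.

Lemma continuous_rescale r c f : continuous f -> continuous (rescale r c f).
Proof.
move=> cf q; apply: (@continuous_comp _ _ _ (fun q : R * R => r^-1 *: (q - c)) f); last exact: cf.
apply: (@continuous_comp _ _ _ (fun q : R * R => q - c) ( *:%R r^-1)); last exact: scaler_continuous.
by apply: continuousB; [exact: cvg_id|exact: cvg_cst].
Qed.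

Lemma iter_partial_rescale r c f w : smooth f ->
  iter_partial (rescale r c f) w = fun q => r^-1 ^+ size w * rescale r c (iter_partial f w) q.
Proof.
move=> sf; elim: w => [|i w IH]; first by apply/funext => q; rewrite /= mul1r.
apply/funext => q; rewrite /= IH.
have H : is_derive q (axis R i) (rescale r c (iter_partial f w))
    (r^-1 * ('D_(axis R i) (iter_partial f w) (r^-1 *: (q - c)))).
  by apply: is_derive_rescale; apply/derivableP; exact: (sf w).2.
have h := is_deriveZ (r^-1 ^+ size w) H.
have h2 := @derive_val _ _ _ _ _ _ _ h.
by apply: (etrans h2); rewrite /GRing.scale/= exprS /rescale; ring.
Qed.

Lemma smooth_rescale r c f : smooth f -> smooth (rescale r c f).
Proof.
move=> sf w; rewrite iter_partial_rescale//; split=> [q|i q].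
  have h1 := @continuous_rescale r c _ (sf w).1 q.
  have h2 : {for q, continuous (fun _ : R * R => r^-1 ^+ size w)} by exact: cst_continuous.
  have h := continuousM h2 h1; exact: h.
have H : is_derive q (axis R i) (rescale r c (iter_partial f w))
    (r^-1 * ('D_(axis R i) (iter_partial f w) (r^-1 *: (q - c)))).
  by apply: is_derive_rescale; apply/derivableP; exact: (sf w).2.
have h := is_deriveZ (r^-1 ^+ size w) H; exact: ex_derive.
Qed.

Lemma derive2_rescale r c f i j : smooth f ->
  'D_(axis R j) ('D_(axis R i) (rescale r c f)) =
  fun q => r^-1 ^+ 2 * rescale r c ('D_(axis R j) ('D_(axis R i) f)) q.
Proof. by move=> sf; have := iter_partial_rescale r c [:: j; i] sf. Qed.

Lemma Lap_rescale r c f : smooth f ->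
  Lap (rescale r c f) = fun q => r^-1 ^+ 2 * rescale r c (Lap f) q.
Proof.
move=> sf; apply/funext => q; have E i := congr1 (@^~ q) (derive2_rescale r c i i sf).
rewrite [LHS](eq_bigr _ (fun i _ => E i)) -mulr_sumr; reflexivity.
Qed.

Lemma smooth_Lap f : smooth f -> smooth (Lap f).
Proof. by move=> sf; rewrite LapE; apply: smoothD; do 2 apply: smooth_partial. Qed.

End scaling.

Section bump_laplacian.
Variable R : realType.

Lemma is_derive_flat_affine n (a b x : R) :
  is_derive x 1 (fun t => flat n (a + b * t))
    (b * (- n%:R * flat n.+1 (a + b * x) + flat n.+2 (a + b * x))).
Proof.
have hg : is_derive x 1 (fun t : R => a + b * t) b.
  have h1 := is_deriveZ b (is_derive_id x (1 : R)).
  have h2 := is_deriveD (is_derive_cst a x (1 : R)) h1.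
  by apply: (is_derive_eq h2); rewrite add0r [_ *: _]mulr1.
have h := @is_derive1_comp R (flat n) _ x _ _ (flat_derive n (a + b * x)) hg.
by apply: (is_derive_eq h); rewrite mulrC.
Qed.

(** On []-1, 1[] this is [exp (- 1 / (1 + t) - 1 / (1 - t))], in the affine form of [rect_bump]. *)
Definition bump1 (t : R) := flat 0 (1 + 1 * t) * flat 0 (1 + (-1) * t).

Definition bump1' (t : R) := flat 2 (1 + 1 * t) * flat 0 (1 + (-1) * t)
  - flat 0 (1 + 1 * t) * flat 2 (1 + (-1) * t).

Definition bump1'' (t : R) :=
  (- 2%:R * flat 3 (1 + 1 * t) + flat 4 (1 + 1 * t)) * flat 0 (1 + (-1) * t)
  - 2%:R * flat 2 (1 + 1 * t) * flat 2 (1 + (-1) * t)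
  + flat 0 (1 + 1 * t) * (- 2%:R * flat 3 (1 + (-1) * t) + flat 4 (1 + (-1) * t)).

Lemma is_derive_bump1 (t : R) : is_derive t 1 bump1 (bump1' t).
Proof.
have h1 := is_derive_flat_affine 0 1 1 t; have h2 := is_derive_flat_affine 0 1 (-1) t.
have h := is_deriveM h1 h2; apply: (is_derive_eq h).
by rewrite /bump1' /GRing.scale/=; ring.
Qed.

Lemma is_derive_bump1' (t : R) : is_derive t 1 bump1' (bump1'' t).
Proof.
have h1 := is_derive_flat_affine 2 1 1 t; have h2 := is_derive_flat_affine 0 1 (-1) t.
have h3 := is_derive_flat_affine 0 1 1 t; have h4 := is_derive_flat_affine 2 1 (-1) t.
have h := is_deriveB (is_deriveM h1 h2) (is_deriveM h3 h4); apply: (is_derive_eq h).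
by rewrite /bump1'' /GRing.scale/=; ring.
Qed.

Lemma is_derive_fst (u w : R -> R) (q : R * R) (d : R) : is_derive q.1 1 u d ->
  is_derive q (axis R false) (fun p => u p.1 * w p.2) (d * w q.2).
Proof.
move=> H; apply: is_derive_line.
have H2 : is_derive (0 + 1 * q.1 : R) 1 u d by rewrite mul1r add0r.
have h := is_deriveZ (w q.2) (is_derive_affine 1 0 H2).
rewrite (_ : (fun _ => _) = w q.2 *: (fun h : R => u (0 + 1 * (1 * h + q.1)))).
  by apply: (is_derive_eq h); rewrite /GRing.scale/=; ring.
apply/funext => t /=; rewrite /GRing.scale/= mulr0 add0r mulrC; congr (_ * u _).
by ring.
Qed.

Lemma is_derive_snd (u w : R -> R) (q : R * R) (d : R) : is_derive q.2 1 w d ->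
  is_derive q (axis R true) (fun p => u p.1 * w p.2) (u q.1 * d).
Proof.
move=> H; apply: is_derive_line.
have H2 : is_derive (0 + 1 * q.2 : R) 1 w d by rewrite mul1r add0r.
have h := is_deriveZ (u q.1) (is_derive_affine 1 0 H2).
rewrite (_ : (fun _ => _) = u q.1 *: (fun h : R => w (0 + 1 * (1 * h + q.2)))).
  by apply: (is_derive_eq h); rewrite /GRing.scale/=; ring.
apply/funext => t /=; rewrite /GRing.scale/= mulr0 add0r; congr (_ * w _).
by ring.
Qed.

Definition base_bump : R * R -> R := rect_bump (-1) 1 (-1) 1.

Lemma bumpE : base_bump = fun q => bump1 q.1 * bump1 q.2.
Proof. by apply/funext => q; rewrite /base_bump /rect_bump /bump1 !opprK. Qed.

Lemma smooth_bump : smooth base_bump.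
Proof. by apply: flat_class_smooth; exact: rect_bump_class. Qed.

Lemma Lap_bumpE : Lap base_bump = fun q => bump1 q.1 * bump1'' q.2 + bump1'' q.1 * bump1 q.2.
Proof.
have E1 : 'D_(axis R false) base_bump = fun q => bump1' q.1 * bump1 q.2.
  apply/funext => q; rewrite bumpE; apply: derive_val; apply: is_derive_fst; exact: is_derive_bump1.
have E2 : 'D_(axis R true) base_bump = fun q => bump1 q.1 * bump1' q.2.
  apply/funext => q; rewrite bumpE; apply: derive_val; apply: is_derive_snd; exact: is_derive_bump1.
have A q : 'D_(axis R true) ('D_(axis R true) base_bump) q = bump1 q.1 * bump1'' q.2.
  by rewrite E2; apply: derive_val; apply: is_derive_snd; exact: is_derive_bump1'.
have B q : 'D_(axis R false) ('D_(axis R false) base_bump) q = bump1'' q.1 * bump1 q.2.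
  by rewrite E1; apply: derive_val; apply: is_derive_fst; exact: is_derive_bump1'.
apply/funext => q; apply: (etrans (congr1 (@^~ q) (LapE base_bump))).
exact: (congr2 +%R (A q) (B q)).
Qed.

(** A point with nonzero Laplacian is wanted. At the centre every [flat n] equals [e = exp (-1)], so
    [bump1 = e ^ 2] and [bump1'' = - 4 * e ^ 2], which gives [- 8 * e ^ 4]. *)
Lemma Lap_bump0 : Lap base_bump 0 < 0.
Proof.
have F n : flat n (1 + 1 * 0 : R) = expR (-1).
  by rewrite mulr0 addr0 /flat ltr01 invr1 expr1n mul1r.
have G n : flat n (1 + (-1) * 0 : R) = expR (-1).
  by rewrite mulr0 addr0 /flat ltr01 invr1 expr1n mul1r.
rewrite Lap_bumpE /bump1 /bump1'' /= !F !G.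
set e := expR (-1); have e0 : 0 < e by exact: expR_gt0.
have e4 : 0 < e ^+ 4 by rewrite exprn_gt0.
rewrite [ltLHS](_ : _ = - (8%:R * e ^+ 4)); first by rewrite oppr_lt0 mulr_gt0.
by ring.
Qed.

Lemma Lap_bump_lower : exists2 k : R * R, 0 < k.1 /\ 0 < k.2 <= 1 & forall q : R * R,
  `|q.1| <= k.2 -> `|q.2| <= k.2 -> k.1 <= Lap base_bump q ^+ 2.
Proof.
have key (x y : R) : `|y - x| < (- y) / 2 -> y < 0 -> ((- y) / 2) ^+ 2 <= x ^+ 2.
  rewrite ltr_norml => /andP[h3 h4] y0.
  by rewrite -[leRHS]sqrrN ler_sqr ?nnegrE; lra.
have cL := smooth_continuous (smooth_Lap smooth_bump).
have L0 := Lap_bump0; pose m := - Lap base_bump 0.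
have m0 : 0 < m / 2 by rewrite divr_gt0// oppr_gt0.
have /cvgrPdist_lt /(_ _ m0) /nbhs_ballP[d /= d0 Hd] := cL 0.
exists ((m / 2) ^+ 2, Num.min (d / 2) 1) => /=.
  split; first by rewrite exprn_gt0.
  by rewrite lt_min divr_gt0//= ltr01 ge_min lexx orbT.
move=> q; rewrite !le_min => /andP[h1 _] /andP[h2 _].
have : `|Lap base_bump 0 - Lap base_bump q| < m / 2.
  apply: Hd; apply/ball_planeP => /=; rewrite !sub0r !normrN.
  by split; apply: le_lt_trans; [exact: h1|lra|exact: h2|lra].
by move=> h; exact: key.
Qed.

Lemma test_real_bump_bound (w : seq bool) : exists2 M : R, 0 <= M & forall q, `|iter_partial base_bump w q| <= M.
Proof.
have t : test_real setT base_bump.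
  split; first exact: smooth_bump.
  exists (closed_rect (-1) 1 (-1) 1); split => // [|q nq]; first exact: compact_closed_rect.
  apply: rect_bump_eq0; apply/negP => /andP[/andP[? ?] /andP[? ?]]; apply: nq.
  by rewrite /closed_rect/= !ltW.
have tw : test_real setT (iter_partial base_bump w).
  by elim: w => [|i w IH] //=; exact: test_real_partial.
have [M HM] := test_real_bounded tw.
by exists M => //; exact: le_trans (normr_ge0 _) (HM 0).
Qed.

End bump_laplacian.

(** * Disjoint squares accumulating at a boundary point *)

Section boundary_sequence.
Variable R : realType.
Implicit Types (Omega D : set (R * R)).

Definition closed_square (c : R * R) (r : R) : set (R * R) :=
  closed_rect (c.1 - r) (c.1 + r) (c.2 - r) (c.2 + r).

Lemma closed_squareP c r p : closed_square c r p <-> `|p.1 - c.1| <= r /\ `|p.2 - c.2| <= r.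
Proof. by rewrite /closed_square /closed_rect/= !ler_distl; split => [/andP|/andP]. Qed.

(** From a point of [Omega] one moves right up to the first exit, at a finite [b] as [Omega] is
    bounded; if [(b, y0)] were in [Omega], openness would push the exit further. *)
Lemma boundary_segment Omega : bounded_domain Omega -> exists x0 y0 b : R,
  [/\ x0 < b, forall s : R, x0 <= s < b -> Omega (s, y0) & ~ Omega (b, y0)].
Proof.
move=> [oO _ [[x0 y0] O0] [M [_ HM]]].
have op (s : R) : Omega (s, y0) -> exists2 e : R, 0 < e & forall s' : R, `|s - s'| < e -> Omega (s', y0).
  move=> Os; have /nbhs_ballP[e /= e0 He] : nbhs (s, y0) Omega by exact: open_nbhs_nbhs.
  by exists e => // s' ss'; apply: He; apply/ball_planeP; split => //=; rewrite subrr normr0.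
pose E := [set b : R | x0 < b /\ forall s : R, x0 <= s < b -> Omega (s, y0)].
have [e e0 He] := op _ O0.
have E0 : E (x0 + e).
  split; first by rewrite ltrDl.
  by move=> s /andP[h1 h2]; apply: He; rewrite distrC ger0_norm ?subr_ge0//; lra.
have Eub : ubound E (`|M| + 1).
  move=> c [xc Hc]; rewrite leNgt; apply/negP => Mc.
  pose s := Num.max x0 ((`|M| + 1 + c) / 2).
  have : Omega (s, y0).
    apply: Hc; rewrite le_max lexx/= gt_max xc/=; lra.
  move=> /(HM (`|M| + 1 / 2)); rewrite (le_lt_trans (ler_norm M)) ?ltrDl ?divr_gt0// => /(_ erefl).
  rewrite /= prod_normE ge_max => /andP[/= h _].
  have h2 : s <= `|M| + 1 / 2 by exact: le_trans (ler_norm _) h.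
  by move: h2; rewrite ge_max => /andP[_ h3]; lra.
have hE : has_sup E by split; [exists (x0 + e)|exists (`|M| + 1)].
exists x0, y0, (sup E); split.
- by apply: (@lt_le_trans _ _ (x0 + e)); [rewrite ltrDl|exact: sup_upper_bound].
- move=> s /andP[h1 h2]; have [c [xc Hc] sc] := sup_gt hE.1 h2.
  by apply: Hc; rewrite h1.
move=> Ob; have [d d0 Hd] := op _ Ob.
have xs : x0 < sup E.
  by apply: (@lt_le_trans _ _ (x0 + e)); [rewrite ltrDl|exact: sup_upper_bound].
have : E (sup E + d).
  split; first by rewrite (lt_trans xs)// ltrDl.
  move=> s /andP[h1 h2]; have [h|h] := ltP s (sup E).
    by have [c [xc Hc] sc] := sup_gt hE.1 h; apply: Hc; rewrite h1.
  by apply: Hd; rewrite distrC ger0_norm ?subr_ge0//; lra.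
by move=> /(sup_upper_bound hE); lra.
Qed.

(** The centres lie on the segment at dyadic distances [d k] from its end [(b, y0)]. The squares
    shrink to that point, which is not in [Omega], and so leave every compact subset. *)
Lemma boundary_squares Omega : bounded_domain Omega ->
  exists (c : nat -> R * R) (r : nat -> R),
  [/\ forall k, 0 < r k <= 1, forall k, closed_square (c k) (r k) `<=` Omega,
    forall p j k, closed_square (c j) (r j) p -> closed_square (c k) (r k) p -> j = k,
    forall D, compact D -> D `<=` Omega -> exists N : nat, forall k, (N <= k)%N ->
      forall p, closed_square (c k) (r k) p -> ~ D p &
    forall e : R, 0 < e -> exists N : nat, forall k, (N <= k)%N -> r k < e].
Proof.
move=> bO; have [oO _ _ _] := bO.
have [x0 [y0 [b [xb Hs Ob]]]] := boundary_segment bO.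
pose d (k : nat) : R := (b - x0) / 2 ^+ k.
have dS k : d k.+1 = d k / 2 by rewrite /d exprS; field; rewrite expf_neq0.
have d0 k : 0 < d k by rewrite divr_gt0 ?subr_gt0 ?exprn_gt0.
have dle k n : d (k + n)%N <= d k.
  elim: n => [|n IH]; first by rewrite addn0.
  by rewrite addnS dS; have := d0 (k + n)%N; lra.
have dle' j k : (j <= k)%N -> d k <= d j by move=> /subnKC <-.
have dx k : x0 <= b - d k < b.
  have h : d k <= d 0%N by exact: dle'.
  have e0 : d 0%N = b - x0 by rewrite /d expr0 divr1.
  by have := d0 k; lra.
have dsmall (e : R) : 0 < e -> exists N : nat, d N < e.
  exact: half_pow_small.
have /choice[r Hr] (k : nat) : exists r : R, [/\ 0 < r, r <= 1, r <= d k / 4 &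
    closed_square (b - d k, y0) r `<=` Omega].
  have /nbhs_ballP[e /= e0 He] : nbhs (b - d k, y0) Omega.
    by apply: open_nbhs_nbhs; split => //; apply: Hs; exact: dx.
  (* [e / 2] keeps the square inside [Omega], [d k / 4] separates the squares, and the bound 1 later
     gives [r ^ 2 <= r]. *)
  exists (Num.min (e / 2) (Num.min 1 (d k / 4))); split.
  - by rewrite !lt_min ltr01 (divr_gt0 e0)// (divr_gt0 (d0 k)).
  - by rewrite !ge_min lexx !orbT.
  - by rewrite !ge_min lexx !orbT.
  move=> p /closed_squareP[/= h1 h2]; apply: He; apply/ball_planeP => /=.
  rewrite !le_min in h1 h2; move: h1 h2 => /andP[h1 _] /andP[h2 _].
  by rewrite distrC [`|y0 - _|]distrC; split; lra.
exists (fun k => (b - d k, y0)), r.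
(* Disjointness follows since [d k.+1 = d k / 2] and [5 / 8 < 3 / 4]. *)
have pos k p : closed_square (b - d k, y0) (r k) p -> d k * (3 / 4) <= b - p.1 <= d k * (5 / 4).
  move=> /closed_squareP[/= h _]; have [_ _ h2 _] := Hr k; move: h; rewrite ler_distl => /andP[h3 h4].
  by apply/andP; split; lra.
split.
- by move=> k; have [-> -> _ _] := Hr k.
- by move=> k; have [_ _ _ h] := Hr k.
- have aux p j k : (j < k)%N -> closed_square (b - d j, y0) (r j) p -> ~ closed_square (b - d k, y0) (r k) p.
    move=> jk /pos /andP[h1 _] /pos /andP[_ h2].
    have := dle' _ _ jk; rewrite dS; have := d0 j; lra.
  move=> p j k hj hk; have [jk|kj|//] := ltngtP j k; first by have := aux _ _ _ jk hj.
  by have := aux _ _ _ kj hk.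
- move=> D cD DO.
  have oD : open (~` D).
    by apply: closed_openC; apply: compact_closed => //; exact: plane_hausdorff.
  have nD : ~ D (b, y0) by move=> /DO.
  have /nbhs_ballP[e /= e0 He] : nbhs (b, y0) (~` D) by exact: open_nbhs_nbhs.
  have [N HN] := dsmall (e / 2) (divr_gt0 e0 (ltr0n _ 2)).
  exists N => k Nk p hp; apply: He; apply/ball_planeP => /=.
  have /andP[h1 h2] := pos _ _ hp; have := dle' _ _ Nk; have := d0 k => dk dN.
  have /closed_squareP[/= _ h3] := hp; have [_ _ h4 _] := Hr k.
  rewrite [`|y0 - _|]distrC ger0_norm; last by lra.
  by split; lra.
- move=> e e0; have [N HN] := dsmall e e0; exists N => k Nk.
  have [_ _ h4 _] := Hr k; have := dle' _ _ Nk; have := d0 k; lra.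
Qed.

End boundary_sequence.

(** * Gluing a locally finite family with disjoint supports *)

Section gluing.
Variables (R : realType) (Omega : set (R * R)) (S : nat -> set (R * R)).
Notation mR := (measurableTypeR R).
Notation mu2 := (leb2 R).
Notation sqi := (sq_integrable mu2 Omega).
Hypotheses (oO : open Omega) (Ooo : (mu2 Omega < +oo)%E)
  (cS : forall k, compact (S k)) (SO : forall k, S k `<=` Omega)
  (dS : forall p j k, S j p -> S k p -> j = k)
  (fS : forall D, compact D -> D `<=` Omega -> exists N : nat, forall k, (N <= k)%N ->
      forall p, S k p -> ~ D p).
Implicit Types (F : nat -> R * R -> R) (eta : R * R -> R).

Let mO : measurable (Omega : set (mR * mR)) := open_measurable_plane oO.

Definition supported F := forall k p, ~ S k p -> F k p = 0.

(* Off all the [S k] the default index [0] is harmless for a [supported] family. *)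
Definition dglue F p : R := F (xget 0%N [set k | S k p]) p.

Lemma dglueE F k p : S k p -> dglue F p = F k p.
Proof.
move=> Sp; have h := xgetPex 0%N (ex_intro (fun k => S k p) k Sp).
by rewrite /dglue; congr F; exact: dS h Sp.
Qed.

Lemma dglue_out F p : supported F -> (forall k, ~ S k p) -> dglue F p = 0.
Proof. by move=> sF np; exact: sF. Qed.

(** On a compact subset of [Omega] one [N] serves all points by [fS], so the glued function is there
    a finite sum of smooth functions. *)
Lemma dglue_sum F N p : supported F -> (forall k, (N <= k)%N -> ~ S k p) ->
  dglue F p = \sum_(k < N) F k p.
Proof.
move=> sF np; have [[j Sj]|nS] := pselect (exists j, S j p).
  have jN : (j < N)%N by rewrite ltnNge; apply/negP => /np.
  rewrite (dglueE _ Sj) (bigD1 (Ordinal jN))//= big1 ?addr0// => i ij.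
  by apply: sF => Si; move: ij; rewrite -val_eqE/= (dS Si Sj) eqxx.
rewrite dglue_out//; last by move=> k Sk; apply: nS; exists k.
by rewrite big1// => i _; apply: sF => Si; apply: nS; exists i.
Qed.

Lemma dglue_measurable F : supported F -> (forall k, continuous (F k)) ->
  measurable_fun (Omega : set (mR * mR)) (dglue F : mR * mR -> mR).
Proof.
move=> sF cF; apply: (@measurable_fun_cvg _ _ _ _ (fun n p => \sum_(k < n) F k p)) => [n|p Op].
  by apply: measurable_sum => k; apply: measurable_funTS; exact: continuous_measurable_plane.
have [N HN] : exists N : nat, forall k, (N <= k)%N -> forall q, S k q -> ~ [set p] q.
  by apply: fS; [exact: compact_set1|move=> q ->].
apply: cvg_near_cst; exists N => // n /= Nn; apply/esym/dglue_sum => // k nk Sk.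
exact: (HN k (leq_trans Nn nk) p Sk).
Qed.

Lemma dglue_sqi F (M : R) : supported F -> (forall k, continuous (F k)) ->
  (forall k p, `|F k p| <= M) -> sqi (dglue F).
Proof.
move=> sF cF bF; apply: (@bounded_sq_integrable _ _ _ M) => //; first exact: dglue_measurable.
by move=> p _; exact: bF.
Qed.

Lemma sqi0 : sqi (fun=> 0).
Proof. by have /(inL2P oO)[] := inL2_0 oO Ooo. Qed.

Lemma inL2_real (h : R * R -> R) : sqi h -> inL2 Omega (fun p => (h p)%:C).
Proof. by move=> hh; apply/(inL2P oO); split => //=; exact: sqi0. Qed.

Lemma supported_partial F i : supported F -> supported (fun k => 'D_(axis R i) (F k)).
Proof. by move=> sF k p np; have h := zero_off_derive i (@cS k) (sF k) np; exact: h. Qed.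

(** The support of [eta] meets finitely many pieces only, so classical integration by parts for a
    finite sum suffices. *)
Lemma dglue_ibp F i eta : (forall k, smooth (F k)) -> supported F -> test_real Omega eta ->
  \int[mu2]_(p in Omega) (dglue F p * 'D_(axis R i) eta p) =
  - \int[mu2]_(p in Omega) (dglue (fun k => 'D_(axis R i) (F k)) p * eta p).
Proof.
move=> smF sF te; have [se [D [cD DO e0]]] := te.
have d0 := zero_off_derive i cD e0.
have [N HN] := fS cD DO.
have sF' : supported (fun k => 'D_(axis R i) (F k)).
  exact: supported_partial.
have ssum : smooth (fun p => \sum_(k < N) F k p) by exact: (smooth_sum (index_enum 'I_N) (fun k : 'I_N => smF k)).
have E (H : nat -> R * R -> R) (g : R * R -> R) : supported H -> (forall p, ~ D p -> g p = 0) ->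
    \int[mu2]_(p in Omega) (dglue H p * g p) =
    \int[mu2]_(p in Omega) ((\sum_(k < N) H k p) * g p).
  move=> sH g0; apply: eq_Rintegral => p _.
  have [Dp|nD] := pselect (D p); last by rewrite g0// !mulr0.
  by rewrite (dglue_sum (N := N))// => k Nk Sk; exact: (HN k Nk p Sk).
rewrite !E// (integration_by_parts_plane i mO ssum te); congr (- _).
apply: eq_Rintegral => p _; congr (_ * _).
have h : is_derive p (axis R i) (\sum_(k < N) F k) (\sum_(k < N) 'D_(axis R i) (F k) p).
  apply: is_derive_sum => k; apply: derivableP; exact: smooth_derivable i p (smF k).
rewrite -(@derive_val _ _ _ _ _ _ _ h); congr ('D__ _ _).
by apply/funext => q; rewrite fct_sumE.
Qed.

Lemma dglue_weak_partial F (M M' : R) i : (forall k, smooth (F k)) -> supported F ->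
  (forall k p, `|F k p| <= M) -> (forall k p, `|'D_(axis R i) (F k) p| <= M') ->
  [/\ inL2 Omega (fun p => (dglue F p)%:C),
    inL2 Omega (fun p => (dglue (fun k => 'D_(axis R i) (F k)) p)%:C) &
    weak_partial Omega i (fun p => (dglue F p)%:C)
      (fun p => (dglue (fun k => 'D_(axis R i) (F k)) p)%:C)].
Proof.
move=> smF sF bF bF'.
have sF' : supported (fun k => 'D_(axis R i) (F k)).
  exact: supported_partial.
have i1 : inL2 Omega (fun p => (dglue F p)%:C).
  by apply: inL2_real; apply: dglue_sqi bF => // k; exact: smooth_continuous.
have i2 : inL2 Omega (fun p => (dglue (fun k => 'D_(axis R i) (F k)) p)%:C).
  apply: inL2_real; apply: dglue_sqi bF' => // k; apply: smooth_continuous.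
  exact: smooth_partial.
split => //; apply: weak_partial_of_parts => // eta te /=; first exact: dglue_ibp.
by under eq_Rintegral do rewrite mul0r; under [in RHS]eq_Rintegral do rewrite mul0r; rewrite Rintegral_cst// mul0r oppr0.
Qed.

Lemma dglue_inH1 F (M : R) : (forall k, smooth (F k)) -> supported F ->
  (forall k p, `|F k p| <= M) -> (forall i k p, `|'D_(axis R i) (F k) p| <= M) ->
  inH1 Omega (fun p => (dglue F p)%:C).
Proof.
move=> smF sF bF bF'; split => [|i].
  by have [h _ _] := dglue_weak_partial smF sF bF (bF' true).
have [h1 h2 h3] := dglue_weak_partial smF sF bF (bF' i).
by exists (fun p => (dglue (fun k => 'D_(axis R i) (F k)) p)%:C); split.
Qed.

Lemma dglue_wD_ae F (M : R) i : (forall k, smooth (F k)) -> supported F ->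
  (forall k p, `|F k p| <= M) -> (forall i k p, `|'D_(axis R i) (F k) p| <= M) ->
  ae_eq_on Omega (wD Omega i (fun p => (dglue F p)%:C))
    (fun p => (dglue (fun k => 'D_(axis R i) (F k)) p)%:C).
Proof.
move=> smF sF bF bF'; have [h1 h2 h3] := dglue_weak_partial smF sF bF (bF' i).
exact: wD_ae oO Ooo _ _ _ h2 h3 (dglue_inH1 smF sF bF bF').
Qed.

Lemma dglue_inH2 F (M : R) : (forall k, smooth (F k)) -> supported F ->
  (forall k p, `|F k p| <= M) -> (forall i k p, `|'D_(axis R i) (F k) p| <= M) ->
  (forall i j k p, `|'D_(axis R j) ('D_(axis R i) (F k)) p| <= M) ->
  inH2 Omega (fun p => (dglue F p)%:C).
Proof.
move=> smF sF b0 b1 b2; have H1 := dglue_inH1 smF sF b0 b1; split; [exact: H1|move=> i].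
have H2 : inH1 Omega (fun p => (dglue (fun k => 'D_(axis R i) (F k)) p)%:C).
  apply: (@dglue_inH1 (fun k => 'D_(axis R i) (F k)) M).
  - by move=> k; exact: smooth_partial.
  - exact: supported_partial.
  - exact: b1.
  - by move=> j; exact: b2.
have [a1 w1] := wD_spec i H1; apply: (inH1_ae oO Ooo a1) H2.
by have := dglue_wD_ae i smF sF b0 b1; apply: ae_plane_mono => p /= h Op; rewrite h.
Qed.

Lemma L2norm_ae f g : inL2 Omega f -> inL2 Omega g -> ae_eq_on Omega f g ->
  L2norm Omega f = L2norm Omega g.
Proof.
move=> hf hg H; rewrite /L2norm; congr Num.sqrt; rewrite /Rintegral; congr fine.
have m (k : planefun R) : inL2 Omega k -> measurable_fun (Omega : set (mR * mR)) (fun p : mR * mR => (cmod (k p) ^+ 2)%:E).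
  move=> /(inL2P oO)[[m1 _] [m2 _]]; apply/measurable_EFinP.
  under eq_fun do rewrite cmod_sq.
  by apply: measurable_funD; exact: measurable_funX.
apply: ae_eq_integral => //; [exact: m|exact: m|].
by apply: ae_plane_mono H => p /= h Op; rewrite h.
Qed.

Lemma L2norm_real_le (h : R * R -> R) (e : R) : 0 <= e -> sqi h -> (forall p, `|h p| <= e) ->
  L2norm Omega (fun p => (h p)%:C) <= e * Num.sqrt (fine (mu2 Omega)).
Proof.
move=> e0 [mh ih] he; rewrite -[e in leRHS](ger0_norm e0) -sqrtr_sqr -sqrtrM ?sqr_ge0//.
rewrite ler_wsqrtr// -Rintegral_cst//.
have E p : cmod ((h p)%:C) ^+ 2 = h p ^+ 2 by rewrite cmod_sq/= expr0n addr0.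
under eq_Rintegral do rewrite E.
apply: le_Rintegral => //.
  by apply: (bounded_integrable mO Ooo (M := e ^+ 2)) => // p _; rewrite ger0_norm ?sqr_ge0.
by move=> p _; rewrite -[h p ^+ 2]real_normK ?num_real// lerXn2r ?nnegrE.
Qed.

Lemma dglue_H1norm_le F (e : R) : 0 <= e -> (forall k, smooth (F k)) -> supported F ->
  (forall k p, `|F k p| <= e) -> (forall i k p, `|'D_(axis R i) (F k) p| <= e) ->
  H1norm Omega (fun p => (dglue F p)%:C) <= 2 * (e * Num.sqrt (fine (mu2 Omega))).
Proof.
move=> e0 smF sF b0 b1; have H1 := dglue_inH1 smF sF b0 b1.
set s := e * Num.sqrt _; have s0 : 0 <= s by rewrite mulr_ge0 ?sqrtr_ge0.
have h0 : L2norm Omega (fun p => (dglue F p)%:C) <= s.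
  apply: L2norm_real_le => //; first by apply: dglue_sqi b0 => // k; exact: smooth_continuous.
  by move=> p; exact: b0.
have h1 i : L2norm Omega (wD Omega i (fun p => (dglue F p)%:C)) <= s.
  have [a1 _] := wD_spec i H1; have [a2 a3 _] := dglue_weak_partial smF sF b0 (b1 i).
  rewrite (L2norm_ae a1 a3 (dglue_wD_ae i smF sF b0 b1)).
  apply: L2norm_real_le => //; last by move=> p; exact: b1.
  apply: dglue_sqi (b1 i) => [|k]; first exact: supported_partial.
  by apply: smooth_continuous; exact: smooth_partial.
(* The function and its two partial derivatives contribute three terms, bounded by four. *)
have key (a b c t : R) : a <= t ^+ 2 -> b <= t ^+ 2 -> c <= t ^+ 2 -> a + (b + c) <= (2 * t) ^+ 2.
  by move=> ? ? ?; rewrite exprMn; have := sqr_ge0 t; lra.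
have sq (a : R) : 0 <= a -> a <= s -> a ^+ 2 <= s ^+ 2 by move=> a0 as'; rewrite lerXn2r.
rewrite -[leRHS](ger0_norm (mulr_ge0 _ s0))// -sqrtr_sqr ler_wsqrtr// big_bool/=.
have k0 := sq _ (L2norm_ge0 _ _) h0; have k1 := sq _ (L2norm_ge0 _ _) (h1 true).
have k2 := sq _ (L2norm_ge0 _ _) (h1 false).
exact: key k0 k1 k2.
Qed.

(** The partial sums are test functions. What remains is again glued, from the family [F'] with its
    first [N] members replaced by zero, and [dglue_H1norm_le] applies to it. *)
Lemma dglue_inH10 F (M : R) : (forall k, smooth (F k)) -> supported F ->
  (forall k p, `|F k p| <= M) -> (forall i k p, `|'D_(axis R i) (F k) p| <= M) ->
  (forall e : R, 0 < e -> exists N : nat, forall k, (N <= k)%N ->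
     (forall p, `|F k p| <= e) /\ forall i p, `|'D_(axis R i) (F k) p| <= e) ->
  inH10 Omega (fun p => (dglue F p)%:C).
Proof.
move=> smF sF b0 b1 small; split; first exact: dglue_inH1 b0 b1.
move=> e e0; set s := Num.sqrt (fine (mu2 Omega)).
have s0 : 0 <= s by exact: sqrtr_ge0.
pose d := e / (2 * s + 1); have d0 : 0 < d by rewrite divr_gt0// ltr_wpDl// mulr_ge0.
have [N HN] := small d d0.
pose F' k : R * R -> R := if (k < N)%N then (fun=> 0) else F k.
have smF' k : smooth (F' k) by rewrite /F'; case: ifP => _ //; exact: smooth_cst.
have sF' : supported F' by move=> k p np; rewrite /F'; case: ifP => // _; exact: sF.
have b0' k p : `|F' k p| <= d.
  by rewrite /F'; case: ltnP => [_|/HN[]//]; rewrite normr0 ltW.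
have b1' i k p : `|'D_(axis R i) (F' k) p| <= d.
  by rewrite /F'; case: ltnP => [_|/HN[_ h]]; [|exact: h];
    rewrite (_ : 'D_(axis R i) _ p = 0); [rewrite normr0 ltW|exact: derive_cst].
exists (fun p => (\sum_(k < N) F k p)%:C); split.
  apply: test_function_real; split; first by apply: smooth_sum => k; exact: smF.
  exists (\big[setU/set0]_(k < N) S k); split.
  - by elim/big_ind: _ => //; [exact: compact0|exact: compactU].
  - by rewrite -bigcup_mkord => p [k _ Sk]; exact: SO Sk.
  - move=> p; rewrite -bigcup_mkord => np; rewrite big1// => k _; apply: sF => Sk.
    by apply: np; exists k => /=.
rewrite (_ : (fun p => _) = (fun p => (dglue F' p)%:C)); last first.
  apply/funext => p; rewrite -raddfB/=; congr (_%:C).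
  have [[j Sj]|nS] := pselect (exists j, S j p); last first.
    have nS' k : ~ S k p by move=> Sk; apply: nS; exists k.
    by rewrite !dglue_out// big1 ?subr0// => i _; exact: sF.
  rewrite !(dglueE _ Sj) /F'; case: ltnP => [jN|Nj].
    rewrite (bigD1 (Ordinal jN))//= big1 ?addr0 ?subrr// => i ij.
    by apply: sF => Si; move: ij; rewrite -val_eqE/= (dS Si Sj) eqxx.
  rewrite big1 ?subr0// => i _; apply: sF => Si; have := ltn_ord i.
  by rewrite (dS Si Sj) ltnNge Nj.
apply: le_lt_trans (dglue_H1norm_le (ltW d0) smF' sF' b0' b1') _.
have t0 : 2 * s + 1 != 0 by rewrite gt_eqF// ltr_wpDl// mulr_ge0.
have h : d * (2 * s + 1) = e by rewrite /d divfK.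
by rewrite -[ltRHS]h mulrDr mulr1 -/s mulrCA ltrDl.
Qed.

End gluing.

Section square_bumps.
Variables (R : realType) (Omega : set (R * R)).
Notation mR := (measurableTypeR R).
Notation mu2 := (leb2 R).
Hypotheses (oO : open Omega) (Ooo : (mu2 Omega < +oo)%E).
Implicit Types (c : R * R) (r : R) (h f eta : R * R -> R).

Let mO : measurable (Omega : set (mR * mR)) := open_measurable_plane oO.

Lemma measure_square c r : 0 <= r -> mu2 (closed_square c r) = ((2 * r) ^+ 2)%:E.
Proof.
move=> r0; rewrite /closed_square closed_rectE measure_rect; [|lra|lra].
by congr (_%:E); ring.
Qed.

Lemma measurable_square c r : measurable (closed_square c r : set (mR * mR)).
Proof. exact: measurable_closed_rect. Qed.

Lemma integral_cst_square c r (C : R) : 0 <= r -> closed_square c r `<=` Omega ->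
  \int[mu2]_(p in Omega) (C * \1_(closed_square c r) p) = C * (2 * r) ^+ 2.
Proof.
move=> r0 sO; rewrite -(Rintegral_indic_subset (fun=> C) sO).
rewrite Rintegral_cst; last exact: measurable_square.
by congr (_ * _); exact: (congr1 fine (measure_square c r0)).
Qed.

Lemma integrable_cst_square c r (C : R) :
  mu2.-integrable Omega (EFin \o (fun p => C * \1_(closed_square c r) p)).
Proof.
apply: (bounded_integrable mO Ooo (M := `|C|)).
  apply: measurable_funM; first exact: measurable_cst.
  by apply: measurable_indic; exact: measurable_square.
move=> p _; rewrite normrM ler_piMr// indicE.
by case: (_ \in _); rewrite ?normr0 ?normr1.
Qed.

Lemma square_integral_le c r h (C : R) : 0 <= r -> closed_square c r `<=` Omega -> continuous h ->
  (forall p, `|h p| <= C) -> (forall p, ~ closed_square c r p -> h p = 0) ->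
  `|\int[mu2]_(p in Omega) h p| <= C * (2 * r) ^+ 2.
Proof.
move=> r0 sO ch hC h0.
have mh : measurable_fun (Omega : set (mR * mR)) (h : mR * mR -> mR).
  by apply: measurable_funTS; exact: continuous_measurable_plane.
have ih : mu2.-integrable Omega (EFin \o h) by apply: (bounded_integrable mO Ooo mh (M := C)) => p _.
apply: le_trans (le_normr_Rintegral mO ih) _.
rewrite -(integral_cst_square C r0 sO); apply: le_Rintegral => //.
- by have j := integrable_norm ih; exact: j.
- exact: integrable_cst_square.
move=> p _; rewrite indicE; case: (boolP (p \in _)) => [_|/negP np]; first by rewrite mulr1.
by rewrite mulr0 h0 ?normr0// => sp; apply: np; exact/mem_set.
Qed.

Lemma square_integral_ge c r h (C : R) : 0 <= r -> closed_square c r `<=` Omega ->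
  mu2.-integrable Omega (EFin \o h) ->
  (forall p, 0 <= h p) -> (forall p, closed_square c r p -> C <= h p) ->
  C * (2 * r) ^+ 2 <= \int[mu2]_(p in Omega) h p.
Proof.
move=> r0 sO ih h0 hC; rewrite -(integral_cst_square C r0 sO); apply: le_Rintegral => //.
  exact: integrable_cst_square.
move=> p _; rewrite indicE; case: (boolP (p \in _)) => [sp|_]; last by rewrite mulr0.
by rewrite mulr1; apply: hC; exact: set_mem.
Qed.

Lemma Lap_symmetric f eta : test_real Omega f -> test_real Omega eta ->
  \int[mu2]_(p in Omega) (f p * Lap eta p) = \int[mu2]_(p in Omega) (Lap f p * eta p).
Proof.
move=> tf te.
have int (u v : R * R -> R) : test_real Omega u -> test_real Omega v ->
    mu2.-integrable Omega (EFin \o (fun p => u p * v p)).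
  move=> tu tv; have j := sq_integrableM mO (test_sqi oO Ooo tu) (test_sqi oO Ooo tv); exact: j.
have tD i (g : R * R -> R) : test_real Omega g -> test_real Omega ('D_(axis R i) g).
  exact: test_real_partial.
have E i : \int[mu2]_(p in Omega) (f p * 'D_(axis R i) ('D_(axis R i) eta) p) =
    \int[mu2]_(p in Omega) ('D_(axis R i) ('D_(axis R i) f) p * eta p).
  rewrite (integration_by_parts_plane i mO tf.1 (tD i _ te)).
  by rewrite (integration_by_parts_plane i mO (tD i _ tf).1 te) opprK.
have L g p : Lap g p = 'D_(axis R true) ('D_(axis R true) g) p + 'D_(axis R false) ('D_(axis R false) g) p.
  exact: (congr1 (@^~ p) (LapE g)).
under eq_Rintegral do rewrite L mulrDr.
under [in RHS]eq_Rintegral do rewrite L mulrDl.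
have i1 i := int _ _ tf (tD i _ (tD i _ te)); have i2 i := int _ _ (tD i _ (tD i _ tf)) te.
have A1 := RintegralD mO (i1 true) (i1 false); have A2 := RintegralD mO (i2 true) (i2 false).
apply: (etrans A1); apply: etrans (esym A2).
exact: (congr2 +%R (E true) (E false)).
Qed.

End square_bumps.

Section bumps.
Variable R : realType.
Implicit Types (c : R * R) (r : R).

Definition zeta c r : R * R -> R := rescale r c (@base_bump R).

Lemma smooth_zeta c r : smooth (zeta c r).
Proof. by apply: smooth_rescale; exact: smooth_bump. Qed.

Lemma zeta_off c r p : 0 < r -> ~ closed_square c r p -> zeta c r p = 0.
Proof.
move=> r0 np; apply: rect_bump_eq0; apply/negP => /andP[/= h1 h2]; apply: np.
apply/closed_squareP; rewrite -!ltr_norml in h1 h2.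
have rV : `|r^-1| = r^-1 by rewrite gtr0_norm ?invr_gt0.
rewrite /GRing.scale/= !normrM rV in h1 h2.
rewrite mulrC ltr_pdivrMr// mul1r in h1; rewrite mulrC ltr_pdivrMr// mul1r in h2.
by split; exact: ltW.
Qed.

Lemma compact_square c r : compact (closed_square c r). Proof. exact: compact_closed_rect. Qed.

Lemma test_real_zeta (A : set (R * R)) c r : 0 < r -> closed_square c r `<=` A -> test_real A (zeta c r).
Proof.
move=> r0 sA; split; first exact: smooth_zeta.
by exists (closed_square c r); split => //; [exact: compact_square|move=> p; exact: zeta_off].
Qed.

Lemma Lap_off (f : R * R -> R) (D : set (R * R)) : compact D -> (forall p, ~ D p -> f p = 0) ->
  forall p, ~ D p -> Lap f p = 0.
Proof.
move=> cD f0 p np; rewrite /Lap big1// => i _.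
by have h := zero_off_derive i cD (zero_off_derive i cD f0) np; exact: h.
Qed.

Lemma zeta_bounds : exists2 M : R, 0 < M & forall c r, 0 < r -> forall p,
  [/\ `|zeta c r p| <= M, forall i, `|'D_(axis R i) (zeta c r) p| <= M / r,
    forall i j, `|'D_(axis R j) ('D_(axis R i) (zeta c r)) p| <= M / r ^+ 2 &
    `|Lap (zeta c r) p| <= M / r ^+ 2].
Proof.
have /choice[B HB] (w : seq bool) : exists M : R, 0 <= M /\
    forall q, `|iter_partial (@base_bump R) w q| <= M.
  by have [M M0 HM] := @test_real_bump_bound R w; exists M.
have B0 w : 0 <= B w by have [] := HB w.
pose N := \sum_(i : bool) \sum_(j : bool) B [:: j; i].
have N0 : 0 <= N by apply: sumr_ge0 => i _; exact: sumr_ge0.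
have BN i j : B [:: j; i] <= N.
  by have := @le_double_sum_bool R (fun i j => B [:: j; i]) 0 i j (lexx _) (fun _ _ => B0 _); rewrite add0r.
(* The 1 makes [M] positive, and [2 * N] covers the Laplacian, a sum of two second derivatives. *)
pose M := 1 + B [::] + (B [:: true] + B [:: false]) + 2 * N.
have sb := @smooth_bump R.
have bound c r p (w : seq bool) (x : R) : 0 < r -> B w <= x ->
    `|iter_partial (zeta c r) w p| <= x / r ^+ size w.
  move=> r0 Bx; rewrite (iter_partial_rescale r c w sb).
  have rV : 0 <= r^-1 ^+ size w by rewrite exprn_ge0// invr_ge0 ltW.
  rewrite normrM (ger0_norm rV) mulrC -exprVn; apply: ler_wpM2r => //.
  exact: le_trans ((HB w).2 _) Bx.
exists M.
  by rewrite /M; have := B0 [::]; have := B0 [:: true]; have := B0 [:: false]; lra.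
have M0 : B [::] <= M.
  by rewrite /M; have := B0 [:: true]; have := B0 [:: false]; lra.
have M1 i : B [:: i] <= M.
  by case: i; rewrite /M; have := B0 [::]; have := B0 [:: true]; have := B0 [:: false]; lra.
have MN : 2 * N <= M.
  by rewrite /M; have := B0 [::]; have := B0 [:: true]; have := B0 [:: false]; lra.
have M2 i j : B [:: j; i] <= M.
  by apply: le_trans (BN i j) _; apply: le_trans MN; rewrite mulr2n mulrDl mul1r lerDl.
move=> c r r0 p; split.
- by have := bound c r p [::] _ r0 M0; rewrite expr0 divr1.
- by move=> i; have := bound c r p [:: i] _ r0 (M1 i); rewrite expr1.
- by move=> i j; exact: (bound c r p [:: j; i] _ r0 (M2 i j)).
have -> : Lap (zeta c r) p = iter_partial (zeta c r) [:: true; true] p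
    + iter_partial (zeta c r) [:: false; false] p.
  exact: (congr1 (@^~ p) (LapE _)).
apply: le_trans (ler_normD _ _) _.
apply: le_trans (lerD (bound c r p _ _ r0 (BN true true)) (bound c r p _ _ r0 (BN false false))) _.
rewrite -mulrDl; apply: ler_wpM2r; first by rewrite invr_ge0 exprn_ge0// ltW.
by apply: le_trans MN; rewrite [in leRHS]mulr2n mulrDl mul1r.
Qed.

End bumps.

Section initial_datum.
Variables (R : realType) (Omega : set (R * R)).
Notation mR := (measurableTypeR R).
Notation mu2 := (leb2 R).
Hypotheses (bO : bounded_domain Omega).

Let oO : open Omega. Proof. by case: bO. Qed.
Let mO : measurable (Omega : set (mR * mR)) := open_measurable_plane oO.
Let Ooo : (mu2 Omega < +oo)%E.
Proof. by apply: bounded_measure => //; case: bO. Qed.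

Lemma Lap_zeta_square_lower : exists2 k : R * R, 0 < k.1 /\ 0 < k.2 <= 1 &
  forall (c : R * R) (r : R), 0 < r -> forall p, closed_square c (k.2 * r) p ->
  r^-1 ^+ 4 * k.1 <= Lap (zeta c r) p ^+ 2.
Proof.
have [k [k1 k2] Hk] := @Lap_bump_lower R; exists k => // c r r0 p /closed_squareP[h1 h2].
have -> : Lap (zeta c r) p = r^-1 ^+ 2 * Lap (@base_bump R) (r^-1 *: (p - c)).
  exact: (congr1 (@^~ p) (Lap_rescale r c (@smooth_bump R))).
rewrite exprMn -exprM; apply: ler_wpM2l; first by rewrite exprn_ge0// invr_ge0 ltW.
have rV : `|r^-1| = r^-1 by rewrite gtr0_norm ?invr_gt0.
apply: Hk; rewrite /GRing.scale/= normrM rV mulrC ler_pdivrMr//.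
Qed.

(** The weighted pieces have bounded second derivatives, which gives [inH2]; together with their
    first derivatives they are [O(r n)], which gives [inH10]. *)
Lemma exists_initial_datum : exists (xi : R * R -> R) (c : nat -> R * R) (r : nat -> R) (C k : R),
  [/\ inH2 Omega (fun p => (xi p)%:C), inH10 Omega (fun p => (xi p)%:C), 0 < k, 0 <= C &
    [/\ forall n, 0 < r n,
      forall D, compact D -> D `<=` Omega -> exists N : nat, forall n, (N <= n)%N ->
        test_real (Omega `\` D) (zeta (c n) (r n)),
      forall e : R, 0 < e -> exists N : nat, forall n, (N <= n)%N -> r n < e,
      forall n, k <= rpair Omega (fun p => (xi p)%:C) (Lap (Lap (zeta (c n) (r n)))) &
      forall n, `|rpair Omega (fun p => (xi p)%:C) (Lap (zeta (c n) (r n)))| <= C * r n /\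
        sq_norm mu2 Omega (zeta (c n) (r n)) <= C * r n]].
Proof.
have [c [r [r01 rO dS fS rS]]] := boundary_squares bO.
have [M M0 HM] := @zeta_bounds R.
have [k [k1 /andP[k20 k21]] Hk] := Lap_zeta_square_lower.
have r0 n : 0 < r n by have /andP[] := r01 n.
have r1 n : r n <= 1 by have /andP[] := r01 n.
pose S n := closed_square (c n) (r n).
pose z n := zeta (c n) (r n).
pose F n (p : R * R) := r n ^+ 2 * z n p.
have sz n : smooth (z n) by exact: smooth_zeta.
have smF n : smooth (F n) by exact: smoothZ.
have cS n : compact (S n) by exact: compact_square.
have sF : supported S F by move=> n p np; rewrite /F /z zeta_off// mulr0.
have tz n : test_real Omega (z n) by exact: test_real_zeta.
have DF i n p : 'D_(axis R i) (F n) p = r n ^+ 2 * 'D_(axis R i) (z n) p.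
  exact: (congr1 (@^~ p) (iter_partialZ (r n ^+ 2) [:: i] (sz n))).
have DDF i j n p : 'D_(axis R j) ('D_(axis R i) (F n)) p =
    r n ^+ 2 * 'D_(axis R j) ('D_(axis R i) (z n)) p.
  exact: (congr1 (@^~ p) (iter_partialZ (r n ^+ 2) [:: j; i] (sz n))).
have sq (a : R) n : `|r n ^+ 2 * a| = r n ^+ 2 * `|a|.
  by rewrite normrM [`|_ ^+ _|]ger0_norm// exprn_ge0// ltW.
have rr n : r n ^+ 2 <= r n by rewrite expr2 ler_piMr// ltW.
have b0 n p : `|F n p| <= M * r n.
  have [h _ _ _] := HM (c n) _ (r0 n) p; rewrite /F sq mulrC.
  by apply: ler_pM => //; rewrite exprn_ge0// ltW.
have b1 i n p : `|'D_(axis R i) (F n) p| <= M * r n.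
  have [_ h _ _] := HM (c n) _ (r0 n) p; rewrite DF sq.
  apply: le_trans (ler_wpM2l _ (h i)) _; first by rewrite exprn_ge0// ltW.
  by rewrite [leLHS](_ : _ = M * r n)//; field; rewrite gt_eqF.
have b2 i j n p : `|'D_(axis R j) ('D_(axis R i) (F n)) p| <= M.
  have [_ _ h _] := HM (c n) _ (r0 n) p; rewrite DDF sq.
  apply: le_trans (ler_wpM2l _ (h i j)) _; first by rewrite exprn_ge0// ltW.
  by rewrite [leLHS](_ : _ = M)//; field; rewrite gt_eqF.
have Mr n : M * r n <= M by rewrite ler_piMr// ltW.
have b0' n p : `|F n p| <= M by exact: le_trans (b0 n p) (Mr n).
have b1' i n p : `|'D_(axis R i) (F n) p| <= M by exact: le_trans (b1 i n p) (Mr n).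
(* Disjointness of the squares: a function supported in the [n]-th one sees only the [n]-th piece of
   the datum. *)
have xiE n (eta : R * R -> R) : (forall p, ~ S n p -> eta p = 0) ->
    rpair Omega (fun p => (dglue S F p)%:C) eta =
    \int[mu2]_(p in Omega) (r n ^+ 2 * (z n p * eta p)).
  move=> e0; apply: eq_Rintegral => p _ /=.
  have [Sp|nS] := pselect (S n p); last by rewrite e0// !mulr0.
  by rewrite (dglueE dS F Sp) /F mulrA.
have Loff n p : ~ S n p -> Lap (z n) p = 0.
  by apply: (Lap_off (cS n)) => q; exact: zeta_off.
have cz n : continuous (z n) by exact: smooth_continuous.
have cL n : continuous (Lap (z n)) by apply: smooth_continuous; exact: smooth_Lap.
(* [4 * M ^ 2] bounds the pairing with [Lap (z n)], being [M ^ 2] times the area [(2 * r n) ^ 2]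
   together with [r n ^ 2 <= r n]; [2 * M] is for the L_2 norm of [z n]. *)
pose C := 4 * M ^+ 2 + 2 * M.
(* The lower bound is the product of the weight [r ^ 2], of [k.1 / r ^ 4] and of the area
   [(2 * k.2 * r) ^ 2], in which [r] cancels. *)
exists (dglue S F), c, r, C, (k.1 * (2 * k.2) ^+ 2).
split.
- exact: (@dglue_inH2 R Omega S oO Ooo cS dS fS F M).
- apply: (@dglue_inH10 R Omega S oO Ooo cS rO dS fS F M) => // e e0.
  have [N HN] := rS (e / M) (divr_gt0 e0 M0); exists N => n Nn.
  have h : M * r n <= e by rewrite mulrC -ler_pdivlMr// ltW// HN.
  by split => [p|i p]; [exact: le_trans (b0 n p) h|exact: le_trans (b1 i n p) h].
- by rewrite mulr_gt0// exprn_gt0// mulr_gt0.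
- by rewrite /C addr_ge0// mulr_ge0// ?exprn_ge0// ltW.
split => //.
- move=> D cD DO; have [N HN] := fS D cD DO; exists N => n Nn.
  by apply: test_real_zeta => // p Sp; split; [exact: rO Sp|exact: HN Sp].
- move=> n; have LLoff p : ~ S n p -> Lap (Lap (z n)) p = 0.
    by apply: (Lap_off (cS n)) => q; exact: Loff.
  rewrite (xiE n _ LLoff).
  have tL := test_real_Lap (tz n).
  have i1 : mu2.-integrable Omega (EFin \o (fun p => z n p * Lap (Lap (z n)) p)).
    have j := sq_integrableM mO (test_sqi oO Ooo (tz n)) (test_sqi oO Ooo (test_real_Lap tL)); exact: j.
  rewrite RintegralZl// (Lap_symmetric oO Ooo (tz n) tL).
  have i2 : mu2.-integrable Omega (EFin \o (fun p => Lap (z n) p * Lap (z n) p)).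
    have j := sq_integrableM mO (test_sqi oO Ooo tL) (test_sqi oO Ooo tL); exact: j.
  have kr : 0 <= k.2 * r n by rewrite mulr_ge0// ltW.
  have sO : closed_square (c n) (k.2 * r n) `<=` Omega.
    move=> p /closed_squareP[h1 h2]; apply: (rO n); apply/closed_squareP.
    have h : k.2 * r n <= r n by rewrite ler_piMl// ltW.
    by split; [exact: le_trans h1 h|exact: le_trans h2 h].
  have := @square_integral_ge R Omega oO Ooo (c n) (k.2 * r n) _ ((r n)^-1 ^+ 4 * k.1) kr sO i2.
  move=> /(_ (fun p => sqr_ge0 _) (Hk _ _ (r0 n))) h.
  have r2 : 0 <= r n ^+ 2 by rewrite exprn_ge0// ltW.
  apply: le_trans (ler_wpM2l r2 h).
  by rewrite [leRHS](_ : _ = k.1 * (2 * k.2) ^+ 2)//; field; rewrite gt_eqF.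
- move=> n; split.
    rewrite (xiE n _ (Loff n)).
    have B p : `|r n ^+ 2 * (z n p * Lap (z n) p)| <= M ^+ 2.
      have [h1 _ _ h2] := HM (c n) _ (r0 n) p; rewrite sq normrM.
      apply: le_trans (ler_wpM2l _ (ler_pM _ _ h1 h2)) _ => //; first by rewrite exprn_ge0// ltW.
      by rewrite [leLHS](_ : _ = M ^+ 2)//; field; rewrite gt_eqF.
    have cz' : continuous (fun p => r n ^+ 2 * (z n p * Lap (z n) p)).
      move=> p; have h1 := continuousM (cz n p) (cL n p).
      have h2 : {for p, continuous (fun _ : R * R => r n ^+ 2)} by exact: cst_continuous.
      have h := continuousM h2 h1; exact: h.
    apply: le_trans (square_integral_le oO Ooo (ltW (r0 n)) (rO n) cz' B _) _.
      by move=> p /Loff ->; rewrite !mulr0.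
    have := rr n; have M2 : 0 <= M ^+ 2 by rewrite exprn_ge0// ltW.
    move=> h; apply: (@le_trans _ _ (4 * M ^+ 2 * r n)); last first.
      by apply: ler_wpM2r; [exact: ltW|rewrite /C lerDl mulr_ge0// ltW].
    rewrite exprMn [leLHS](_ : _ = 4 * M ^+ 2 * r n ^+ 2); last by ring.
    by rewrite ler_wpM2l// mulr_ge0.
  have B p : `|z n p ^+ 2| <= M ^+ 2.
    have [h1 _ _ _] := HM (c n) _ (r0 n) p; rewrite normrX lerXn2r ?nnegrE//.
    by rewrite ltW.
  have cz' : continuous (fun p => z n p ^+ 2).
    by move=> p; have h := continuousM (cz n p) (cz n p); exact: h.
  have h := square_integral_le oO Ooo (ltW (r0 n)) (rO n) cz' B.
  have {}h : \int[mu2]_(p in Omega) (z n p ^+ 2) <= (2 * M * r n) ^+ 2.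
    apply: le_trans (ler_norm _) _; apply: le_trans (h _) _.
      by move=> p np; rewrite /z zeta_off// expr0n.
    by rewrite [leLHS](_ : _ = (2 * M * r n) ^+ 2)//; ring.
  have s0 : 0 <= 2 * M * r n by rewrite !mulr_ge0// ltW.
  rewrite /sq_norm; apply: le_trans (ler_wsqrtr h) _.
  rewrite sqrtr_sqr ger0_norm// /C; apply: ler_wpM2r; first exact: ltW.
  by rewrite lerDr mulr_ge0// exprn_ge0// ltW.
Qed.

End initial_datum.

(** * Uncontrollability *)

Section uncontrollability.
Variables (R : realType) (Omega : set (R * R)) (K : R -> R).
Variables (G : set R[i]^o) (Khat : R[i]^o -> R[i]^o) (lambda0 : R[i]^o).
Notation mu2 := (leb2 R).
Notation halfline := [set t : R | 0 <= t].

(** [laplace_root_coef] is used at [Lap eta] and not at [eta]: its left side is then controlled by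
    [rpair_theta_Lap_bound] in terms of the L_2 norm of [eta], with [E] independent of [eta]. [D]
    comes first, so that test functions are chosen after it; [eta0] determines [a0] and [b0]. *)
Lemma rpair_coef_relation (xi : R * R -> R) (T : R) (u theta : R -> planefun R) :
  open Omega -> (mu2 Omega < +oo)%E -> C2_halfline K -> laplace_extension K G Khat ->
  G lambda0 -> lambda0 != 0 -> Khat lambda0 = 0 ->
  inL2 Omega (fun p => (xi p)%:C) ->
  control Omega T u -> solution Omega K (fun p => (xi p)%:C) u theta ->
  compact_support_in_time Omega theta ->
  exists D, [/\ compact D, D `<=` Omega &
    forall eta0, test_real (Omega `\` D) eta0 -> rpair Omega (fun p => (xi p)%:C) eta0 != 0 ->
    exists (E : R) (a0 b0 : R[i]), [/\ 0 <= E, b0 != 0 &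
      forall eta, test_real (Omega `\` D) eta ->
        normc (a0 * (rpair Omega (fun p => (xi p)%:C) (Lap eta))%:C +
               b0 * (rpair Omega (fun p => (xi p)%:C) (Lap (Lap eta)))%:C)
          <= E * sq_norm mu2 Omega eta]].
Proof.
move=> oO Ooo [K1 [K2 [dK1 _ _]]] [oG cG dK [a Ha]] Gl0 l00 Kl0 xi2 [u2 _ _ [D [cD DO uD]]].
move=> [th cth th0 [theta' [th'2 dth cth' eqn]]] [T1 T10 thT].
have cK := derivative_halfline_continuous dK1.
have th2 (t : R) : 0 <= t -> inH2 Omega (theta t) by move=> /th[].
exists D; split => // eta0 W0 xi0.
pose W eta := test_real (Omega `\` D) eta.
have WO eta : W eta -> test_real Omega eta by apply: test_real_sub => p [].
have WL eta : W eta -> W (Lap eta) by exact: test_real_Lap.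
pose h eta (t : R) := rpair Omega (theta t) eta.
pose h1 eta (t : R) := rpair Omega (theta' t) eta.
have ch0 eta : W eta -> {within halfline, continuous (h eta)}.
  by move=> /WO te; exact: (rpair_theta_continuous oO Ooo th2 cth te).
have ch10 eta : W eta -> {within halfline, continuous (h1 eta)}.
  by move=> /WO te; exact: (rpair_theta'_continuous oO Ooo th'2 cth' te).
have sub : `[0, T1]%classic `<=` halfline by move=> t /=; rewrite in_itv/= => /andP[].
have ch eta : W eta -> {within `[0, T1], continuous (h eta)}.
  by move=> /ch0; exact: continuous_subspaceW.
have ch1 eta : W eta -> {within `[0, T1], continuous (h1 eta)}.
  by move=> /ch10; exact: continuous_subspaceW.
have dh eta (t : R) : W eta -> 0 < t -> is_derive t 1 (h eta) (h1 eta t).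
  by move=> /WO te t0; exact: (is_derive_rpair_theta oO Ooo th2 th'2 dth te t0).
have hT eta (t : R) : W eta -> T1 <= t -> h eta t = 0.
  move=> /WO te Tt; have t0 : 0 <= t by rewrite (le_trans (ltW T10)).
  have i1 := (th2 t t0).1.1; have i0 := inL2_0 oO Ooo.
  rewrite /h (ae_eq_rpair oO Ooo i1 i0 te (A := Omega) _ _ (thT t Tt)) //.
  rewrite /rpair; under eq_Rintegral do rewrite mul0r.
  by rewrite Rintegral_cst ?mul0r//; exact: open_measurable_plane.
have h0 eta : W eta -> h eta 0 = rpair Omega (fun p => (xi p)%:C) eta.
  move=> /WO te; have i1 := (th2 0 (lexx _)).1.1.
  by rewrite /h (ae_eq_rpair oO Ooo i1 xi2 te (A := Omega) _ _ th0).
(* Strictly past [T1] the function [h eta] is zero in a neighbourhood, so its derivative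
   vanishes. *)
have h1T eta (t : R) : W eta -> T1 < t -> h1 eta t = 0.
  move=> We Tt; have d := dh eta t We (lt_trans T10 Tt).
  rewrite -(@derive_val _ _ _ _ _ _ _ d) (@near_eq_derive _ _ _ _ (fun=> 0)); first exact: derive_cst.
  by near=> s; apply: hT => //; apply: ltW; near: s; exact: lt_nbhsr.
have hA eta l : W eta -> l * finite_laplace T1 (h eta) l -
    (rpair Omega (fun p => (xi p)%:C) eta)%:C = finite_laplace T1 (h1 eta) l.
  move=> We; rewrite -(h0 eta We); apply: laplace_derivative => //; [exact: ch|exact: ch1| |exact: hT].
  by move=> t /andP[t0 _]; exact: dh.
have hK eta (l : R[i]) : W eta -> a < complex.Re l ->
    finite_laplace T1 (h1 eta) l = Khat l * finite_laplace T1 (h (Lap eta)) l.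
  (* In the half-plane [Khat] is the Laplace integral, absolutely convergent as Fubini requires. *)
  move=> We /Ha[_ absK ->]; apply: laplace_convolution => //.
  - by apply: ch0; exact: WL.
  - exact: ch1.
  - by move=> s Ts; apply: hT => //; exact: WL.
  - by move=> t t0; exact: (rpair_theta'E oO Ooo cK th2 cth th'2 eqn u2 uD We t0).
  - by move=> t; exact: h1T.
have GRe (z : R[i]) : a < complex.Re z -> G z by move=> /Ha[].
have [m [a0 [b0 [b00 coef]]]] := laplace_root_coef T10 WL ch ch1 hA hK oG cG dK GRe Gl0 l00 Kl0 W0 xi0.
have [Cm Cm0 HCm] := laplace_coef_bound T10 lambda0 m.
have [C HC] := rpair_theta_Lap_bound oO Ooo th2 cth T1.
exists (Cm * `|C|), a0, b0; split => //; first by rewrite mulr_ge0.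
move=> eta We; have WLe := WL _ We; rewrite -(coef _ WLe) -mulrA.
apply: HCm => [|t tT]; first exact: ch.
apply: le_trans (HC t tT eta (WO _ We)) _.
by apply: ler_wpM2r; [exact: sqrtr_ge0|exact: ler_norm].
Unshelve. all: by end_near. Qed.

(** The relation is solved for its [b0] term: all the rest is [O(r)], while that term stays above
    [normc b0 * k]. This is impossible for small [r]. *)
Lemma normc_combination_le (a0 b0 : R[i]) (x y s E C k r : R) : 0 <= E ->
  normc (a0 * x%:C + b0 * y%:C) <= E * s -> `|x| <= C * r -> s <= C * r -> k <= y ->
  normc b0 * k <= r * (E * C + normc a0 * C).
Proof.
move=> E0 H hx hs hy.
have h1 : normc (b0 * y%:C) <= E * s + normc a0 * `|x|.
  have -> : b0 * y%:C = (a0 * x%:C + b0 * y%:C) + (- a0) * x%:C by rewrite mulNr addrC addKr.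
  by apply: le_trans (le_normcD _ _) _; rewrite [normc (- a0 * _)]normcM normcN normc_real lerD2r.
rewrite normcM normc_real in h1.
have h2 : normc b0 * k <= normc b0 * `|y|.
  by apply: ler_wpM2l; [exact: normc_ge0|exact: le_trans hy (ler_norm _)].
apply: (le_trans h2); apply: (le_trans h1).
have -> : r * (E * C + normc a0 * C) = E * (C * r) + normc a0 * (C * r) by ring.
by apply: lerD; apply: ler_wpM2l => //; exact: normc_ge0.
Qed.

End uncontrollability.

Theorem mainTheorem1 (R : realType) (Omega : set (R * R)) (K : R -> R) (mu : R)
    (G : set R[i]^o) (Khat : R[i]^o -> R[i]^o) (lambda0 : R[i]^o) :
  bounded_domain Omega -> C2_boundary Omega ->
  C2_halfline K -> K 0 = mu -> 0 < mu ->
  laplace_extension K G Khat ->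
  G lambda0 -> lambda0 != 0 -> Khat lambda0 = 0 ->
  exists xi : planefun R, inH2 Omega xi /\ inH10 Omega xi /\
    forall (T : R) (u : R -> planefun R), 0 < T -> control Omega T u ->
    forall theta : R -> planefun R, solution Omega K xi u theta ->
    ~ compact_support_in_time Omega theta.
Proof.
move=> bO _ K2 _ _ LE Gl0 l00 Kl0.
have [oO _ _ bdO] := bO.
have Ooo := bounded_measure bdO (open_measurable_plane oO).
have [xi [c [r [C [k [xH2 xH10 k0 C0 [r0 tz rS lower upper]]]]]]] := exists_initial_datum bO.
exists (fun p => (xi p)%:C); split => //; split => // T u _ ctl theta sol cst.
have [D [cD DO rel]] := rpair_coef_relation oO Ooo K2 LE Gl0 l00 Kl0 xH2.1.1 ctl sol cst.
have [N HN] := tz D cD DO.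
pose z n := zeta (c n) (r n).
pose X eta := rpair Omega (fun p => (xi p)%:C) eta.
have low n : k <= X (Lap (Lap (z n))) by exact: lower.
(* As [eta0] serves a test function off [D] whose pairing with the datum is at least [k], hence
   nonzero. *)
have [|//|E [a0 [b0 [E0 b00 HE]]]] := rel (Lap (Lap (z N))).
  by do 2 apply: test_real_Lap; exact: HN.
  by rewrite gt_eqF// (lt_le_trans k0 (low N)).
have nb : 0 < normc b0 by rewrite normc_gt0.
pose B := E * C + normc a0 * C.
have B0 : 0 <= B by rewrite addr_ge0// mulr_ge0// normc_ge0.
have B1 : 0 < B + 1 by rewrite ltr_wpDl.
have [N' HN'] := rS (normc b0 * k / (B + 1)) (divr_gt0 (mulr_gt0 nb k0) B1).
(* [N] puts the bump off the support of the control; [N'] makes [r n * (B + 1)] smaller than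
   [normc b0 * k]. *)
pose n := maxn N N'.
have := HN' n (leq_maxr _ _); rewrite ltr_pdivlMr// ltNge => /negP; apply.
have [u1 u2] := upper n.
have h := normc_combination_le E0 (HE (z n) (HN n (leq_maxl _ _))) u1 u2 (lower n).
by apply: (le_trans h); apply: ler_wpM2l; [exact: ltW|rewrite lerDl].
Qed.
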